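(* Let $\Omega_1\subset\mathbb{C}^n$ and $\Omega_2\subset\mathbb{C}^m$ be bounded domains with Bergman metrics $g_{B_1}$ and $g_{B_2}$, respectively. Let $\mathcal{B}_2$ and $P_2$ be the Bergman kernel and the Berezin kernel of $\Omega_2$. Suppose that there exists a constant $\alpha>0$ such that $$\alpha\,|\partial_Y\log P_2(w,\zeta)|^2\le g_{B_2}(Y,Y)\left(1-\left(\frac{|\mathcal{B}_2(w,\zeta)|^2}{\mathcal{B}_2(w,w)\,\mathcal{B}_2(\zeta,\zeta)}\right)^{\alpha}\right)$$ for all $w,\zeta\in\Omega_2$ (with $P_2(w,\zeta)\ne0$) and all $Y\in T^{1,0}_w\Omega_2$. Then for any holomorphic map $f:\Omega_1\to\Omega_2$, $$f^*g_{B_2}\le\frac1\alpha\,g_{B_1},$$ i.e. $g_{B_2}(df(X),df(X))\le\frac1\alpha g_{B_1}(X,X)$ for all $z\in\Omega_1$ and $X\in T^{1,0}_z\Omega_1$.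
   Context: For a bounded domain $\Omega\subset\mathbb{C}^n$, $A^2(\Omega)$ is the Hilbert space of holomorphic functions on $\Omega$ that are square integrable for Lebesgue measure. The Bergman kernel is $\mathcal{B}(z,\xi)=\sum_j\phi_j(z)\overline{\phi_j(\xi)}$ for any orthonormal basis $\{\phi_j\}$ of $A^2(\Omega)$; it is holomorphic in $z$, anti-holomorphic in $\xi$, and $\mathcal{B}(z,z)>0$. The Bergman metric is $g_B(X,Y)=\sum_{j,k}\frac{\partial^2\log\mathcal{B}(z,z)}{\partial z_j\partial\bar z_k}X_j\overline{Y_k}$ for $X,Y\in T^{1,0}_z\Omega\cong\mathbb{C}^n$; it is positive definite. The Berezin kernel is $P(z,\xi)=|\mathcal{B}(z,\xi)|^2/\mathcal{B}(z,z)$. For $Y\in T^{1,0}_w\Omega_2$, $\partial_Y=\sum_jY_j\frac{\partial}{\partial w_j}$ acts on the first variable $w$. *)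

(* Defs.v *)
From HB Require Import structures.
From mathcomp Require Import all_boot all_order all_algebra.
From mathcomp Require Import all_classical all_reals all_analysis.
From mathcomp Require Import complex.

Set Implicit Arguments.
Unset Strict Implicit.
Unset Printing Implicit Defensive.

Import Order.TTheory GRing.Theory Num.Theory numFieldNormedType.Exports.

Local Open Scope classical_set_scope.
Local Open Scope ring_scope.
Local Open Scope complex_scope.

(* [R[i]] as a [numFieldType]: this is what gives it the canonical topology of
   a numeric field (distance |x - y|) and makes C^n = 'rV[Cplx R]_n a normed
   space over it, so that [differentiable] is complex differentiability. *)
Definition Cplx (R : realType) : numFieldType := R[i].

Section ProductMeasure.
Context d1 d2 (T1 : measurableType d1) (T2 : measurableType d2) (R : realType).
Context (m1 : {sigma_finite_measure set T1 -> \bar R}).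
Context (m2 : {sigma_finite_measure set T2 -> \bar R}).

(* The canonical structures on [m1 \x m2] only make it sigma-finite when m1 and
   m2 are subprobabilities; this alias makes it sigma-finite in general. *)
Definition prod_measure : set (T1 * T2) -> \bar R := (m1 \x m2)%E.

HB.instance Definition _ := Measure.on prod_measure.

Let prod_measure_sigma_finite : sigma_finite setT prod_measure.
Proof.
have /sigma_finiteP[F [TF ndF Foo]] := sigma_finiteT m1.
have /sigma_finiteP[G [TG ndG Goo]] := sigma_finiteT m2.
exists (fun n => F n `*` G n).
  rewrite -setXTT TF TG predeqE => -[x y]; split.
    move=> [/= [n _ Fnx] [k _ Gky]]; exists (maxn n k) => //; split.
    - by move: x Fnx; exact/subsetPset/ndF/leq_maxl.
    - by move: y Gky; exact/subsetPset/ndG/leq_maxr.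
  by move=> [n _ []/= ? ?]; split; exists n.
move=> k; have [? ?] := Foo k; have [? ?] := Goo k.
split; first exact: measurableX.
rewrite /prod_measure product_measure1E// lte_mul_pinfty//.
by rewrite ge0_fin_numE.
Qed.

HB.instance Definition _ :=
  Measure_isSigmaFinite.Build _ _ _ prod_measure prod_measure_sigma_finite.

End ProductMeasure.

Section TupleMeasure.
Context d (T : measurableType d) (R : realType).

Definition tuple_cons n (x : T * n.-tuple T) : n.+1.-tuple T :=
  [tuple of x.1 :: x.2].

Lemma measurable_tuple_cons n :
  measurable_fun [set: T * n.-tuple T] (@tuple_cons n).
Proof. exact: (measurable_cons measurable_fst measurable_snd). Qed.

Section Step.
Context (n : nat) (mu : {sigma_finite_measure set T -> \bar R}).
Context (nu : {sigma_finite_measure set (n.-tuple T) -> \bar R}).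

Definition cons_measure : set (n.+1.-tuple T) -> \bar R :=
  pushforward (prod_measure mu nu) (@tuple_cons n).

Let preim_measurable (A : set (n.+1.-tuple T)) :
  measurable A -> measurable (@tuple_cons n @^-1` A).
Proof.
by move=> mA; rewrite -[X in measurable X]setTI; exact: measurable_tuple_cons.
Qed.

Let cons_measure0 : cons_measure set0 = 0%E.
Proof. by rewrite /cons_measure /pushforward preimage_set0 measure0. Qed.

Let cons_measure_ge0 A : (0 <= cons_measure A)%E.
Proof. exact: (@measure_ge0 _ _ _ (prod_measure mu nu)). Qed.

Let cons_measure_sigma_additive : semi_sigma_additive cons_measure.
Proof.
move=> F mF tF mUF; rewrite /cons_measure /pushforward preimage_bigcup.
apply: (@measure_semi_sigma_additive _ _ _ (prod_measure mu nu) (fun k => @tuple_cons n @^-1` F k)).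
- by move=> k; exact: preim_measurable.
- apply/trivIsetP => /= i j _ _ ij; rewrite -preimage_setI.
  by move/trivIsetP : tF => /(_ _ _ _ _ ij) ->//; rewrite preimage_set0.
- by rewrite -preimage_bigcup; exact: preim_measurable.
Qed.

HB.instance Definition _ := isMeasure.Build _ _ _ cons_measure
  cons_measure0 cons_measure_ge0 cons_measure_sigma_additive.

Let cons_measure_sigma_finite : sigma_finite setT cons_measure.
Proof.
have [F FT Foo] := sigma_finiteT (prod_measure mu nu).
pose uncons (t : n.+1.-tuple T) : T * n.-tuple T :=
  (thead t, [tuple of behead t]).
have unconsK : cancel (@tuple_cons n) uncons.
  move=> [x t]; rewrite /uncons /tuple_cons theadE; congr pair.
  exact/val_inj.
have muncons : measurable_fun setT uncons.
  apply/measurable_fun_pairP; split.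
    exact: (@measurable_tnth _ T n.+1 ord0).
  exact: measurable_behead.
exists (fun k => uncons @^-1` F k).
  by rewrite -preimage_bigcup -FT preimage_setT.
move=> k; have [mFk Fkoo] := Foo k; split.
  by rewrite -[X in measurable X]setTI; exact: muncons.
rewrite /cons_measure /pushforward -comp_preimage.
by have -> : uncons \o @tuple_cons n = id by exact/funext.
Qed.

HB.instance Definition _ :=
  Measure_isSigmaFinite.Build _ _ _ cons_measure cons_measure_sigma_finite.

End Step.

(* the n-fold product measure mu \x ... \x mu *)
Fixpoint tuple_measure (mu : {sigma_finite_measure set T -> \bar R}) n :
    {sigma_finite_measure set (n.-tuple T) -> \bar R} :=
  match n with
  | 0 => \d_([tuple] : 0.-tuple T)
  | n'.+1 => cons_measure mu (tuple_measure mu n')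
  end.

End TupleMeasure.

Section Bergman.
Context (R : realType).
Local Notation C := (Cplx R).
Local Notation ci := ('i%C : C).

Definition holomorphic_on (V W : normedModType C) (Omega : set V) (f : V -> W) :=
  forall z, Omega z -> differentiable f z.

(* Lebesgue measure on C^n, a point of C^n being given by the n-tuple of the
   pairs of real coordinates (x_j, y_j) with z_j = x_j + i y_j. *)
Definition lebesgueC n :=
  tuple_measure (prod_measure (@lebesgue_measure R) (@lebesgue_measure R)) n.

Definition of_coords n (t : n.-tuple (R * R)) : 'rV[C]_n :=
  \row_j ((tnth t j).1 +i* (tnth t j).2).

Section Domain.
Context (n : nat).
Implicit Types (Omega : set 'rV[C]_n) (f g : 'rV[C]_n -> C).
Implicit Types (B : 'rV[C]_n -> 'rV[C]_n -> C).

Definition bounded_domain Omega :=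
  [/\ Omega !=set0, open Omega, connected Omega & bounded_set Omega].

Definition L2norm_sq Omega f : \bar R :=
  (\int[lebesgueC n]_(t in @of_coords n @^-1` Omega)
     ((Normc.normc (f (of_coords t))) ^+ 2)%:E)%E.

Definition L2inner Omega f g : C :=
  let h t : C := f (of_coords t) * (g (of_coords t))^*%C in
  (\int[lebesgueC n]_(t in @of_coords n @^-1` Omega) complex.Re (h t)) +i*
  (\int[lebesgueC n]_(t in @of_coords n @^-1` Omega) complex.Im (h t)).

(* Elements of A^2(Omega) are represented by total functions, of which only the
   restriction to Omega matters. *)
Definition bergman_space Omega : set ('rV[C]_n -> C) :=
  [set f | holomorphic_on Omega f /\ (L2norm_sq Omega f < +oo)%E].

(* A (countable) orthonormal basis indexed by J : pred nat, so that finite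
   dimension is not excluded; the completeness clause is the convergence in
   A^2(Omega) of the Fourier series of every element. *)
Definition orthonormal_basis Omega (J : pred nat) (phi : nat -> 'rV[C]_n -> C) :=
  [/\ forall j, J j -> bergman_space Omega (phi j),
      forall j k, J j -> J k -> L2inner Omega (phi j) (phi k) = (j == k)%:R
    & forall f, bergman_space Omega f ->
        (fun N => L2norm_sq Omega (fun z =>
           f z - \sum_(0 <= j < N | J j) L2inner Omega f (phi j) * phi j z))
        @ \oo --> 0%E].

(* The kernel does not depend on the basis, so requiring the expansion for one
   basis is the weakest way of saying that B is the Bergman kernel of Omega. *)
Definition is_bergman_kernel Omega B :=
  exists J phi, orthonormal_basis Omega J phi /\
    forall z xi, Omega z -> Omega xi ->
      (fun N => \sum_(0 <= j < N | J j) phi j z * (phi j xi)^*%C)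
      @ \oo --> B z xi.

(* derivative of u at z along the real line z + R v; with v = e_j and v = i e_j
   these are the partial derivatives in x_j and y_j *)
Definition real_deriv (u : 'rV[C]_n -> C) (v z : 'rV[C]_n) : C :=
  let u_ (t : R) := u (z + (t%:C : C) *: v) in
  derive1 (fun t : R => complex.Re (u_ t) : R) 0 +i*
  derive1 (fun t : R => complex.Im (u_ t) : R) 0.

Definition d_z (j : 'I_n) u z : C :=
  (real_deriv u (delta_mx 0 j) z -
   ci * real_deriv u (ci *: delta_mx 0 j) z) / 2.

Definition d_zbar (j : 'I_n) u z : C :=
  (real_deriv u (delta_mx 0 j) z +
   ci * real_deriv u (ci *: delta_mx 0 j) z) / 2.

Definition dpartial (Y : 'rV[C]_n) u z : C := \sum_j Y 0 j * d_z j u z.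

(* B z z is real for a Bergman kernel, hence the real parts below. *)
Definition bergman_metric B (z X Y : 'rV[C]_n) : C :=
  \sum_j \sum_k
    d_z j (d_zbar k (fun x => (ln (complex.Re (B x x)))%:C)) z *
    X 0 j * (Y 0 k)^*%C.

Definition berezin B (z xi : 'rV[C]_n) : R :=
  (Normc.normc (B z xi)) ^+ 2 / complex.Re (B z z).

End Domain.

End Bergman.

(* Main.v *)
(* Put w = f z, Y = 'd f z X, and write g1, g2 for the squared lengths of X, Y.
   The hypothesis bounds the gradient of log P_2(., zeta) by the metric, so by
   Gronwall's inequality along segments the set where B_2(., zeta) <> 0 is open
   and closed, and B_2 has no zeros. Hence F(xi), the conjugate of
   d_Y log P_2(w, f xi), is holomorphic in xi on Omega_1, with |F|^2 <= g2/alpha,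
   F(z) = 0 and dF(X) = g2. For phi in A^2 with phi(z) = 0 the Bergman metric
   satisfies |dphi(X)|^2 <= |phi|^2 B_1(z, z) g1. Applied to phi = F K_N, with K_N
   a partial sum of B_1(., z), it gives g2^2 <= (g2/alpha) g1 as N tends to oo. *)
From HB Require Import structures.
Require Import Defs.
From mathcomp Require Import all_boot all_order all_algebra.
From mathcomp Require Import all_classical all_reals all_analysis.
From mathcomp Require Import measurable_realfun complex.
From mathcomp Require Import ring lra.
Import Order.TTheory GRing.Theory Num.Theory numFieldNormedType.Exports.
Set Implicit Arguments.
Unset Strict Implicit.
Unset Printing Implicit Defensive.
Local Open Scope classical_set_scope.
Local Open Scope ring_scope.
Local Open Scope complex_scope.
Local Notation normc := Normc.normc.
Local Notation Re := complex.Re.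
Local Notation Im := complex.Im.

(** Each kernel is known only as the pointwise limit of its series along some orthonormal basis, so
    its regularity must be extracted from the norm of A^2. A mean value inequality bounds point
    evaluations; by duality the sums of |phi_j|^2 and |dphi_j|^2 are then locally bounded, uniformly
    in the number of terms, and locally bounded limits of holomorphic functions may be
    differentiated term by term. Holomorphy means complex differentiability at each point, with no
    continuity of the derivative, hence the start from Goursat's theorem. The constants of these
    estimates are crude and only provide finiteness; the sharp 1/alpha comes from Cauchy-Schwarz on
    Fourier coefficients and from exact identities for the metric. Gronwall is applied to the
    Berezin kernel and not to its logarithm, since the zeros to be excluded are where the logarithm
    degenerates. The conjugate in F is taken because d_Y log P_2(w, zeta) is antiholomorphic in
    zeta. A partial sum of B_1(., z) is convenient because its squared norm and its value at z are
    the same finite sum. *)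

Section ComplexNorm.
Variable R : realType.
Implicit Types (x y z : R[i]) (a b : R).

Lemma normc_ge0 x : 0 <= normc x.
Proof. by case: x => a b; exact: sqrtr_ge0. Qed.

Lemma normc_triangle x y : normc (x + y) <= normc x + normc y.
Proof. exact: le_normcD. Qed.

Lemma normcBC x y : normc (x - y) = normc (y - x).
Proof. by rewrite -normcN opprB. Qed.

Lemma normc_sqr x : normc x ^+ 2 = Re x ^+ 2 + Im x ^+ 2.
Proof. by case: x => a b /=; rewrite sqr_sqrtr// addr_ge0 ?sqr_ge0. Qed.

Lemma Re_le_normc x : `|Re x| <= normc x.
Proof.
rewrite -(@ler_pXn2r _ 2) ?nnegrE ?normc_ge0// normc_sqr real_normK ?num_real//.
by rewrite lerDl sqr_ge0.
Qed.

Lemma Im_le_normc x : `|Im x| <= normc x.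
Proof.
rewrite -(@ler_pXn2r _ 2) ?nnegrE ?normc_ge0// normc_sqr real_normK ?num_real//.
by rewrite lerDr sqr_ge0.
Qed.

Lemma normc_real a : normc a%:C = `|a|.
Proof. by rewrite /= expr0n addr0 sqrtr_sqr. Qed.

Lemma normci : normc ('i : R[i]) = 1.
Proof. by rewrite /= expr0n expr1n add0r sqrtr1. Qed.

Lemma normc_le_ReIm x : normc x <= `|Re x| + `|Im x|.
Proof.
rewrite [x in normc x]complexE; apply: (le_trans (normc_triangle _ _)).
by rewrite Normc.normcM normci mul1r !normc_real.
Qed.

Lemma ReD x y : Re (x + y) = Re x + Re y. Proof. by case: x; case: y. Qed.
Lemma ImD x y : Im (x + y) = Im x + Im y. Proof. by case: x; case: y. Qed.
Lemma ReN x : Re (- x) = - Re x. Proof. by case: x. Qed.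
Lemma ImN x : Im (- x) = - Im x. Proof. by case: x. Qed.
Lemma ReM x y : Re (x * y) = Re x * Re y - Im x * Im y.
Proof. by case: x; case: y. Qed.
Lemma ImM x y : Im (x * y) = Re x * Im y + Im x * Re y.
Proof. by case: x; case: y. Qed.
Lemma ReJ x : Re (x^*%C) = Re x. Proof. by case: x. Qed.
Lemma ImJ x : Im (x^*%C) = - Im x. Proof. by case: x. Qed.

Lemma complex_eqP x y : Re x = Re y -> Im x = Im y -> x = y.
Proof. by case: x => ? ?; case: y => ? ? /= -> ->. Qed.

Lemma normcE x : `|x| = (normc x)%:C.
Proof. by case: x. Qed.

Lemma normcJ x : normc (x^*%C) = normc x.
Proof. by case: x => a b /=; rewrite sqrrN. Qed.

Lemma normcX x n : normc (x ^+ n) = normc x ^+ n.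
Proof.
by elim: n => [|n IH]; rewrite ?expr0 ?Normc.normc1// !exprS Normc.normcM IH.
Qed.

Lemma normc_eq0 x : (normc x == 0) = (x == 0).
Proof.
by apply/eqP/eqP => [/Normc.eq0_normc//|->]; rewrite Normc.normc0.
Qed.

Lemma normc_gt0 x : (0 < normc x) = (x != 0).
Proof. by rewrite lt_neqAle normc_ge0 andbT eq_sym normc_eq0. Qed.

Lemma mulcJ x : x * x^*%C = (normc x ^+ 2)%:C.
Proof. by rewrite normc_sqr; apply: complex_eqP; case: x => a b /=; ring. Qed.

Lemma Re_dist x y : `|Re x - Re y| <= normc (x - y).
Proof. by rewrite -ReN -ReD Re_le_normc. Qed.

Lemma Im_dist x y : `|Im x - Im y| <= normc (x - y).
Proof. by rewrite -ImN -ImD Im_le_normc. Qed.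

Lemma normc_dist x y : `|normc x - normc y| <= normc (x - y).
Proof.
have := normc_triangle (x - y) y; have := normc_triangle (y - x) x.
by rewrite !subrK normcBC ler_norml; lra.
Qed.

End ComplexNorm.

(** The [+ 1] keeps the denominator positive when [b = 0]; radii and step sizes below are chosen in
    this form whenever a constant may vanish. *)
Lemma mulr_le_divD1 (R : realFieldType) (t b a : R) : 0 <= t -> 0 <= b ->
  t <= a / (b + 1) -> t * b <= a.
Proof.
move=> t0 b0; rewrite ler_pdivlMr ?ltr_wpDl//; apply: le_trans.
by rewrite ler_wpM2l// lerDl.
Qed.

(** * Goursat's theorem and Cauchy estimates in one variable *)

Section SegmentIntegral.
Variable R : realType.
Implicit Types (a b c : R) (f g : R -> R[i]).
Local Notation mu := (@lebesgue_measure R).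

Definition cts_at f (t : R) := forall e : R, 0 < e ->
  exists2 d : R, 0 < d & forall s, `|s - t| < d -> normc (f s - f t) < e.

Definition cts_on a b f := forall t, a <= t <= b -> cts_at f t.

Lemma continuous_nonexpansive (g : R[i] -> R) f t :
  (forall x y, `|g x - g y| <= normc (x - y)) -> cts_at f t ->
  {for t, continuous (fun t => g (f t))}.
Proof.
move=> Hg H; apply/cvgrPdist_lt => e /H[d d0 Hd].
near=> s; rewrite distrC; have /Hd : `|s - t| < d.
  by near: s; apply: cvgr_distC_lt => //; exact: cvg_id.
exact: le_lt_trans.
Unshelve. all: by end_near. Qed.

Lemma cts_at_normc f t : cts_at f t ->
  {for t, continuous (fun t => normc (f t))}.
Proof. exact: continuous_nonexpansive (@normc_dist R). Qed.

Lemma integrable_of_cts a b (f : R -> R) :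
  (forall t, a <= t <= b -> {for t, continuous f}) ->
  mu.-integrable `[a, b] (EFin \o f).
Proof.
move=> H; apply: continuous_compact_integrable; first exact: segment_compact.
apply: continuous_in_subspaceT => x; rewrite inE/= in_itv/= => xab.
exact: H.
Qed.

Lemma integrable_Re a b f : cts_on a b f ->
  mu.-integrable `[a, b] (EFin \o (@complex.Re R \o f)).
Proof. by move=> H; apply: integrable_of_cts => t /H;
  exact: continuous_nonexpansive (@Re_dist R). Qed.

Lemma integrable_Im a b f : cts_on a b f ->
  mu.-integrable `[a, b] (EFin \o (@complex.Im R \o f)).
Proof. by move=> H; apply: integrable_of_cts => t /H;
  exact: continuous_nonexpansive (@Im_dist R). Qed.

Definition cint a b f : R[i] :=
  (\int[mu]_(t in `[a, b]) Re (f t)) +i* (\int[mu]_(t in `[a, b]) Im (f t)).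

Lemma eq_cint a b f g : (forall t, a <= t <= b -> f t = g t) ->
  cint a b f = cint a b g.
Proof.
by move=> fg; rewrite /cint; congr (_ +i* _); apply: eq_Rintegral => t;
  rewrite inE/= in_itv/= => /fg ->.
Qed.

Lemma cts_atZ (k : R[i]) f t : cts_at f t -> cts_at (fun t => k * f t) t.
Proof.
move=> Hf e e0; have k0 : 0 < normc k + 1 by have := normc_ge0 k; lra.
have [d d0 H] := Hf (e / (normc k + 1)) (divr_gt0 e0 k0).
exists d => // s /H; rewrite -mulrBr Normc.normcM ltr_pdivlMr// => h.
apply: le_lt_trans h; rewrite mulrC ler_wpM2l ?normc_ge0//.
by rewrite lerDl.
Qed.

Lemma cintD a b f g : cts_on a b f -> cts_on a b g ->
  cint a b (fun t => f t + g t) = cint a b f + cint a b g.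
Proof.
move=> cf cg; apply: complex_eqP; rewrite ?ReD ?ImD /=.
- rewrite -RintegralD//; [|exact: integrable_Re..].
  by apply: eq_Rintegral => t _; rewrite ReD.
- rewrite -RintegralD//; [|exact: integrable_Im..].
  by apply: eq_Rintegral => t _; rewrite ImD.
Qed.

Lemma cintZ a b (k : R[i]) f : cts_on a b f ->
  cint a b (fun t => k * f t) = k * cint a b f.
Proof.
move=> cf; have [iR iI] := (integrable_Re cf, integrable_Im cf).
have iZ r h : mu.-integrable `[a, b] (EFin \o h) ->
    mu.-integrable `[a, b] (EFin \o (fun t => r * h t)).
  by move=> ih; apply: (@integrableZl _ _ _ mu _ _ r (EFin \o h)).
apply: complex_eqP; rewrite ?ReM ?ImM /=.
- rewrite -!RintegralZl// -RintegralB//; [|exact: iZ..].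
  by apply: eq_Rintegral => t _; rewrite ReM.
- rewrite -!RintegralZl// -RintegralD//; [|exact: iZ..].
  by apply: eq_Rintegral => t _; rewrite ImM.
Qed.

Lemma cintB a b f g : cts_on a b f -> cts_on a b g ->
  cint a b (fun t => f t - g t) = cint a b f - cint a b g.
Proof.
move=> cf cg.
have -> : cint a b (fun t => f t - g t) =
          cint a b (fun t => f t + -1 * g t).
  by apply: eq_cint => t _; rewrite mulN1r.
rewrite cintD//; last by move=> t /cg; exact: cts_atZ.
by rewrite cintZ// mulN1r.
Qed.

Lemma Rint_chasles a b c (h : R -> R) : a <= b -> b <= c ->
  mu.-integrable `[a, c] (EFin \o h) ->
  \int[mu]_(t in `[a, c]) h t =
  \int[mu]_(t in `[a, b]) h t + \int[mu]_(t in `[b, c]) h t.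
Proof.
move=> ab bc ih.
have := @Rintegral_itvB R h (BLeft a) (BRight c) b ih.
rewrite !bnd_simp => /(_ ab bc) /eqP; rewrite subr_eq => /eqP ->.
rewrite addrC Rintegral_itv_obnd_cbnd//.
apply: integrableS ih => //; apply: subset_itv; rewrite bnd_simp//.
Qed.

Lemma cint_chasles a b c f : a <= b -> b <= c -> cts_on a c f ->
  cint a c f = cint a b f + cint b c f.
Proof.
move=> ab bc cf; apply: complex_eqP; rewrite ?ReD ?ImD /=.
- exact: (Rint_chasles ab bc (integrable_Re cf)).
- exact: (Rint_chasles ab bc (integrable_Im cf)).
Qed.

Lemma Rint_cst a b (k : R) : a <= b ->
  \int[mu]_(t in `[a, b]) k = k * (b - a).
Proof.
move=> ab; rewrite Rintegral_cst//= lebesgue_measure_itv/= lte_fin.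
case: ltP => //= ba; have -> : b = a by lra.
by rewrite subrr.
Qed.

(** Bounding real and imaginary parts separately costs a factor 2, harmless because only the order
    of magnitude of these integrals matters. *)
Lemma normc_cint_le a b f : cts_on a b f ->
  normc (cint a b f) <= 2 * \int[mu]_(t in `[a, b]) normc (f t).
Proof.
move=> cf; apply: (le_trans (normc_le_ReIm _)) => /=.
have iN : mu.-integrable `[a, b] (EFin \o (fun t => normc (f t))).
  apply: integrable_of_cts => t /cf; exact: cts_at_normc.
rewrite mulr2n mulrDl mul1r lerD//.
- apply: (le_trans (le_normr_Rintegral _ (integrable_Re cf))) => //=.
  apply: le_Rintegral => //; last by move=> t _; exact: Re_le_normc.
  exact: (integrable_norm (integrable_Re cf)).
- apply: (le_trans (le_normr_Rintegral _ (integrable_Im cf))) => //=.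
  apply: le_Rintegral => //; last by move=> t _; exact: Im_le_normc.
  exact: (integrable_norm (integrable_Im cf)).
Qed.

Lemma normc_cint_bound a b f (M : R) : a <= b -> cts_on a b f ->
  (forall t, a <= t <= b -> normc (f t) <= M) ->
  normc (cint a b f) <= 2 * M * (b - a).
Proof.
move=> ab cf Hf.
apply: (le_trans (normc_cint_le cf)); rewrite -mulrA ler_pM2l// -Rint_cst//.
apply: le_Rintegral => //.
- apply: integrable_of_cts => t /cf; exact: cts_at_normc.
- by apply: integrable_of_cts => t _; exact: cst_continuous.
Unshelve. all: by end_near. Qed.

Lemma Rint_id a b : a <= b ->
  \int[mu]_(t in `[a, b]) t = (b ^+ 2 - a ^+ 2) / 2.
Proof.
rewrite le_eqVlt => /predU1P[->|ab].
  by rewrite set_itv1 Rintegral_set1 subrr mul0r.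
pose F (x : R) : R := x ^+ 2 / 2.
have dF (x : R) : is_derive x (1 : R) F x.
  rewrite /F; apply: is_derive_eq.
  by rewrite /GRing.scale/=; lra.
rewrite /Rintegral (@continuous_FTC2 _ id F)//.
- by rewrite -EFinB/= /F; lra.
- by apply: continuous_in_subspaceT => x _; exact: cvg_id.
- split=> [x _||].
  + by have [] := dF x.
  + apply: cvg_at_right_filter; apply: differentiable_continuous.
    by apply/derivable1_diffP; have [] := dF a.
  + apply: cvg_at_left_filter; apply: differentiable_continuous.
    by apply/derivable1_diffP; have [] := dF b.
- by move=> x _; rewrite derive1E; have [] := dF x.
Qed.

Lemma cint_affine a b (p q : R[i]) : a <= b ->
  cint a b (fun t => p + q * t%:C) =
  p * (b - a)%:C + q * ((b ^+ 2 - a ^+ 2) / 2)%:C.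
Proof.
move=> ab.
have H r s : \int[mu]_(t in `[a, b]) (r + s * t) =
    r * (b - a) + s * ((b ^+ 2 - a ^+ 2) / 2).
  rewrite RintegralD//.
  - rewrite RintegralZl// ?Rint_id// ?Rint_cst//.
    by apply: integrable_of_cts => t _; exact: cvg_id.
  - by apply: integrable_of_cts => t _; exact: cst_continuous.
  - apply: integrable_of_cts => t _; apply: cvgM; first exact: cst_continuous.
    exact: cvg_id.
apply: complex_eqP; rewrite ?(ReD, ImD, ReM, ImM) /=.
- rewrite !mulr0 !subr0 -H; apply: eq_Rintegral => t _.
  by rewrite ReD ReM /= mulr0 subr0.
- rewrite !mulr0 !add0r -H; apply: eq_Rintegral => t _.
  by rewrite ImD ImM /= mulr0 add0r.
Qed.

End SegmentIntegral.

(** * Bisection of rectangles *)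

Section Bisection.
Variable R : realType.
Implicit Types a b c d e : R.

Lemma small_halving (K e : R) : 0 < e -> exists n, K / 2 ^+ n < e.
Proof.
move=> e0; have := archi_boundP (normr_ge0 (K / e)).
set N := Num.bound _ => HN; exists N.
have N2 : (N%:R : R) <= 2 ^+ N.
  by rewrite -natrX ler_nat; exact/ltnW/ltn_expl.
have H2 : 0 < (2 : R) ^+ N by rewrite exprn_gt0.
rewrite ltr_pdivrMr// mulrC -ltr_pdivrMr//.
by apply: lt_le_trans N2; apply: le_lt_trans HN; exact: ler_norm.
Qed.

Lemma midpoint_between a b : a <= b ->
  a <= (a + b) / 2 /\ (a + b) / 2 <= b.
Proof. by move=> ab; split; lra. Qed.

Lemma midpoint_sub a b : (a + b) / 2 - a = (b - a) / 2 /\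
  b - (a + b) / 2 = (b - a) / 2.
Proof. by split; field. Qed.

(** A compactness principle: if [P] failed on the whole rectangle, one quarter would be bad, then a
    quarter of that one, and so on; the nested bad rectangles shrink to a point [(x, y)], where the
    local hypothesis contradicts badness. *)
Lemma rectangle_bisection (P : R -> R -> R -> R -> Prop) a b c d :
  a <= b -> c <= d ->
  (forall a' b' c' d', a <= a' -> a' <= b' -> b' <= b ->
     c <= c' -> c' <= d' -> d' <= d ->
     let m := (a' + b') / 2 in let n := (c' + d') / 2 in
     P a' m c' n -> P m b' c' n -> P a' m n d' -> P m b' n d' ->
     P a' b' c' d') ->
  (forall x y, a <= x <= b -> c <= y <= d -> exists2 r : R, 0 < r &
     forall a' b' c' d', a <= a' -> a' <= x -> x <= b' -> b' <= b ->
     c <= c' -> c' <= y -> y <= d' -> d' <= d ->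
     (b' - a') + (d' - c') < r -> P a' b' c' d') ->
  P a b c d.
Proof.
move=> ab cd Psplit Ploc; apply: contrapT => nP.
pose T := (R * R * R * R)%type.
pose bad (q : T) := ~ P q.1.1.1 q.1.1.2 q.1.2 q.2.
pose m (q : T) := (q.1.1.1 + q.1.1.2) / 2.
pose n (q : T) := (q.1.2 + q.2) / 2.
pose q1 (q : T) : T := (q.1.1.1, m q, q.1.2, n q).
pose q2 (q : T) : T := (m q, q.1.1.2, q.1.2, n q).
pose q3 (q : T) : T := (q.1.1.1, m q, n q, q.2).
pose q4 (q : T) : T := (m q, q.1.1.2, n q, q.2).
(* The last quarter is the default: when [q] is bad and the other three quarters are good, [Psplit]
   forces it to be bad. *)
pose step (q : T) : T := if `[< bad (q1 q) >] then q1 q else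
  if `[< bad (q2 q) >] then q2 q else
  if `[< bad (q3 q) >] then q3 q else q4 q.
pose Q k : T := iter k step (a, b, c, d).
pose inside (q : T) := [/\ a <= q.1.1.1, q.1.1.1 <= q.1.1.2, q.1.1.2 <= b &
  [/\ c <= q.1.2, q.1.2 <= q.2 & q.2 <= d]].
have stepP q : [\/ step q = q1 q, step q = q2 q, step q = q3 q | step q = q4 q].
  rewrite /step; case: ifP => _; first exact: Or41.
  case: ifP => _; first exact: Or42.
  by case: ifP => _; [exact: Or43 | exact: Or44].
have step_in q : inside q -> [/\ inside (step q),
    q.1.1.1 <= (step q).1.1.1, (step q).1.1.2 <= q.1.1.2,
    q.1.2 <= (step q).1.2 & (step q).2 <= q.2] /\
    (step q).1.1.2 - (step q).1.1.1 = (q.1.1.2 - q.1.1.1) / 2 /\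
    (step q).2 - (step q).1.2 = (q.2 - q.1.2) / 2.
  rewrite /inside => -[h1 h2 h3 [h4 h5 h6]].
  have [m1 m2] := midpoint_between h2; have [n1 n2] := midpoint_between h5.
  have [m3 m4] := midpoint_sub q.1.1.1 q.1.1.2.
  have [n3 n4] := midpoint_sub q.1.2 q.2.
  by case: (stepP q) => ->; rewrite /q1 /q2 /q3 /q4 /m /n /=; do !split => //;
    by [exact: le_trans m2 h3|exact: le_trans h1 m1|exact: le_trans n2 h6|
        exact: le_trans h4 n1].
have step_bad q : inside q -> bad q -> bad (step q).
  rewrite /inside => -[h1 h2 h3 [h4 h5 h6]] bq.
  rewrite /step; case: asboolP => // n1; case: asboolP => // n2.
  case: asboolP => // n3 b4; apply: bq.
  apply: Psplit => //; exact: contrapT.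
have Qin k : inside (Q k) /\ bad (Q k).
  elim: k => [|k [IHi IHb]]; first by split.
  by split; rewrite /Q iterS -/(Q k); [case: (step_in _ IHi) => -[] | apply: step_bad].
have Qw k : (Q k).1.1.2 - (Q k).1.1.1 = (b - a) / 2 ^+ k /\
            (Q k).2 - (Q k).1.2 = (d - c) / 2 ^+ k.
  elim: k => [|k [IH1 IH2]]; first by rewrite expr0 !divr1.
  rewrite /Q iterS -/(Q k); have [_ [-> ->]] := step_in _ (Qin k).1.
  by rewrite IH1 IH2 exprS invfM; split; ring.
have mono k l : [/\ (Q k).1.1.1 <= (Q (k + l)%N).1.1.1,
    (Q (k + l)%N).1.1.2 <= (Q k).1.1.2,
    (Q k).1.2 <= (Q (k + l)%N).1.2 & (Q (k + l)%N).2 <= (Q k).2].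
  elim: l => [|l [h1 h2 h3 h4]]; first by rewrite addn0.
  rewrite addnS; have := step_in _ (Qin (k + l)%N).1.
  rewrite -/(Q (k + l).+1) => -[[_ g1 g2 g3 g4] _].
  split; [exact: le_trans g1|exact: le_trans g2 _|exact: le_trans g3|
    exact: le_trans g4 _].
have cross k l : (Q k).1.1.1 <= (Q l).1.1.2 /\ (Q k).1.2 <= (Q l).2.
  have [h1 h2 h3 h4] := mono k l; have [g1 g2 g3 g4] := mono l k.
  have [[i1 i2 i3 [i4 i5 i6]] _] := Qin (k + l)%N.
  rewrite addnC in g1 g2 g3 g4; split.
    exact: le_trans h1 (le_trans i2 g2).
  exact: le_trans h3 (le_trans i5 g4).
(* By [cross] every left end lies below every right end, so the suprema of the left and lower ends
   belong to all the nested rectangles. *)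
pose x := sup (range (fun k => (Q k).1.1.1)).
pose y := sup (range (fun k => (Q k).1.2)).
have hx k : (Q k).1.1.1 <= x <= (Q k).1.1.2.
  apply/andP; split.
    apply: sup_upper_bound; last by exists k.
    split; first by exists a, 0%N.
    by exists b => _ [l _ <-]; exact: (cross l 0%N).1.
  apply: ge_sup; first by exists a, 0%N.
  by move=> _ [l _ <-]; exact: (cross l k).1.
have hy k : (Q k).1.2 <= y <= (Q k).2.
  apply/andP; split.
    apply: sup_upper_bound; last by exists k.
    split; first by exists c, 0%N.
    by exists d => _ [l _ <-]; exact: (cross l 0%N).2.
  apply: ge_sup; first by exists c, 0%N.
  by move=> _ [l _ <-]; exact: (cross l k).2.
have [r r0 Hr] := Ploc x y (hx 0%N) (hy 0%N).
have [k Hk] := small_halving ((b - a) + (d - c)) r0.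
have [[i1 i2 i3 [i4 i5 i6]] bk] := Qin k; have [w1 w2] := Qw k.
have /andP[x1 x2] := hx k; have /andP[y1 y2] := hy k.
by apply: bk; apply: Hr => //; rewrite w1 w2 -mulrDl.
Qed.

End Bisection.

(** * Integrals along the boundary of a rectangle, and Goursat's theorem *)

Section RectangleIntegral.
Variable R : realType.
Implicit Types (a b c d e x y : R) (f g : R[i] -> R[i]) (p s : R[i]).
Local Notation ci := ('i : R[i]).

Definition ccont f p := forall e, 0 < e -> exists2 r : R, 0 < r &
  forall h, normc h < r -> normc (f (p + h) - f p) < e.

(** Written without division, so that [h = 0] needs no exclusion. *)
Definition cdiff f p (l : R[i]) := forall e, 0 < e -> exists2 r : R, 0 < r &
  forall h, normc h < r -> normc (f (p + h) - f p - l * h) <= e * normc h.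

Lemma cdiff_ccont f p l : cdiff f p l -> ccont f p.
Proof.
move=> H e e0; have [r r0 Hr] := H 1 ltr01.
have k0 : 0 < 2 + normc l by have := normc_ge0 l; lra.
exists (Num.min r (e / (2 + normc l))); first by rewrite lt_min r0 divr_gt0.
move=> h; rewrite lt_min ltr_pdivlMr// => /andP[/Hr h1 h2].
have -> : f (p + h) - f p = (f (p + h) - f p - l * h) + l * h by ring.
apply: (le_lt_trans (normc_triangle _ _)); rewrite Normc.normcM.
have := normc_ge0 h; rewrite mul1r in h1; nra.
Qed.

Lemma cts_at_horizontal f x y : ccont f (x +i* y) ->
  cts_at (fun t => f (t +i* y)) x.
Proof.
move=> H e /H[r r0 Hr]; exists r => // s sx.
have -> : s +i* y = (x +i* y) + (s - x)%:C :> R[i].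
  by apply: complex_eqP => /=; ring.
by apply: Hr; rewrite normc_real.
Qed.

Lemma cts_at_vertical f x y : ccont f (x +i* y) ->
  cts_at (fun t => f (x +i* t)) y.
Proof.
move=> H e /H[r r0 Hr]; exists r => // s sy.
have -> : x +i* s = (x +i* y) + ci * (s - y)%:C.
  by apply: complex_eqP => /=; ring.
by apply: Hr; rewrite Normc.normcM normci mul1r normc_real.
Qed.

(* The integral of f along the boundary of [a, b] x [c, d], counterclockwise. *)
Definition rint f a b c d : R[i] :=
  cint a b (fun t => f (t +i* c)) - cint a b (fun t => f (t +i* d)) +
  ci * (cint c d (fun t => f (b +i* t)) - cint c d (fun t => f (a +i* t))).

Definition on_bdry a b c d p :=
  ((a <= Re p <= b) /\ (Im p = c \/ Im p = d)) \/
  ((c <= Im p <= d) /\ (Re p = a \/ Re p = b)).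

Definition bcont f a b c d := forall p, on_bdry a b c d p -> ccont f p.

Lemma bcont_cts f a b c d : a <= b -> c <= d -> bcont f a b c d ->
  [/\ cts_on a b (fun t => f (t +i* c)), cts_on a b (fun t => f (t +i* d)),
      cts_on c d (fun t => f (b +i* t)) & cts_on c d (fun t => f (a +i* t))].
Proof.
move=> ab cd H; split=> t tab.
- by apply: cts_at_horizontal; apply: H; left; split=> //; left.
- by apply: cts_at_horizontal; apply: H; left; split=> //; right.
- by apply: cts_at_vertical; apply: H; right; split=> //; right.
- by apply: cts_at_vertical; apply: H; right; split=> //; left.
Qed.

Lemma rint_split_x f a m b c d : a <= m -> m <= b -> c <= d ->
  bcont f a b c d -> rint f a b c d = rint f a m c d + rint f m b c d.
Proof.
move=> am mb cd H; have [h1 h2 _ _] := bcont_cts (le_trans am mb) cd H.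
by rewrite /rint (cint_chasles am mb h1) (cint_chasles am mb h2); ring.
Qed.

Lemma rint_split_y f a b c n d : a <= b -> c <= n -> n <= d ->
  bcont f a b c d -> rint f a b c d = rint f a b c n + rint f a b n d.
Proof.
move=> ab cn nd H; have [_ _ h1 h2] := bcont_cts ab (le_trans cn nd) H.
by rewrite /rint (cint_chasles cn nd h1) (cint_chasles cn nd h2); ring.
Qed.

Lemma normc_rint_le f a b c d (M : R) : a <= b -> c <= d -> bcont f a b c d ->
  (forall p, on_bdry a b c d p -> normc (f p) <= M) ->
  normc (rint f a b c d) <= 4 * M * ((b - a) + (d - c)).
Proof.
move=> ab cd H HM; have [h1 h2 h3 h4] := bcont_cts ab cd H.
apply: (le_trans (normc_triangle _ _)); rewrite Normc.normcM normci mul1r.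
have B1 : normc (cint a b (fun t => f (t +i* c))) <= 2 * M * (b - a).
  by apply: normc_cint_bound => // t tab; apply: HM; left; split=> //; left.
have B2 : normc (cint a b (fun t => f (t +i* d))) <= 2 * M * (b - a).
  by apply: normc_cint_bound => // t tab; apply: HM; left; split=> //; right.
have B3 : normc (cint c d (fun t => f (b +i* t))) <= 2 * M * (d - c).
  by apply: normc_cint_bound => // t tab; apply: HM; right; split=> //; right.
have B4 : normc (cint c d (fun t => f (a +i* t))) <= 2 * M * (d - c).
  by apply: normc_cint_bound => // t tab; apply: HM; right; split=> //; left.
have := normc_triangle (cint a b (fun t => f (t +i* c)))
          (- cint a b (fun t => f (t +i* d))).
have := normc_triangle (cint c d (fun t => f (b +i* t)))
          (- cint c d (fun t => f (a +i* t))).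
by rewrite !normcN; lra.
Qed.

Lemma eq_rint f g a b c d : a <= b -> c <= d ->
  (forall p, on_bdry a b c d p -> f p = g p) ->
  rint f a b c d = rint g a b c d.
Proof.
move=> ab cd fg; rewrite /rint.
congr (_ - _ + _ * (_ - _)); apply: eq_cint => t tab; apply: fg.
- by left; split=> //; left.
- by left; split=> //; right.
- by right; split=> //; right.
- by right; split=> //; left.
Qed.

Lemma rintB f g a b c d : a <= b -> c <= d ->
  bcont f a b c d -> bcont g a b c d ->
  rint (fun z => f z - g z) a b c d = rint f a b c d - rint g a b c d.
Proof.
move=> ab cd Hf Hg; have [f1 f2 f3 f4] := bcont_cts ab cd Hf.
have [g1 g2 g3 g4] := bcont_cts ab cd Hg.
by rewrite /rint !cintB//; ring.
Qed.

Lemma rintZ k f a b c d : a <= b -> c <= d -> bcont f a b c d ->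
  rint (fun z => k * f z) a b c d = k * rint f a b c d.
Proof.
move=> ab cd Hf; have [f1 f2 f3 f4] := bcont_cts ab cd Hf.
by rewrite /rint !cintZ//; ring.
Qed.

(** All four sides are explicit: the vertical ones together contribute i q (b - a) (d - c) and the
    horizontal ones its opposite. *)
Lemma rint_affine (p q : R[i]) a b c d : a <= b -> c <= d ->
  rint (fun z => p + q * z) a b c d = 0.
Proof.
move=> ab cd; rewrite /rint.
have E1 y : cint a b (fun t => p + q * (t +i* y)) =
    cint a b (fun t => (p + q * (ci * y%:C)) + q * t%:C).
  apply: eq_cint => t _; rewrite -addrA -mulrDr; congr (_ + q * _).
  by apply: complex_eqP => /=; ring.
have E2 x : cint c d (fun t => p + q * (x +i* t)) =
    cint c d (fun t => (p + q * x%:C) + (q * ci) * t%:C).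
  apply: eq_cint => t _; rewrite -addrA -mulrA -mulrDr; congr (_ + q * _).
  by apply: complex_eqP => /=; ring.
rewrite !E1 !E2 !cint_affine//.
have i2 : ci * ci = -1 by rewrite -expr2 sqr_i.
rewrite !rmorphB/=.
have -> : ci * ((p + q * b%:C) * (d%:C - c%:C) +
     q * ci * ((d ^+ 2 - c ^+ 2) / 2)%:C -
    ((p + q * a%:C) * (d%:C - c%:C) + q * ci * ((d ^+ 2 - c ^+ 2) / 2)%:C)) =
    ci * q * (b%:C - a%:C) * (d%:C - c%:C) by ring.
by ring.
Qed.

Lemma ccontB f g p : ccont f p -> ccont g p -> ccont (fun z => f z - g z) p.
Proof.
move=> Hf Hg e e0; have e20 : 0 < e / 2 by lra.
have [r1 r10 H1] := Hf _ e20; have [r2 r20 H2] := Hg _ e20.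
exists (Num.min r1 r2); first by rewrite lt_min r10.
move=> h; rewrite lt_min => /andP[/H1 h1 /H2 h2].
have -> : f (p + h) - g (p + h) - (f p - g p) =
  (f (p + h) - f p) - (g (p + h) - g p) by ring.
by apply: (le_lt_trans (normc_triangle _ _)); rewrite normcN; lra.
Qed.

Lemma cdiff_affine (k l : R[i]) p : cdiff (fun z => k + l * z) p l.
Proof.
move=> e e0; exists 1 => // h _.
have -> : k + l * (p + h) - (k + l * p) - l * h = 0 by ring.
by rewrite Normc.normc0 mulr_ge0 ?normc_ge0// ltW.
Qed.

Definition in_rect a b c d p := (a <= Re p <= b) && (c <= Im p <= d).

Lemma on_bdry_in_rect a b c d p : a <= b -> c <= d ->
  on_bdry a b c d p -> in_rect a b c d p.
Proof.
by rewrite /in_rect => ab cd [[/andP[h1 h2] [->|->]]|[/andP[h1 h2] [->|->]]];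
  apply/andP; split; apply/andP; split; lra.
Qed.

Lemma in_rectS a b c d a' b' c' d' p : a <= a' -> b' <= b -> c <= c' ->
  d' <= d -> in_rect a' b' c' d' p -> in_rect a b c d p.
Proof.
move=> aa bb cc dd /andP[/andP[h1 h2] /andP[h3 h4]].
by apply/andP; split; apply/andP; split;
  [exact: le_trans h1|exact: le_trans h2 _|exact: le_trans h3|exact: le_trans h4 _].
Qed.

(** Near a point, [f] differs from its tangent affine map by a small multiple of the distance, and
    the affine map integrates to 0; so small rectangles satisfy a bound by [e] times the square of
    the half-perimeter. Such a bound passes from the quarters to the whole, and [e] is arbitrary. *)
Lemma goursat f a b c d : a <= b -> c <= d ->
  (forall p, in_rect a b c d p -> exists l, cdiff f p l) ->
  rint f a b c d = 0.
Proof.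
move=> ab cd Hf.
suff small e : 0 < e ->
    normc (rint f a b c d) <= e * ((b - a) + (d - c)) ^+ 2.
  apply: Normc.eq0_normc; apply/eqP; rewrite eq_le normc_ge0 andbT leNgt.
  apply/negP => n0.
  have k0 : 0 < ((b - a) + (d - c)) ^+ 2 + 1 by rewrite ltr_wpDl ?sqr_ge0.
  have := small _ (divr_gt0 n0 k0).
  rewrite mulrAC ler_pdivlMr// ler_pM2l// => H; lra.
move=> e0; pose P a b c d :=
  normc (rint f a b c d) <= e * ((b - a) + (d - c)) ^+ 2.
apply: (@rectangle_bisection R P) => //.
  move=> a' b' c' d' h1 h2 h3 h4 h5 h6 m n; rewrite /P => P1 P2 P3 P4.
  have H x y z t : a' <= x -> x <= y -> y <= b' -> c' <= z -> z <= t ->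
      t <= d' -> bcont f x y z t.
    move=> k1 k2 k3 k4 k5 k6 p /(on_bdry_in_rect k2 k5).
    move=> Hp; have [|l Hl] := Hf p; last exact: cdiff_ccont Hl.
    by apply: in_rectS Hp; [exact: le_trans k1|exact: le_trans h3|
      exact: le_trans k4|exact: le_trans h6].
  have [am mb] := midpoint_between h2; have [cn nd] := midpoint_between h5.
  rewrite (rint_split_x am mb h5); last exact: H.
  rewrite (rint_split_y am cn nd); last exact: H.
  rewrite (rint_split_y mb cn nd); last exact: H.
  have T1 := normc_triangle (rint f a' m c' n) (rint f a' m n d').
  have T2 := normc_triangle (rint f m b' c' n) (rint f m b' n d').
  apply: (le_trans (normc_triangle _ _)).
  (* Halving both sides divides the square of the half-perimeter by 4, so the four bounds add up
     exactly. *)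
  have -> : e * (b' - a' + (d' - c')) ^+ 2 =
     (e * (m - a' + (n - c')) ^+ 2 + e * (m - a' + (d' - n)) ^+ 2) +
     (e * (b' - m + (n - c')) ^+ 2 + e * (b' - m + (d' - n)) ^+ 2).
    by rewrite /m /n; field.
  apply: lerD; first by apply: (le_trans T1); exact: lerD.
  by apply: (le_trans T2); exact: lerD.
move=> x y xab ycd.
have [|l Hl] := Hf (x +i* y); first by rewrite /in_rect /= xab ycd.
(* The quarter compensates the factor 4 in [normc_rint_le]. *)
have [r r0 Hr] := Hl (e / 4) (divr_gt0 e0 (ltr0Sn _ 3)).
exists r => // a' b' c' d' a1 a2 a3 a4 c1 c2 c3 c4 wr.
pose p := x +i* y; pose k := f p - l * p.
have ab' := le_trans a2 a3; have cd' := le_trans c2 c3.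
have Hc q : on_bdry a' b' c' d' q -> ccont f q.
  move=> /(on_bdry_in_rect ab' cd') Hq.
  have [|l' Hl'] := Hf q; last exact: cdiff_ccont Hl'.
  exact: in_rectS Hq.
have Ha q : ccont (fun z => k + l * z) q by apply: (@cdiff_ccont _ _ l); exact: cdiff_affine.
rewrite /P.
have -> : rint f a' b' c' d' = rint (fun z => f z - (k + l * z)) a' b' c' d'.
  by rewrite rintB// rint_affine// subr0.
set w := b' - a' + (d' - c').
have -> : e * w ^+ 2 = 4 * (e / 4 * w) * w by field.
apply: normc_rint_le => //.
  by move=> q Hq; apply: ccontB; [exact: Hc|exact: Ha].
move=> q /(on_bdry_in_rect ab' cd')/andP[/andP[g1 g2] /andP[g3 g4]].
have Hq : normc (q - p) <= w.
  apply: (le_trans (normc_le_ReIm _)); rewrite ReD ReN ImD ImN /= /w.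
  by apply: lerD; rewrite ler_norml; lra.
have := Hr (q - p) (le_lt_trans Hq wr).
have -> : p + (q - p) = q by ring.
have -> : f q - f p - l * (q - p) = f q - (k + l * q) by rewrite /k; ring.
move=> h; apply: (le_trans h); rewrite ler_wpM2l//; lra.
Qed.

End RectangleIntegral.

Lemma divf_sub_lin (F : fieldType) (h x l : F) : h != 0 ->
  h^-1 * x - l = h^-1 * (x - l * h).
Proof. by move=> h0; field. Qed.

Lemma sub_lin_divf (F : fieldType) (h x l : F) : h != 0 ->
  x - l * h = h * (h^-1 * x - l).
Proof. by move=> h0; field. Qed.

(** * The derivative as a limit of difference quotients *)

Section Bridge.
Variable R : realType.
Local Notation C := (Cplx R).

Lemma posC_real (e : C) : 0 < e -> exists2 r : R, 0 < r & e = r%:C.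
Proof.
case: e => a b; rewrite ltcE /= => /andP[/eqP -> a0].
by exists a.
Qed.

Lemma cvg_dnbhsC (f : C -> C) (l : C) :
  (forall e : R, 0 < e -> exists2 r : R, 0 < r & forall h : C, h != 0 ->
     normc h < r -> normc (f h - l) <= e) <-> f @ 0^' --> l.
Proof.
split.
  move=> H; apply/cvgrPdist_le => e /posC_real[r r0 ->].
  have [d d0 Hd] := H _ r0.
  have d0C : (0 : C) < d%:C by rewrite ltcR.
  exists (d%:C) => //= h.
  rewrite /ball_ [X in X -> _]/= sub0r normrN => hd h0.
  rewrite distrC normcE lecR; apply: Hd => //.
  by move: hd; rewrite normcE ltcR.
move=> /cvgrPdist_le H e e0.
have e0C : (0 : C) < e%:C by rewrite ltcR.
have [d /= /posC_real[r r0 ->] Hd] := H _ e0C.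
exists r => // h h0 hr; have := Hd h.
rewrite /ball_ [X in X -> _]/= sub0r normrN !normcE ltcR => /(_ hr h0).
by rewrite lecR normcBC.
Qed.

(** Makes the product, inverse and difference rules for [is_derive] available for [cdiff]. *)
Lemma cdiffP (f : C -> C) (p l : C) :
  cdiff f p l <-> is_derive p (1 : C) f l.
Proof.
have aux : cdiff f p l <->
    (fun h : C => h^-1 *: ((f \o shift p) (h *: (1 : C)) - f p)) @ 0^' --> l.
  rewrite -cvg_dnbhsC; split=> H e /H[r r0 Hr]; exists r => // h.
    move=> h0 /Hr; rewrite /= [h *: 1]mulr1 [h + p]addrC => hh.
    have nh0 : 0 < normc h by rewrite normc_gt0.
    have -> : h^-1 *: (f (p + h) - f p) - l =
        h^-1 * (f (p + h) - f p - l * h).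
      exact: (@divf_sub_lin C).
    by rewrite Normc.normcM Normc.normcV mulrC ler_pdivrMr.
  have [->|h0] := eqVneq h 0.
    by rewrite addr0 subrr mulr0 subrr Normc.normc0 mulr0.
  move=> /(Hr _ h0); rewrite /= [h *: 1]mulr1 [h + p]addrC => hh.
  have nh0 : 0 < normc h by rewrite normc_gt0.
  have -> : f (p + h) - f p - l * h =
        h * (h^-1 *: (f (p + h) - f p) - l).
    exact: (@sub_lin_divf C).
  by rewrite Normc.normcM mulrC ler_wpM2r ?normc_ge0.
rewrite aux; split=> [H|[H <-]]; last exact: H.
by split; [apply/cvg_ex; exists l|exact: cvg_lim].
Qed.

Lemma cdiffM (f g : R[i] -> R[i]) p k l : cdiff f p k -> cdiff g p l ->
  cdiff (fun z => f z * g z) p (f p * l + g p * k).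
Proof.
by move=> /(cdiffP f) Hf /(cdiffP g) Hg; apply/(cdiffP (fun z => f z * g z));
  apply: is_deriveM.
Qed.

Lemma cdiffV (f : R[i] -> R[i]) p k : f p != 0 -> cdiff f p k ->
  cdiff (fun z => (f z)^-1) p (- (f p) ^- 2 * k).
Proof.
move=> f0 /(cdiffP f) Hf; apply/(cdiffP (fun z => (f z)^-1)).
  split; [by case: Hf => Hd _; exact: derivableV|by case: Hf => Hd <-; rewrite deriveV].
Qed.

Lemma cdiffB (f g : R[i] -> R[i]) p k l : cdiff f p k -> cdiff g p l ->
  cdiff (fun z => f z - g z) p (k - l).
Proof.
by move=> /(cdiffP f) Hf /(cdiffP g) Hg; apply/(cdiffP (fun z => f z - g z));
  apply: is_deriveB.
Qed.

End Bridge.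

(** * Cauchy's formula on rectangles *)

Section Cauchy.
Variable R : realType.
Implicit Types (a b c d e x y r : R) (f g : R[i] -> R[i]) (p s z : R[i]).

Lemma cdiff_unique f p k l : cdiff f p k -> cdiff f p l -> k = l.
Proof.
by move=> /(cdiffP f)[_ <-] /(cdiffP f)[_ <-].
Qed.

Lemma cdiff_cst (k p : R[i]) : cdiff (fun=> k) p 0.
Proof.
move=> e e0; exists 1 => // h _.
by rewrite mul0r !subrr Normc.normc0 mulr_ge0 ?normc_ge0// ltW.
Qed.

Lemma cdiff_id (p : R[i]) : cdiff id p 1.
Proof.
move=> e e0; exists 1 => // h _.
have -> : id (p + h) - id p - 1 * h = 0 by rewrite /=; ring.
by rewrite Normc.normc0 mulr_ge0 ?normc_ge0// ltW.
Qed.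

Lemma cdiff_id_sub s p : cdiff (fun z => z - s) p 1.
Proof.
by have := cdiffB (cdiff_id p) (cdiff_cst s p); rewrite subr0.
Qed.

Lemma cdiff_sub_inv s p : p != s -> exists l, cdiff (fun z => (z - s)^-1) p l.
Proof.
move=> ps; exists (- (p - s) ^- 2 * 1).
by apply: (cdiffV (f := fun z => z - s)); [rewrite subr_eq0|exact: cdiff_id_sub].
Qed.

Lemma cdiff_div_sub f s p : p != s -> (exists l, cdiff f p l) ->
  exists l, cdiff (fun z => f z / (z - s)) p l.
Proof.
move=> /cdiff_sub_inv[k Hk] [l Hl].
by exists (f p * k + (p - s)^-1 * l); exact: cdiffM.
Qed.

Lemma bcont_diff g a b c d : a <= b -> c <= d ->
  (forall p, on_bdry a b c d p -> exists l, cdiff g p l) -> bcont g a b c d.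
Proof. by move=> ab cd H p /H[l]; exact: cdiff_ccont. Qed.

(** By Goursat the integral equals the one over a small square of half-side [w] around the singular
    point. There |g| <= e / w on the boundary, which has half-perimeter 4 w, whence the bound 16
    e. *)
Lemma rint_removable g a b c d x0 y0 : a < x0 < b -> c < y0 < d ->
  (forall p, in_rect a b c d p -> p != x0 +i* y0 -> exists l, cdiff g p l) ->
  (forall e, 0 < e -> exists2 r : R, 0 < r & forall h, h != 0 ->
     normc h < r -> normc (g (x0 +i* y0 + h)) * normc h <= e) ->
  rint g a b c d = 0.
Proof.
move=> /andP[ax xb] /andP[cy yd] Hg Hs.
suff small e : 0 < e -> normc (rint g a b c d) <= 16 * e.
  apply: Normc.eq0_normc; apply/eqP; rewrite eq_le normc_ge0 andbT leNgt.
  apply/negP => n0; have := small (normc (rint g a b c d) / 32).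
  by rewrite divr_gt0// => /(_ isT); lra.
move=> e0; have [r r0 Hr] := Hs _ e0.
have [w [w0 [wr [wa wb]] [wc wd]]] : exists w : R,
    [/\ 0 < w, 4 * w <= r /\ w <= x0 - a /\ w <= b - x0 &
        w <= y0 - c /\ w <= d - y0].
  exists (Num.min (r / 4) (Num.min (Num.min (x0 - a) (b - x0))
     (Num.min (y0 - c) (d - y0)))).
  split; [rewrite !lt_min; repeat (apply/andP; split); lra | |].
  - repeat split.
    + by rewrite mulrC -ler_pdivlMr// ge_min lexx.
    + by rewrite !ge_min lexx !orbT.
    + by rewrite !ge_min lexx !orbT.
  - by split; rewrite !ge_min lexx !orbT.
have [x1 x2 y1 y2] : [/\ a <= x0 - w, x0 + w <= b, c <= y0 - w & y0 + w <= d].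
  by clear -wa wb wc wd; split; lra.
have xx : x0 - w <= x0 + w by clear -w0; lra.
have yy : y0 - w <= y0 + w by clear -w0; lra.
have H a' b' c' d' : a <= a' -> a' <= b' -> b' <= b -> c <= c' -> c' <= d' ->
    d' <= d ->
    (forall p, on_bdry a' b' c' d' p -> p != x0 +i* y0) -> bcont g a' b' c' d'.
  move=> h1 h2 h3 h4 h5 h6 hp; apply: bcont_diff => // p pb; apply: Hg.
    exact: in_rectS (on_bdry_in_rect h2 h5 pb).
  exact: hp.
have H0 a' b' c' d' : a <= a' -> a' <= b' -> b' <= b -> c <= c' -> c' <= d' ->
    d' <= d ->
    [\/ x0 < a', b' < x0, y0 < c' | d' < y0] -> rint g a' b' c' d' = 0.
  move=> h1 h2 h3 h4 h5 h6 hp; apply: goursat => // p pb; apply: Hg.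
    exact: in_rectS pb.
  case/andP: pb => /andP[g1 g2] /andP[g3 g4].
  by apply/eqP => E; rewrite E /= in g1 g2 g3 g4; case: hp; rewrite ltNge ?(g1,g2,g3,g4).
have out p : Re p != x0 \/ Im p != y0 -> p != x0 +i* y0.
  by move=> [/eqP E|/eqP E]; apply/eqP => pE; apply: E; rewrite pE.
have cd : c <= d by exact: ltW (lt_trans cy yd).
have nb a' b' c' d' p : a' <= b' -> c' <= d' ->
    a' != x0 -> b' != x0 -> c' != y0 -> d' != y0 ->
    on_bdry a' b' c' d' p -> p != x0 +i* y0.
  by move=> ? ? n1 n2 n3 n4 [[_ [E|E]]|[_ [E|E]]]; apply: out; rewrite E; auto.
have [na nb' nc nd] : [/\ a != x0, b != x0, c != y0 & d != y0].
  by split; apply/eqP => E; move: ax xb cy yd; rewrite E ltxx.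
have [nw1 nw2 nw3 nw4] : [/\ x0 - w != x0, x0 + w != x0, y0 - w != y0 &
    y0 + w != y0].
  by clear -w0; split; apply/eqP => E; lra.
have ab : a <= b by exact: ltW (lt_trans ax xb).
have [mb ma] := (le_trans xx x2, le_trans x1 xx).
have [nd' nc'] := (le_trans yy y2, le_trans y1 yy).
(* The strips to the left, to the right, below and above the small square are removed in this order;
   each avoids the singular point. *)
have S1 : rint g a b c d = rint g (x0 - w) (x0 + w) (y0 - w) (y0 + w).
  rewrite (rint_split_x x1 mb cd); last by apply: H => // p; exact: nb.
  rewrite H0//; last by apply: Or42; clear -w0; lra.
  rewrite add0r (rint_split_x xx x2 cd); last by apply: H => // p; exact: nb.
  rewrite [rint g (x0 + w) b _ _]H0//; last by apply: Or41; clear -w0; lra.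
  rewrite addr0 (rint_split_y xx y1 nd'); last by apply: H => // p; exact: nb.
  rewrite H0//; last by apply: Or44; clear -w0; lra.
  rewrite add0r (rint_split_y xx yy y2); last by apply: H => // p; exact: nb.
  rewrite [rint g _ _ (y0 + w) _]H0 ?addr0//.
  by apply: Or43; clear -w0; lra.
rewrite S1; have -> : 16 * e = 4 * (e / w) * (x0 + w - (x0 - w) + (y0 + w - (y0 - w))).
  by field; rewrite gt_eqF.
apply: normc_rint_le => //; first by apply: H => // p; exact: nb.
move=> p pb; pose h := p - x0 +i* y0.
have Ep : p = x0 +i* y0 + h by rewrite /h; ring.
have dw (u : R) : `|u - w - u| = w /\ `|u + w - u| = w.
  have -> : u - w - u = - w by ring.
  have -> : u + w - u = w by ring.
  by rewrite normrN ger0_norm// ltW.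
have hw : w <= normc h.
  have [hI hR] := (Im_le_normc h, Re_le_normc h).
  rewrite /h ReD ImD ReN ImN /= in hI hR.
  case: pb => [[_ E]|[_ E]]; [apply: le_trans hI|apply: le_trans hR].
    by have [d1 d2] := dw y0; case: E => ->; rewrite ?d1 ?d2.
  by have [d1 d2] := dw x0; case: E => ->; rewrite ?d1 ?d2.
have hr : normc h < r.
  apply: le_lt_trans (normc_le_ReIm h) _; rewrite /h ReD ImD ReN ImN /=.
  have /andP[/andP[g1 g2] /andP[g3 g4]] := on_bdry_in_rect xx yy pb.
  have B1 : `|Re p - x0| <= w by clear -g1 g2; rewrite ler_norml; lra.
  have B2 : `|Im p - y0| <= w by clear -g3 g4; rewrite ler_norml; lra.
  by clear -B1 B2 wr w0; lra.
have h0 : h != 0 by rewrite -normc_gt0; exact: lt_le_trans hw.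
rewrite ler_pdivlMr// Ep; apply: le_trans (Hr h h0 hr).
by rewrite ler_wpM2l ?normc_ge0.
Qed.

(** The quotient (f z - f s) / (z - s) has a removable singularity at [s]. The integral of 1 / (z -
    s), classically 2 pi i, is left unevaluated: the estimates below only divide by it, and a lower
    bound on its modulus suffices. *)
Lemma cauchy_rectangle f a b c d s : a < Re s < b -> c < Im s < d ->
  (forall p, in_rect a b c d p -> exists l, cdiff f p l) ->
  rint (fun z => f z / (z - s)) a b c d =
  f s * rint (fun z => (z - s)^-1) a b c d.
Proof.
move=> /andP[a1 b1] /andP[c1 d1] Hf.
have ab := ltW (lt_trans a1 b1); have cd := ltW (lt_trans c1 d1).
have bs p : on_bdry a b c d p -> p != s.
  by move=> [[_ [E|E]]|[_ [E|E]]]; apply/eqP => ps; move: E a1 b1 c1 d1;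
    rewrite ps => ->; rewrite ltxx.
have B1 : bcont (fun z => f z / (z - s)) a b c d.
  apply: bcont_diff => // p pb; apply: cdiff_div_sub; first exact: bs.
  by apply: Hf; exact: on_bdry_in_rect.
have B2 : bcont (fun z => (z - s)^-1) a b c d.
  by apply: bcont_diff => // p /bs; exact: cdiff_sub_inv.
have B3 : bcont (fun z => f s * (z - s)^-1) a b c d.
  move=> p /bs ps.
  have [k Hk] := cdiff_sub_inv ps.
  exact: cdiff_ccont (cdiffM (cdiff_cst (f s) p) Hk).
apply/eqP; rewrite -rintZ// -subr_eq0 -rintB//; apply/eqP.
have -> : rint (fun z => f z / (z - s) - f s * (z - s)^-1) a b c d =
    rint (fun z => (f z - f s) / (z - s)) a b c d.
  by apply: eq_rint => // p _; rewrite mulrBl.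
have sE : s = Re s +i* Im s by case: (s).
apply: (@rint_removable _ _ _ _ _ (Re s) (Im s)).
- by rewrite a1.
- by rewrite c1.
- move=> p pin; rewrite -sE => ps.
  have [l Hl] := Hf p pin.
  apply: (cdiff_div_sub (f := fun z => f z - f s)) => //.
  exists (l - 0); apply: cdiffB => //; exact: cdiff_cst.
- move=> e e0; rewrite -sE.
  have [|l Hl] := Hf s; first by rewrite /in_rect !ltW.
  have [r r0 Hr] := cdiff_ccont Hl e0; exists r => // h h0 /Hr/ltW.
  have -> : s + h - s = h by ring.
  by rewrite Normc.normcM Normc.normcV mulfVK// gt_eqF// normc_gt0.
Qed.

Lemma Re_inv z : Re z^-1 = Re z / (Re z ^+ 2 + Im z ^+ 2).
Proof. by case: z. Qed.

Lemma Im_inv z : Im z^-1 = - (Im z / (Re z ^+ 2 + Im z ^+ 2)).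
Proof. by case: z. Qed.

(** The imaginary part is a sum of four side integrals of constant sign, all contributing
    nonnegatively; the right side alone already gives 1/16. *)
Lemma normc_kappa_ge a b c d s r : 0 < r ->
  r / 2 <= Re s - a <= 2 * r -> r / 2 <= b - Re s <= 2 * r ->
  r / 2 <= Im s - c <= 2 * r -> r / 2 <= d - Im s <= 2 * r ->
  16^-1 <= normc (rint (fun z => (z - s)^-1) a b c d).
Proof.
move=> r0 /andP[a1 a2] /andP[b1 b2] /andP[c1 c2] /andP[d1 d2].
apply: le_trans (Im_le_normc _); apply: le_trans (ler_norm _).
have ab : a <= b by clear -a1 b1 r0; lra.
have cd : c <= d by clear -c1 d1 r0; lra.
have B : bcont (fun z => (z - s)^-1) a b c d.
  apply: bcont_diff => // p pb; apply: cdiff_sub_inv.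
  apply/eqP => ps; case: pb; rewrite ps => -[_].
    by clear -c1 d1 r0 => -[]; lra.
  by clear -a1 b1 r0 => -[]; lra.
have [k1 k2 k3 k4] := bcont_cts ab cd B.
rewrite /rint ImD ImM ImD ReD ReN ImN /= mul0r mul1r add0r.
have sq0 (u v : R) : 0 <= u ^+ 2 + v ^+ 2 by rewrite addr_ge0 ?sqr_ge0.
have I1 : 0 <= \int[lebesgue_measure]_(t in `[a, b]) Im ((t +i* c - s)^-1).
  apply: Rintegral_ge0 => t _; rewrite Im_inv -mulNr divr_ge0// ImD ImN /=.
  by clear -c1 r0; lra.
have I2 : 0 <= - \int[lebesgue_measure]_(t in `[a, b]) Im ((t +i* d - s)^-1).
  rewrite -mulN1r -RintegralZl//; last exact: integrable_Im k2.
  apply: Rintegral_ge0 => t _; rewrite Im_inv mulN1r opprK divr_ge0// ImD ImN /=.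
  by clear -d1 r0; lra.
have I4 : 0 <= - \int[lebesgue_measure]_(t in `[c, d]) Re ((a +i* t - s)^-1).
  rewrite -mulN1r -RintegralZl//; last exact: integrable_Re k4.
  apply: Rintegral_ge0 => t _; rewrite Re_inv mulN1r -mulNr divr_ge0// ReD ReN /=.
  by clear -a1 r0; lra.
(* The integrand u / (u^2 + v^2) is at least (r / 2) / (8 r^2), and the side has length at least
   [r]. *)
have I3 : 16^-1 <= \int[lebesgue_measure]_(t in `[c, d]) Re ((b +i* t - s)^-1).
  apply: (@le_trans _ _ ((16 * r)^-1 * (d - c))).
    by rewrite mulrC ler_pdivlMr ?mulr_gt0//; clear -c1 d1 r0; lra.
  rewrite -Rint_cst//; apply: le_Rintegral => //.
  - by apply: integrable_of_cts => t _; exact: cst_continuous.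
  - exact: integrable_Re k3.
  - move=> t; rewrite /= in_itv/= => /andP[t1 t2].
    rewrite Re_inv ReD ReN ImD ImN /=.
    set u := b - Re s; set v := t - Im s.
    have u0 : 0 < u by rewrite /u; clear -b1 r0; lra.
    have v2 : v ^+ 2 <= (2 * r) ^+ 2.
      have : `|v| <= 2 * r by rewrite ler_norml /v; clear -t1 t2 c2 d2 r0; lra.
      by rewrite -[v ^+ 2]real_normK ?num_real// ler_pXn2r ?nnegrE ?mulr_ge0// ltW.
    have D0 : 0 < u ^+ 2 + v ^+ 2 by rewrite ltr_wpDr ?sqr_ge0// exprn_gt0.
    rewrite ler_pdivlMr// mulrC ler_pdivrMr ?mulr_gt0//.
    have u2 : u ^+ 2 <= (2 * r) ^+ 2.
      by rewrite ler_pXn2r ?nnegrE ?mulr_ge0// ltW.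
    have ur : r / 2 <= u by [].
    clear -u2 v2 ur r0; rewrite exprMn in u2 v2; nra.
rewrite -[X in X <= _]add0r; apply: lerD; first exact: addr_ge0.
by rewrite -[X in X <= _]addr0; exact: lerD.
Qed.

End Cauchy.

(** * First-order Taylor estimate in one variable *)

Section Taylor.
Variable R : realType.
Implicit Types (r : R) (f g : R[i] -> R[i]) (p s z : R[i]).

(** Rounded up from 16 * 64 * 257: the two remainder terms are bounded by 64 * 257 * M / r^2 in
    total, and dividing by the integral of 1 / (z - s), of modulus at least 1/16, multiplies this by
    16. *)
Definition taylor_cst : R := 64 * 64 * 65.

Lemma cdiff_of_quadratic g l r K : 0 < r ->
  (forall s, normc s <= r -> normc (g s - g 0 - s * l) <= K * normc s ^+ 2) ->
  cdiff g 0 l.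
Proof.
move=> r0 H e e0.
exists (Num.min r (e / (`|K| + 1))).
  by rewrite lt_min r0 divr_gt0// ltr_wpDl.
move=> h; rewrite lt_min => /andP[h1 h2].
rewrite add0r [l * h]mulrC; apply: le_trans (H _ (ltW h1)) _.
rewrite expr2 mulrA ler_wpM2r ?normc_ge0//.
apply: le_trans (mulr_le_divD1 (normc_ge0 h) (normr_ge0 K) (ltW h2)).
by rewrite mulrC ler_wpM2l ?normc_ge0// ler_norm.
Qed.

(* Expand 1/(z - s) = 1/z + s/z^2 + s^2/(z^2 (z - s)) in Cauchy's formula. *)
Lemma taylor_estimate f r M l : 0 < r ->
  (forall p, in_rect (- r) r (- r) r p -> exists l, cdiff f p l) ->
  (forall p, in_rect (- r) r (- r) r p -> normc (f p) <= M) ->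
  cdiff f 0 l ->
  normc l <= taylor_cst * M / r /\
  forall s, normc s <= r / 2 ->
    normc (f s - f 0 - s * l) <= taylor_cst * M / r ^+ 2 * normc s ^+ 2.
Proof.
move=> r0 Hf HM Hl.
have rr : - r <= r by clear -r0; lra.
have zin : in_rect (- r) r (- r) r 0.
  by rewrite /in_rect /= !oppr_le0 !ltW.
have M0 : 0 <= M by exact: le_trans (normc_ge0 _) (HM _ zin).
pose g z := f z - f 0.
have Hg p : in_rect (- r) r (- r) r p -> exists l, cdiff g p l.
  move=> /Hf[k Hk]; exists (k - 0); apply: cdiffB => //; exact: cdiff_cst.
have gM p : in_rect (- r) r (- r) r p -> normc (g p) <= 2 * M.
  move=> pin; apply: le_trans (normc_triangle _ _) _.
  by rewrite normcN mulr2n mulrDl mul1r lerD ?HM.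
have sM (s : R[i]) : normc s <= r / 2 -> - (r / 2) <= Re s <= r / 2 /\
    - (r / 2) <= Im s <= r / 2.
  by move=> sr; have := le_trans (Re_le_normc s) sr;
    have := le_trans (Im_le_normc s) sr; rewrite !ler_norml.
pose B := on_bdry (- r) r (- r) r.
have bin p : B p -> in_rect (- r) r (- r) r p by exact: on_bdry_in_rect.
have br p : B p -> r <= normc p.
  have hI := Im_le_normc p; have hR := Re_le_normc p.
  by move=> [[_ E]|[_ E]]; [apply: le_trans hI|apply: le_trans hR];
    case: E => ->; rewrite ?normrN ger0_norm// ltW.
have b0 p : B p -> p != 0.
  by move=> /br rp; rewrite -normc_gt0; exact: lt_le_trans rp.
have bs (s : R[i]) p : normc s <= r / 2 -> B p -> r / 2 <= normc (p - s).
  move=> sr /br pr; have := normc_triangle (p - s) s; rewrite subrK.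
  by clear -sr pr; lra.
have bs0 (s : R[i]) p : normc s <= r / 2 -> B p -> p - s != 0.
  move=> sr /(bs _ _ sr) rp; rewrite -normc_gt0; apply: lt_le_trans rp.
  by rewrite divr_gt0.
have inv_le (u : R[i]) (q : R) : 0 < q -> q <= normc u -> normc (u^-1) <= q^-1.
  move=> q0 qu; rewrite Normc.normcV lef_pV2 ?posrE//.
  exact: lt_le_trans qu.
pose K1 := rint (fun z => g z * (z^-1 * z^-1)) (- r) r (- r) r.
pose E s := rint (fun z => g z * (z^-1 * z^-1 * (z - s)^-1)) (- r) r (- r) r.
pose kap s := rint (fun z => (z - s)^-1) (- r) r (- r) r.
pose eta s := rint (fun z => z^-1 * (z - s)^-1) (- r) r (- r) r.
pose D (u : R[i] -> R[i]) := forall p, B p -> exists k, cdiff u p k.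
have Dinv : D (fun z => z^-1).
  move=> p /b0 p0; exists (- p ^- 2 * 1); apply: (cdiffV (f := id)) => //.
  exact: cdiff_id.
have Dsub s : normc s <= r / 2 -> D (fun z => (z - s)^-1).
  by move=> sr p pb; apply: cdiff_sub_inv; rewrite -subr_eq0; exact: bs0 pb.
have DM (u v : R[i] -> R[i]) : D u -> D v -> D (fun z => u z * v z).
  move=> Du Dv p pb; have [k Hk] := Du p pb; have [j Hj] := Dv p pb.
  by exists (u p * j + v p * k); exact: cdiffM.
have Dc k : D (fun=> k) by move=> p _; exists 0; exact: cdiff_cst.
have Dg : D g by move=> p /bin; exact: Hg.
have bd u : D u -> bcont u (- r) r (- r) r by move=> Du; exact: bcont_diff.
have Dgi := DM _ _ Dg (DM _ _ Dinv Dinv).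
have Dgs s sr := DM _ _ Dg (DM _ _ (DM _ _ Dinv Dinv) (Dsub s sr)).
have c1 := bd _ Dgi.
have c2 s sr := bd _ (Dgs s sr).
have c3 s sr := bd _ (DM _ _ Dinv (Dsub s sr)).
have c4 := bd _ Dinv.
have c5 s sr := bd _ (Dsub s sr).
have c6 s sr := bd _ (DM _ _ Dg (Dsub s sr)).
have c7 := bd _ (DM _ _ Dg Dinv).
have bK1 : normc K1 <= 32 * M / r.
  have -> : 32 * M / r = 4 * (2 * M * (r^-1 * r^-1)) * (r - - r + (r - - r)).
    by field; rewrite gt_eqF.
  apply: normc_rint_le => // p pb; rewrite !Normc.normcM ler_pM ?mulr_ge0 ?normc_ge0//.
    by apply: gM; exact: bin.
  by rewrite ler_pM ?normc_ge0//; apply: inv_le => //; exact: br.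
have bE s : normc s <= r / 2 -> normc (E s) <= 64 * M / r ^+ 2.
  move=> sr.
  have -> : 64 * M / r ^+ 2 =
      4 * (2 * M * (r^-1 * r^-1 * (r / 2)^-1)) * (r - - r + (r - - r)).
    by field; rewrite gt_eqF.
  apply: normc_rint_le => //; first exact: c2.
  move=> p pb; rewrite !Normc.normcM ler_pM ?mulr_ge0 ?normc_ge0//.
    by apply: gM; exact: bin.
  rewrite ler_pM ?mulr_ge0 ?normc_ge0//.
    by rewrite ler_pM ?normc_ge0//; apply: inv_le => //; exact: br.
  by apply: inv_le; [rewrite divr_gt0|exact: bs].
have beta s : normc s <= r / 2 -> normc (eta s) <= 32 / r.
  move=> sr; have -> : 32 / r = 4 * (r^-1 * (r / 2)^-1) * (r - - r + (r - - r)).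
    by field; rewrite gt_eqF.
  apply: normc_rint_le => //; first exact: c3.
  move=> p pb; rewrite !Normc.normcM ler_pM ?mulr_ge0 ?normc_ge0//.
    by apply: inv_le => //; exact: br.
  by apply: inv_le; [rewrite divr_gt0|exact: bs].
have bkap s : normc s <= r / 2 -> 16^-1 <= normc (kap s).
  move=> /sM[/andP[s1 s2] /andP[s3 s4]].
  by apply: (normc_kappa_ge r0); clear -r0 s1 s2 s3 s4; lra.
have n00 : normc (0 : R[i]) <= r / 2 by rewrite Normc.normc0 divr_ge0// ltW.
have cau s : normc s <= r / 2 ->
    rint (fun z => g z * (z - s)^-1) (- r) r (- r) r = g s * kap s.
  move=> /sM[/andP[s1 s2] /andP[s3 s4]].
  by apply: cauchy_rectangle => //; clear -r0 s1 s2 s3 s4; lra.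
have g0 : rint (fun z => g z * z^-1) (- r) r (- r) r = 0.
  have := cau 0 n00; rewrite {2}/g subrr mul0r => <-.
  by apply: eq_rint => // p _; rewrite subr0.
have kap0 : rint (fun z => z^-1) (- r) r (- r) r = kap 0.
  by apply: eq_rint => // p _; rewrite subr0.
(* Since [g 0 = 0], the integral of g / z vanishes and may be subtracted, which leaves only the
   orders s and s^2. *)
have exG s : normc s <= r / 2 -> g s * kap s = s * K1 + s ^+ 2 * E s.
  move=> sr; rewrite -cau// -[LHS]subr0 -[in LHS]g0 -rintB//; last exact: c6.
  rewrite (@eq_rint _ _ (fun z => s * (g z * (z^-1 * z^-1)) -
     - s ^+ 2 * (g z * (z^-1 * z^-1 * (z - s)^-1))))//; last first.
    by move=> p pb; have := b0 _ pb; have := bs0 _ _ sr pb => h1 h2; field; rewrite h1 h2.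
  rewrite rintB//; [|exact: bd (DM _ _ (Dc _) Dgi)|exact: bd (DM _ _ (Dc _) (Dgs s sr))].
  rewrite !rintZ//; last exact: c2.
  by rewrite -/K1 -/(E s) mulNr opprK.
(* The unevaluated factor [kap s] is compared with its value at 0; its variation, multiplied by
   [s * l'], is again of order s^2. *)
have exK s : normc s <= r / 2 -> kap s = kap 0 + s * eta s.
  move=> sr; apply/eqP; rewrite addrC -subr_eq -kap0 -rintB//; last exact: c5.
  rewrite -rintZ//; last exact: c3.
  apply/eqP; apply: eq_rint => // p pb.
  by have := b0 _ pb; have := bs0 _ _ sr pb => h1 h2; field; rewrite h1 h2.
have k0n : kap 0 != 0.
  by rewrite -normc_gt0; apply: lt_le_trans (bkap _ n00); rewrite invr_gt0.
pose l' := K1 / kap 0.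
have bl : normc l' <= 512 * M / r.
  rewrite /l' Normc.normcM Normc.normcV.
  have -> : 512 * M / r = (32 * M / r) * 16 by ring.
  apply: ler_pM; rewrite ?invr_ge0 ?normc_ge0//.
  by rewrite -[leRHS]invrK lef_pV2 ?posrE ?normc_gt0// ?invr_gt0// bkap.
have quad s : normc s <= r / 2 ->
    normc (f s - f 0 - s * l') <= taylor_cst * M / r ^+ 2 * normc s ^+ 2.
  move=> sr; rewrite -/(g s).
  have ksn : 0 < normc (kap s).
    by apply: lt_le_trans (bkap _ sr); rewrite invr_gt0.
  have eq : (g s - s * l') * kap s = s ^+ 2 * (E s - l' * eta s).
    rewrite mulrBl exG// [in LHS]exK// /l'.
    by field.
  rewrite -(ler_pM2r ksn) -Normc.normcM eq Normc.normcM normcX.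
  rewrite [X in _ <= X * _]mulrC -[X in _ <= X]mulrA.
  rewrite ler_wpM2l ?exprn_ge0 ?normc_ge0//.
  have B1 : normc (E s - l' * eta s) <= 64 * M / r ^+ 2 + 512 * M / r * (32 / r).
    apply: le_trans (normc_triangle _ _) _; rewrite normcN Normc.normcM.
    by apply: lerD; [exact: bE|apply: ler_pM; rewrite ?normc_ge0//; exact: beta].
  apply: (le_trans B1).
  have -> : 64 * M / r ^+ 2 + 512 * M / r * (32 / r) = 64 * 257 * (M / r ^+ 2).
    by field; rewrite gt_eqF.
  rewrite /taylor_cst -[64 * 64 * 65 * M / _]mulrA.
  have : 0 <= M / r ^+ 2 by rewrite divr_ge0// sqr_ge0.
  move: (M / r ^+ 2) (normc (kap s)) (bkap _ sr) => q k kb q0.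
  by clear -q0 kb; nra.
(* The quadratic estimate makes [l'] a derivative of [f] at 0, so uniqueness identifies it with
   [l]. *)
have l'E : l' = l.
  apply: cdiff_unique Hl.
  by apply: (cdiff_of_quadratic (r := r / 2)) quad; rewrite divr_gt0.
rewrite -l'E; split=> //.
apply: (le_trans bl); rewrite /taylor_cst -[512 * M / _]mulrA -[X in _ <= X]mulrA.
have : 0 <= M / r by rewrite divr_ge0// ltW.
by move: (M / r) => q q0; clear -q0; lra.
Qed.

End Taylor.

(** * Mean value inequality on boxes *)

Section LocalMeasurability.
Variable R : realType.
Local Notation RT := (measurableTypeR R : measurableType _).

(** The preimage of an open ray is the trace on [D] of the union of those boxes on which the
    function stays in the ray; countability of the index type makes this union measurable. It links
    continuity with the product sigma-algebra of tuples. *)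
Lemma measurable_fun_countable_base d (T : measurableType d) (I : countType)
    (box : I -> set T) (D : set T) (g : T -> R) :
  (forall i, measurable (box i)) -> measurable D ->
  (forall t, D t -> forall e, 0 < e -> exists2 i, box i t &
     forall s, box i s -> D s -> `|g s - g t| < e) ->
  measurable_fun D g.
Proof.
move=> mbox mD H _; apply: (measurability _ (measurable_realfun.RGenOInfty.measurableE R)) => //.
move=> /= _ [_ [x ->] <-].
have -> : D `&` g @^-1` `]x, +oo[ =
    D `&` \bigcup_(i in [set i | forall s, box i s -> D s -> x < g s]) box i.
  apply/seteqP; split=> t [Dt] /=.
    rewrite in_itv/= andbT => xt; split=> //.
    have [|i it Hi] := H t Dt (g t - x); first by rewrite subr_gt0.
    exists i => //= s bs Ds; have := Hi s bs Ds.
    by rewrite ltr_distl => /andP[+ _]; rewrite subKr.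
  by case=> i Hi it; split=> //; rewrite in_itv/= andbT; exact: Hi.
apply: measurableI => //; rewrite bigcup_mkcond.
by apply: countable_bigcupT_measurable => // i; case: ifP.
Qed.

Definition rbox (r : rat * nat) : set RT := [set x | `|x - ratr r.1| < r.2.+1%:R^-1].

Lemma measurable_rbox r : measurable (rbox r).
Proof.
rewrite (_ : rbox r = `]ratr r.1 - r.2.+1%:R^-1, ratr r.1 + r.2.+1%:R^-1[%classic).
  exact: measurable_itv.
by apply/seteqP; split=> x; rewrite /rbox/= in_itv/= ltr_distl.
Qed.

(** Valid for all indices beyond [k], so that finitely many coordinates can share the same
    radius. *)
Lemma rbox_small (x d : R) : 0 < d -> exists k, forall l, (k <= l)%N ->
  exists2 q, rbox (q, l) x & forall y : R, rbox (q, l) y -> `|y - x| < d.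
Proof.
move=> d0; have := archi_boundP (ltW (divr_gt0 (ltr0Sn R 1) d0)).
set k := Num.bound _ => Hk; exists k => l kl.
have l0 : 0 < (l.+1%:R : R)^-1 by rewrite invr_gt0.
have ld : 2 * (l.+1%:R : R)^-1 < d.
  rewrite ltr_pdivrMr// mulrC -ltr_pdivrMr//; apply: lt_le_trans Hk _.
  by rewrite ler_nat; exact: leqW.
have xl : x < x + (l.+1%:R)^-1 by rewrite ltrDl.
have [q] := rat_in_itvoo xl; rewrite in_itv/= => /andP[q1 q2].
have xq : `|x - ratr q| < l.+1%:R^-1.
  by rewrite ltr_distl ltrBlDr q2/=; apply: lt_trans q1 _; rewrite ltrDl.
exists q => // y /= yq.
have -> : y - x = (y - ratr q) - (x - ratr q) by ring.
by apply: le_lt_trans (ler_normB _ _) _; apply: lt_trans ld; rewrite mulr2n mulrDl mul1r ltrD.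
Qed.

Lemma measurable_fun_pair (D : set (RT * RT)) (g : RT * RT -> R) : measurable D ->
  (forall t, D t -> forall e, 0 < e -> exists2 d : R, 0 < d &
     forall s, `|s.1 - t.1| < d -> `|s.2 - t.2| < d -> D s -> `|g s - g t| < e) ->
  measurable_fun D g.
Proof.
move=> mD H; pose box (i : rat * rat * nat) : set (RT * RT) :=
  rbox (i.1.1, i.2) `*` rbox (i.1.2, i.2).
apply: (measurable_fun_countable_base (box := box)) => //.
  by move=> i; apply: measurableX; exact: measurable_rbox.
move=> t Dt e e0; have [d d0 Hd] := H t Dt e e0.
have [k1 H1] := rbox_small t.1 d0; have [k2 H2] := rbox_small t.2 d0.
have [q1 q1t Hq1] := H1 (maxn k1 k2) (leq_maxl _ _).
have [q2 q2t Hq2] := H2 (maxn k1 k2) (leq_maxr _ _).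
exists (q1, q2, maxn k1 k2) => // s [s1 s2] Ds.
by apply: Hd => //; [exact: Hq1|exact: Hq2].
Qed.

Definition tuple_rbox n (i : n.-tuple (rat * rat) * nat) :
    set (n.-tuple (RT * RT)) :=
  \bigcap_(j in [set: 'I_n]) (fun t : n.-tuple (RT * RT) => tnth t j) @^-1`
      (rbox ((tnth i.1 j).1, i.2) `*` rbox ((tnth i.1 j).2, i.2)).

Lemma measurable_tuple_rbox n (i : n.-tuple (rat * rat) * nat) :
  measurable (tuple_rbox i).
Proof.
apply: fin_bigcap_measurable; first exact: finite_finset.
move=> j _; rewrite -[X in measurable X]setTI; apply: measurable_tnth => //.
by apply: measurableX; exact: measurable_rbox.
Qed.

Definition tuple_close n (d : R) (s t : n.-tuple (RT * RT)) :=
  forall j, `|(tnth s j).1 - (tnth t j).1| < d /\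
            `|(tnth s j).2 - (tnth t j).2| < d.

Lemma tuple_rbox_small n (t : n.-tuple (RT * RT)) (d : R) : 0 < d ->
  exists2 i, tuple_rbox i t & forall s, tuple_rbox i s -> tuple_close d s t.
Proof.
move=> d0.
have Hj (j : 'I_n) : exists k, forall l, (k <= l)%N -> exists q : rat * rat,
    [/\ rbox (q.1, l) (tnth t j).1, rbox (q.2, l) (tnth t j).2 &
    forall y, rbox (q.1, l) y.1 -> rbox (q.2, l) y.2 ->
    `|y.1 - (tnth t j).1| < d /\ `|y.2 - (tnth t j).2| < d].
  have [k1 H1] := rbox_small (tnth t j).1 d0.
  have [k2 H2] := rbox_small (tnth t j).2 d0.
  exists (maxn k1 k2) => l; rewrite geq_max => /andP[/H1[q1 a1 b1] /H2[q2 a2 b2]].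
  by exists (q1, q2); split=> // y y1 y2; split; [exact: b1|exact: b2].
have [k Hk] := choice Hj; pose l := (\max_j k j)%N.
have Hq j : exists q : rat * rat, [/\ rbox (q.1, l) (tnth t j).1,
    rbox (q.2, l) (tnth t j).2 &
    forall y, rbox (q.1, l) y.1 -> rbox (q.2, l) y.2 ->
    `|y.1 - (tnth t j).1| < d /\ `|y.2 - (tnth t j).2| < d].
  by apply: Hk; exact: leq_bigmax.
have [q Hql] := choice Hq.
exists ([tuple q j | j < n], l).
  by move=> j _; rewrite /= tnth_mktuple; have [] := Hql j.
move=> s bs j.
have [_ _ Hy] := Hql j; have [] := bs j I; rewrite /= tnth_mktuple.
exact: Hy.
Qed.

Lemma measurable_fun_tuple n (D : set (n.-tuple (RT * RT)))
    (g : n.-tuple (RT * RT) -> R) : measurable D ->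
  (forall t, D t -> forall e, 0 < e -> exists2 d : R, 0 < d &
     forall s, tuple_close d s t -> D s -> `|g s - g t| < e) ->
  measurable_fun D g.
Proof.
move=> mD H; apply: (measurable_fun_countable_base (@measurable_tuple_rbox n) mD).
move=> t Dt e e0; have [d d0 Hd] := H t Dt e e0.
have [i it Hi] := tuple_rbox_small t d0.
by exists i => // s /Hi; exact: Hd.
Qed.

Lemma measurable_tuple_open n (D : set (n.-tuple (RT * RT))) :
  (forall t, D t -> exists2 d : R, 0 < d & forall s, tuple_close d s t -> D s) ->
  measurable D.
Proof.
move=> H; have -> : D = \bigcup_(i in [set i | tuple_rbox i `<=` D]) tuple_rbox i.
  apply/seteqP; split=> [t Dt|t [i Hi]]; last exact: Hi.
  have [d d0 Hd] := H t Dt; have [i it Hi] := tuple_rbox_small t d0.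
  by exists i => // s /Hi; exact: Hd.
rewrite bigcup_mkcond; apply: countable_bigcupT_measurable => // i.
by case: ifP => _; [exact: measurable_tuple_rbox|].
Qed.

End LocalMeasurability.

Lemma integral_ge_cst d (T : measurableType d) (R : realType)
    (m : {measure set T -> \bar R}) (F : T -> \bar R) (A : set T) (k : R) :
  measurable_fun setT F -> (forall x, 0 <= F x)%E -> measurable A -> 0 <= k ->
  (forall x, A x -> k%:E <= F x)%E -> (k%:E * m A <= \int[m]_x F x)%E.
Proof.
move=> mF F0 mA k0 H; apply: (@le_trans _ _ (\int[m]_(x in A) F x)%E); last first.
  exact: ge0_subset_integral.
by rewrite -integral_cst//; apply: ge0_le_integral => //; exact: measurable_funS mF.
Qed.

Section SliceBound.
Context d1 d2 (T1 : measurableType d1) (T2 : measurableType d2) (R : realType).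
Variables (m1 : {sigma_finite_measure set T1 -> \bar R}).
Variables (m2 : {sigma_finite_measure set T2 -> \bar R}).
Variable h : T1 * T2 -> \bar R.
Hypothesis mh : measurable_fun setT h.
Hypothesis h0 : forall z, (0 <= h z)%E.

(** Tonelli followed by a Chebyshev bound. It is used contrapositively: when the double integral is
    small, some slice over [A] has a small integral. *)
Lemma slice_bound1 (A : set T1) (k : R) : measurable A -> 0 <= k ->
  (forall x, A x -> k%:E <= \int[m2]_y h (x, y))%E ->
  (k%:E * m1 A <= \int[prod_measure m1 m2]_z h z)%E.
Proof.
move=> mA k0 H; rewrite -[prod_measure m1 m2]/(m1 \x m2)%E fubini_tonelli1//.
apply: integral_ge_cst => // [|x]; last by apply: integral_ge0.
exact: measurable_fun_fubini_tonelli_F.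
Qed.

Lemma slice_bound2 (A : set T2) (k : R) : measurable A -> 0 <= k ->
  (forall y, A y -> k%:E <= \int[m1]_x h (x, y))%E ->
  (k%:E * m2 A <= \int[prod_measure m1 m2]_z h z)%E.
Proof.
move=> mA k0 H; rewrite -[prod_measure m1 m2]/(m1 \x m2)%E fubini_tonelli2//.
apply: integral_ge_cst => // [|x]; last by apply: integral_ge0.
exact: measurable_fun_fubini_tonelli_G.
Qed.

End SliceBound.

(** * Averaging Cauchy's formula over a square *)

Section AreaEstimate.
Variable R : realType.
Local Notation RT := (measurableTypeR R : measurableType _).
Local Notation mu := (@lebesgue_measure R).
Implicit Types (f : R[i] -> R[i]).

Definition csquare (x y r : R) : set (RT * RT) :=
  `[x - r, x + r] `*` `[y - r, y + r].

Lemma measurable_csquare x y r : measurable (csquare x y r).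
Proof. by apply: measurableX; exact: measurable_itv. Qed.

Lemma measurable_normc_csquare f x y r :
  (forall p, in_rect (x - r) (x + r) (y - r) (y + r) p -> ccont f p) ->
  measurable_fun (csquare x y r) (fun q : RT * RT => normc (f (q.1 +i* q.2))).
Proof.
move=> Hf; apply: measurable_fun_pair; first exact: measurable_csquare.
move=> [u v] [/= uS vS] e e0.
have [|d d0 Hd] := Hf (u +i* v) _ e e0.
  by rewrite /in_rect /=; move: uS vS; rewrite !in_itv/= => -> ->.
have d20 : 0 < d / 2 by rewrite divr_gt0.
exists (d / 2) => //= -[s t] /= su tv _.
have := Hd ((s - u) +i* (t - v)).
have -> : u +i* v + ((s - u) +i* (t - v)) = s +i* t.
  by apply: complex_eqP => /=; ring.
move=> h; have {}h : normc (f (s +i* t) - f (u +i* v)) < e.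
  apply: h; apply: le_lt_trans (normc_le_ReIm _) _ => /=.
  by rewrite [d]splitr ltrD.
exact: le_lt_trans (normc_dist _ _) h.
Qed.

Lemma integral_slice (A B : set RT) (h : RT * RT -> \bar R) x : A x ->
  (\int[mu]_y ((h \_ (A `*` B)) (x, y)) = \int[mu]_(y in B) h (x, y))%E.
Proof.
move=> Ax; rewrite [RHS]integral_mkcond; apply: eq_integral => y _.
by rewrite /patch in_setX mem_set.
Qed.

Lemma integral_slice2 (A B : set RT) (h : RT * RT -> \bar R) y : B y ->
  (\int[mu]_x ((h \_ (A `*` B)) (x, y)) = \int[mu]_(x in A) h (x, y))%E.
Proof.
move=> Ay; rewrite [RHS]integral_mkcond; apply: eq_integral => x _.
by rewrite /patch in_setX [in X in _ && X]mem_set// andbT.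
Qed.

Lemma integrable_normc_cts (a b : R) (g : R -> R[i]) : cts_on a b g ->
  mu.-integrable `[a, b] (fun t => (normc (g t))%:E).
Proof. by move=> cg; apply: integrable_of_cts => t /cg; exact: cts_at_normc. Qed.

Lemma fin_num_normc_cts (a b : R) (g : R -> R[i]) : cts_on a b g ->
  (\int[mu]_(t in `[a, b]) (normc (g t))%:E)%E \is a fin_num.
Proof.
move=> cg; apply: integrable_fin_num => //; exact: integrable_normc_cts.
Qed.

Lemma normc_cint_dominated (a0 b0 a b k c : R) (g q : R -> R[i]) : a0 <= a -> b <= b0 ->
  cts_on a b q -> 0 <= c -> cts_on a0 b0 g ->
  (forall t, a <= t <= b -> normc (q t) <= c * normc (g t)) ->
  \int[mu]_(t in `[a0, b0]) normc (g t) <= k -> normc (cint a b q) <= 2 * (c * k).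
Proof.
move=> a0a bb0 cq c0 cg H gk; apply: le_trans (normc_cint_le cq) _.
have cab : cts_on a b g.
  by move=> t /andP[t1 t2]; apply: cg; rewrite (le_trans a0a t1) (le_trans t2 bb0).
have ig := integrable_normc_cts cab.
rewrite ler_pM2l//; apply: (@le_trans _ _ (\int[mu]_(t in `[a, b]) (c * normc (g t)))).
  apply: le_Rintegral => //; first exact: integrable_normc_cts cq.
  exact: (@integrableZl _ _ _ mu _ _ c (EFin \o _)).
rewrite RintegralZl//; apply: ler_wpM2l c0 _ _ _; apply: le_trans gk.
rewrite /Rintegral; apply: fine_le.
- exact: fin_num_normc_cts cab.
- exact: fin_num_normc_cts cg.
- apply: ge0_subset_integral => //.
  + by have /integrableP[] := integrable_normc_cts cg.
  + by move=> t _; rewrite lee_fin normc_ge0.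
  + by apply: subset_itv; rewrite bnd_simp.
Qed.

(* Averaging Cauchy's formula over rectangles with sides in the outer frame of the square: some side integral is large for every position of that side. *)
Lemma area_estimate f x0 y0 r : 0 < r ->
  (forall p, in_rect (x0 - r) (x0 + r) (y0 - r) (y0 + r) p ->
     exists l, cdiff f p l) ->
  ((normc (f (x0 +i* y0)) * (r ^+ 2 / (16 * 128)))%:E <=
   \int[prod_measure mu mu]_(q in csquare x0 y0 r)
      (normc (f (q.1 +i* q.2)))%:E)%E.
Proof.
move=> r0 Hf; set s := x0 +i* y0.
pose X : set RT := `[x0 - r, x0 + r]%classic.
pose Y : set RT := `[y0 - r, y0 + r]%classic.
pose h (q : RT * RT) := (normc (f (q.1 +i* q.2)))%:E.
pose H := h \_ (X `*` Y).
have Hc p : in_rect (x0 - r) (x0 + r) (y0 - r) (y0 + r) p -> ccont f p.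
  by move=> /Hf[l]; exact: cdiff_ccont.
have mH : measurable_fun setT H.
  apply/(measurable_restrictT _ (measurable_csquare x0 y0 r)).
  by apply/measurable_EFinP; exact: measurable_normc_csquare.
have H0 z : (0 <= H z)%E.
  by rewrite /H /patch; case: ifP => // _; rewrite lee_fin normc_ge0.
rewrite integral_mkcond -/(h \_ (X `*` Y)) -/H.
(* If all four sides had slice integrals below [k], Cauchy's integral would be at most 16 k / r = |f
   s| / 64, against the lower bound |f s| / 16. *)
set k := normc (f s) * (r / 128 / 8).
have k0 : 0 <= k by rewrite mulr_ge0 ?normc_ge0// !divr_ge0// ltW.
pose V x := \int[mu]_(y in Y) normc (f (x +i* y)).
pose W y := \int[mu]_(x in X) normc (f (x +i* y)).
have VE x : X x -> (\int[mu]_y H (x, y) = (V x)%:E)%E.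
  move=> Xx; rewrite integral_slice// /V /Rintegral fineK//.
  apply: (@fin_num_normc_cts _ _ (fun y => f (x +i* y))) => t tY.
    apply: cts_at_vertical; apply: Hc; rewrite /in_rect /= tY andbT.
    by move: Xx; rewrite /X /= in_itv.
have WE y : Y y -> (\int[mu]_x H (x, y) = (W y)%:E)%E.
  move=> Yy; rewrite integral_slice2// /W /Rintegral fineK//.
  apply: (@fin_num_normc_cts _ _ (fun x => f (x +i* y))) => t tX.
    apply: cts_at_horizontal; apply: Hc; rewrite /in_rect /= tX /=.
    by move: Yy; rewrite /Y /= in_itv.
have r20 : 0 < r / 2 by rewrite divr_gt0.
have len (u : R) : (lebesgue_measure (`[u, (u + r / 2)%R]%classic : set RT) = (r / 2)%:E)%E.
  by rewrite lebesgue_measure_itv/= lte_fin ltrDl r20 -EFinB addrAC subrr add0r.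
have -> : normc (f s) * (r ^+ 2 / (16 * 128)) = k * (r / 2).
  by rewrite /k; field.
apply: contrapT => /negP; rewrite -ltNge => /lt_geF Hlt.
(* If no slice in a strip of width r / 2 had integral below [k], the area integral would be at least
   k (r / 2), which is the bound assumed to fail. *)
have EV (u : R) : x0 - r <= u -> u + r / 2 <= x0 + r ->
    exists2 x, u <= x <= u + r / 2 & V x < k.
  move=> u1 u2; apply: contrapT => nex; move/negP: Hlt; apply.
  rewrite EFinM -(len u); apply: slice_bound1 => // x /=; rewrite in_itv/= => ux.
  rewrite VE; last first.
    rewrite /X /= in_itv/=; case/andP: ux => a b.
    by rewrite (le_trans u1 a) (le_trans b u2).
  by rewrite lee_fin leNgt; apply/negP => Vk; apply: nex; exists x.
have EW (u : R) : y0 - r <= u -> u + r / 2 <= y0 + r ->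
    exists2 y, u <= y <= u + r / 2 & W y < k.
  move=> u1 u2; apply: contrapT => nex; move/negP: Hlt; apply.
  rewrite EFinM -(len u); apply: slice_bound2 => // x /=; rewrite in_itv/= => ux.
  rewrite WE; last first.
    rewrite /Y /= in_itv/=; case/andP: ux => a b.
    by rewrite (le_trans u1 a) (le_trans b u2).
  by rewrite lee_fin leNgt; apply/negP => Vk; apply: nex; exists x.
have [a /andP[a1 a2] Va] : exists2 x, x0 - r <= x <= x0 - r + r / 2 & V x < k.
  by apply: EV => //; clear -r0; lra.
have [b /andP[b1 b2] Vb] : exists2 x, x0 + r / 2 <= x <= x0 + r / 2 + r / 2 & V x < k.
  by apply: EV => //; clear -r0; lra.
have [c /andP[c1 c2] Wc] : exists2 x, y0 - r <= x <= y0 - r + r / 2 & W x < k.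
  by apply: EW => //; clear -r0; lra.
have [d /andP[d1 d2] Wd] : exists2 x, y0 + r / 2 <= x <= y0 + r / 2 + r / 2 & W x < k.
  by apply: EW => //; clear -r0; lra.
have ab : a <= b by clear -a2 b1 r0; lra.
have cd : c <= d by clear -c2 d1 r0; lra.
have [br dr] : b <= x0 + r /\ d <= y0 + r by clear -b2 d2; lra.
have Hin p : in_rect a b c d p -> in_rect (x0 - r) (x0 + r) (y0 - r) (y0 + r) p.
  exact: in_rectS.
have Hf' p : in_rect a b c d p -> exists l, cdiff f p l by move=> /Hin/Hf.
have sa : a < Re s < b by clear -a2 b1 r0; rewrite /s /=; lra.
have sc : c < Im s < d by clear -c2 d1 r0; rewrite /s /=; lra.
have kap : 16^-1 <= normc (rint (fun z => (z - s)^-1) a b c d).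
  by apply: (normc_kappa_ge r0); rewrite /s /=;
    [clear -a1 a2 r0|clear -b1 b2 r0|clear -c1 c2 r0|clear -d1 d2 r0]; lra.
have bfar p : on_bdry a b c d p -> r / 2 <= normc (p - s).
  have hI := Im_le_normc (p - s); have hR := Re_le_normc (p - s).
  rewrite /s ReD ImD ReN ImN /= in hI hR.
  move=> [[_ [E|E]]|[_ [E|E]]]; [apply: le_trans hI|apply: le_trans hI|
    apply: le_trans hR|apply: le_trans hR]; rewrite E.
  - by clear -c2; rewrite ler_normr; lra.
  - by clear -d1; rewrite ler_normr; lra.
  - by clear -a2; rewrite ler_normr; lra.
  - by clear -b1; rewrite ler_normr; lra.
have bs p : on_bdry a b c d p -> p != s.
  by move=> /bfar h1; rewrite -subr_eq0 -normc_gt0; exact: lt_le_trans h1.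
have bc : bcont (fun z => f z / (z - s)) a b c d.
  apply: bcont_diff => // p pb; apply: cdiff_div_sub; first exact: bs.
  by apply: Hf'; exact: on_bdry_in_rect.
have [k1 k2 k3 k4] := bcont_cts ab cd bc.
have quo p : on_bdry a b c d p ->
    normc (f p / (p - s)) <= 2 / r * normc (f p).
  move=> /bfar pf; rewrite Normc.normcM Normc.normcV mulrC.
  rewrite ler_wpM2r ?normc_ge0// -[2 / r]invf_div lef_pV2 ?posrE//.
  exact: lt_le_trans pf.
have xb t : x0 - r <= t <= x0 + r -> forall y, c <= y <= d -> ccont f (t +i* y).
  move=> tX y /andP[y1 y2]; apply: Hc; rewrite /in_rect /= tX /=.
  by rewrite (le_trans c1 y1) (le_trans y2 dr).
have yb t : y0 - r <= t <= y0 + r -> forall x, a <= x <= b -> ccont f (x +i* t).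
  move=> tY x /andP[y1 y2]; apply: Hc; rewrite /in_rect /= tY andbT.
  by rewrite (le_trans a1 y1) (le_trans y2 br).
have hside y : c <= y <= d -> W y < k ->
    (forall t, a <= t <= b -> on_bdry a b c d (t +i* y)) ->
    cts_on a b (fun t => f (t +i* y) / (t +i* y - s)) ->
    normc (cint a b (fun t => f (t +i* y) / (t +i* y - s))) <= 2 * (2 / r * k).
  move=> ycd Wy on cg.
  apply: (normc_cint_dominated a1 br cg _ _ _ (ltW Wy)); first exact: divr_ge0 (ltW r0).
    by move=> t tX; apply: cts_at_horizontal; exact: xb.
  by move=> t /on; exact: quo.
have vside x : a <= x <= b -> V x < k ->
    (forall t, c <= t <= d -> on_bdry a b c d (x +i* t)) ->
    cts_on c d (fun t => f (x +i* t) / (x +i* t - s)) ->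
    normc (cint c d (fun t => f (x +i* t) / (x +i* t - s))) <= 2 * (2 / r * k).
  move=> xab Vx on cg.
  apply: (normc_cint_dominated c1 dr cg _ _ _ (ltW Vx)); first exact: divr_ge0 (ltW r0).
    by move=> t tX; apply: cts_at_vertical; exact: yb.
  by move=> t /on; exact: quo.
have B1 := hside c _ Wc _ k1; have B2 := hside d _ Wd _ k2.
have B3 := vside b _ Vb _ k3; have B4 := vside a _ Va _ k4.
have total : normc (rint (fun z => f z / (z - s)) a b c d) <= 16 / r * k.
  apply: le_trans (normc_triangle _ _) _.
  rewrite Normc.normcM normci mul1r.
  have -> : 16 / r * k = (2 * (2 / r * k) + 2 * (2 / r * k)) +
      (2 * (2 / r * k) + 2 * (2 / r * k)) by ring.
  apply: lerD; apply: le_trans (normc_triangle _ _) _; rewrite normcN; apply: lerD.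
  - by apply: B1; [rewrite lexx|move=> t ht; left; split=> //; left].
  - by apply: B2; [rewrite lexx andbT|move=> t ht; left; split=> //; right].
  - by apply: B3; [rewrite lexx andbT|move=> t ht; right; split=> //; right].
  - by apply: B4; [rewrite lexx|move=> t ht; right; split=> //; left].
rewrite cauchy_rectangle// Normc.normcM in total.
(* When [f s = 0] the threshold [k] is 0, and a nonnegative integral cannot be below it. *)
have [fs0|fs0] := eqVneq (normc (f s)) 0.
  have : V a < 0 by move: Va; rewrite /k fs0 mul0r.
  by rewrite ltNge Rintegral_ge0// => t _; exact: normc_ge0.
have fs : 0 < normc (f s) by rewrite lt_neqAle eq_sym fs0 normc_ge0.
have : normc (f s) * 16^-1 <= 16 / r * k.
  by apply: le_trans total; rewrite ler_pM2l.
have -> : 16 / r * k = normc (f s) * 64^-1 by rewrite /k; field; rewrite gt_eqF.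
by rewrite ler_pM2l//; lra.
Qed.

End AreaEstimate.

(** * Holomorphic functions on normed spaces *)

Section RealNorm.
Variable R : realType.
Local Notation C := (Cplx R).
Variable V : normedModType C.
Implicit Types (x y : V) (t : C).

(** The norm of a space over [C] is itself an element of [C], real and nonnegative; [vn] is the same
    number in [R]. *)
Definition vn x : R := Re `|x|.

Lemma vnE x : `|x| = (vn x)%:C.
Proof. by rewrite /vn RRe_real// normr_real. Qed.

Lemma vn_ge0 x : 0 <= vn x.
Proof. by rewrite -lecR -vnE normr_ge0. Qed.

Lemma vnD x y : vn (x + y) <= vn x + vn y.
Proof. by rewrite -lecR rmorphD/= -!vnE ler_normD. Qed.

Lemma vnZ t x : vn (t *: x) = normc t * vn x.
Proof. by apply/complexI; rewrite rmorphM/= -!vnE normrZ normcE. Qed.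

Lemma vn0 : vn (0 : V) = 0.
Proof. by rewrite /vn normr0. Qed.

Lemma vn_eq0 x : (vn x == 0) = (x == 0).
Proof. by rewrite -(inj_eq (@complexI R)) -vnE normr_eq0. Qed.

Lemma vn_gt0 x : (0 < vn x) = (x != 0).
Proof. by rewrite lt_neqAle vn_ge0 andbT eq_sym vn_eq0. Qed.

Lemma nbhs_vnP (z : V) (A : set V) : nbhs z A ->
  exists2 r : R, 0 < r & forall x, vn (x - z) < r -> A x.
Proof.
move=> /nbhs_ballP[e /= /posC_real[r r0 ->] H]; exists r => // x xz.
by apply: H; rewrite -ball_normE /=; have := xz; rewrite -ltcR -vnE distrC.
Qed.

Lemma vn_nbhs (z : V) (A : set V) (r : R) : 0 < r ->
  (forall x, vn (x - z) < r -> A x) -> nbhs z A.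
Proof.
move=> r0 H; apply/nbhs_ballP; exists (r%:C); first by rewrite /= ltcR.
by move=> x; rewrite -ball_normE /= distrC => xz; apply: H; rewrite -ltcR -vnE.
Qed.

Lemma open_vn (Omega : set V) z : open Omega -> Omega z ->
  exists2 r : R, 0 < r & forall x, vn (x - z) < r -> Omega x.
Proof. by move=> oO Oz; apply: nbhs_vnP; exact: open_nbhs_nbhs. Qed.

Definition fdiff (f : V -> C) z (L : V -> C) := forall e : R, 0 < e ->
  exists2 r : R, 0 < r & forall h, vn h < r ->
    normc (f (z + h) - f z - L h) <= e * vn h.

Lemma diff_fdiff (f : V -> C) z : differentiable f z -> fdiff f z ('d f z).
Proof.
move=> /diff_locallyP[_ /eqaddoP H] e e0.
have e0C : (0 : C) < e%:C by rewrite ltcR.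
have [r r0 Hr] := nbhs_vnP (H _ e0C); exists r => // h hr.
have := Hr h; rewrite subr0 => /(_ hr) /=.
rewrite vnE normcE -rmorphM/= lecR; congr (normc _ <= _).
by rewrite /= !fctE /= [h + z]addrC opprD addrA.
Qed.

(** A remainder estimate determines the differential among continuous linear maps; the bound [K]
    supplies the continuity of [L]. *)
Lemma fdiff_diff (f : V -> C) z (L : {linear V -> C}) (K : R) :
  (forall h, normc (L h) <= K * vn h) -> fdiff f z L ->
  differentiable f z /\ 'd f z = L :> (V -> C).
Proof.
move=> HK H.
have cL : continuous L.
  apply: bounded_linear_continuous; apply/linear_boundedP.
  exists (K%:C); split; first by apply/complex_realP; exists K.
  move=> r /ltW Kr x; rewrite vnE normcE; apply: (@le_trans _ _ ((K * vn x)%:C)).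
    by rewrite lecR.
  by rewrite rmorphM/= ler_wpM2r ?lecR ?vn_ge0.
have HL : f \o shift z = cst (f z) + L +o_ (0 : V) id.
  apply/eqaddoP => e /posC_real[r r0 ->].
  have [d d0 Hd] := H _ r0; apply: (vn_nbhs d0) => h; rewrite subr0 => /Hd.
  rewrite /= !fctE /= vnE normcE -rmorphM/= lecR.
  by rewrite [h + z]addrC opprD addrA.
have dE := diff_unique cL HL.
split; last exact: dE.
apply/diff_locallyP.
rewrite dE.
split.
exact: cL.
exact: HL.
Qed.

(** Restriction to a complex line reduces estimates on a normed space to functions of one complex
    variable. *)
Lemma fdiff_line (f : V -> C) z v (t : C) (L : {linear V -> C}) :
  fdiff f (z + t *: v) L -> cdiff (fun s : C => f (z + s *: v)) t (L v).
Proof.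
move=> H e e0.
have k0 : 0 < vn v + 1 by rewrite ltr_wpDl// vn_ge0.
have [r r0 Hr] := H _ (divr_gt0 e0 k0).
exists (r / (vn v + 1)); first exact: divr_gt0.
move=> s; rewrite ltr_pdivlMr// => sr.
have vs : vn (s *: v) <= normc s * (vn v + 1).
  by rewrite vnZ ler_wpM2l ?normc_ge0// lerDl.
have := Hr _ (le_lt_trans vs sr).
have -> : z + t *: v + s *: v = z + (t + s) *: v by rewrite scalerDl addrA.
have -> : L (s *: v) = L v * s by rewrite linearZ /= [LHS]mulrC.
move=> h; apply: le_trans h _.
have := ler_wpM2l (divr_ge0 (ltW e0) (ltW k0)) vs => h; apply: le_trans h _.
have -> : e / (vn v + 1) * (normc s * (vn v + 1)) = e * normc s.
  by field; rewrite gt_eqF.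
exact: lexx.
Qed.

Lemma diff_line (f : V -> C) z v (t : C) : differentiable f (z + t *: v) ->
  cdiff (fun s : C => f (z + s *: v)) t ('d f (z + t *: v) v).
Proof. by move=> /diff_fdiff; exact: fdiff_line. Qed.

End RealNorm.

(** * Convergence of complex sequences *)

Section Sequences.
Variable R : realType.
Implicit Types (u w : nat -> R[i]) (l : R[i]).

Definition ccvg u l := forall e : R, 0 < e -> exists N, forall n, (N <= n)%N ->
  normc (u n - l) <= e.

Lemma ccvgP (u : nat -> Cplx R) (l : Cplx R) : ccvg u l <-> u @ \oo --> l.
Proof.
split.
  move=> H; apply/cvgrPdist_le => e /posC_real[r r0 ->].
  have [N HN] := H _ r0; near=> n; rewrite distrC normcE lecR; apply: HN.
  by near: n; exact: nbhs_infty_ge.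
move=> /cvgrPdist_le H e e0.
have e0C : (0 : Cplx R) < e%:C by rewrite ltcR.
have [N _ HN] := H _ e0C; exists N => n Nn.
by have := HN n Nn; rewrite /= distrC normcE lecR.
Unshelve. all: by end_near. Qed.

Lemma ccvg_unique u l l' : ccvg u l -> ccvg u l' -> l = l'.
Proof.
move=> H H'; apply/eqP; rewrite -subr_eq0 -normc_eq0 eq_le normc_ge0 andbT.
rewrite leNgt; apply/negP => h0.
have h30 : 0 < normc (l - l') / 3 by rewrite divr_gt0.
have [N HN] := H _ h30; have [N' HN'] := H' _ h30.
have := HN (maxn N N') (leq_maxl _ _); have := HN' (maxn N N') (leq_maxr _ _).
have := normc_triangle (u (maxn N N') - l') (l - u (maxn N N')).
have -> : u (maxn N N') - l' + (l - u (maxn N N')) = l - l' by ring.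
rewrite [normc (l - u _)]normcBC; lra.
Qed.

Lemma ccvgD u w l k : ccvg u l -> ccvg w k -> ccvg (fun n => u n + w n) (l + k).
Proof.
move=> H H' e e0; have e20 : 0 < e / 2 by rewrite divr_gt0.
have [N HN] := H _ e20; have [N' HN'] := H' _ e20; exists (maxn N N') => n.
rewrite geq_max => /andP[/HN h1 /HN' h2].
have -> : u n + w n - (l + k) = (u n - l) + (w n - k) by ring.
by apply: le_trans (normc_triangle _ _) _; lra.
Qed.

Lemma ccvgZ a u l : ccvg u l -> ccvg (fun n => a * u n) (a * l).
Proof.
move=> H e e0; have k0 : 0 < normc a + 1 by rewrite ltr_wpDl// normc_ge0.
have [N HN] := H _ (divr_gt0 e0 k0); exists N => n /HN.
rewrite -mulrBr Normc.normcM ler_pdivlMr// => h; apply: le_trans h.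
by rewrite mulrC ler_wpM2l ?normc_ge0// lerDl.
Qed.

Lemma ccvgB u w l k : ccvg u l -> ccvg w k -> ccvg (fun n => u n - w n) (l - k).
Proof.
move=> H /(ccvgZ (-1)) H'; have := ccvgD H H'.
by rewrite mulN1r; congr ccvg; apply/funext => n; rewrite mulN1r.
Qed.

Lemma ccvgJ u l : ccvg u l -> ccvg (fun n => (u n)^*%C) l^*%C.
Proof.
move=> H e /H[N HN]; exists N => n /HN; congr (_ <= _).
by rewrite -rmorphB normcJ.
Qed.

Lemma ccvg_le u l (M : R) : ccvg u l -> (forall n, normc (u n) <= M) ->
  normc l <= M.
Proof.
move=> H HM; rewrite leNgt; apply/negP => h0.
have h20 : 0 < (normc l - M) / 2 by rewrite divr_gt0// subr_gt0.
have [N HN] := H _ h20; have := HN N (leqnn _); have := HM N.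
have := normc_triangle (u N) (l - u N); rewrite addrC subrK.
by rewrite [normc (l - _)]normcBC; lra.
Qed.

Lemma ccauchy u : (forall e : R, 0 < e -> exists N, forall n m, (N <= n)%N ->
    (N <= m)%N -> normc (u n - u m) <= e) -> exists l, ccvg u l.
Proof.
move=> H.
have real_case (r : nat -> R) : (forall e : R, 0 < e -> exists N, forall n m,
    (N <= n)%N -> (N <= m)%N -> `|r n - r m| <= e) ->
    exists l : R, forall e, 0 < e -> exists N, forall n, (N <= n)%N ->
    `|r n - l| <= e.
  move=> Hr; have cr : cvg (r @ \oo).
    apply/cauchy_cvgP/cauchy_exP => e e0.
    have e20 : 0 < e / 2 by rewrite divr_gt0.
    have [N HN] := Hr _ e20; exists (r N).
    exists N => // n /= Nn; rewrite -ball_normE /=.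
    by apply: le_lt_trans (HN N n (leqnn _) Nn) _; rewrite ltr_pdivrMr// ltr_pMr// ltr1n.
  exists (lim (r @ \oo)) => e e0.
  have /cvgrPdist_le /(_ _ e0)[N _ HN] := cr.
  by exists N => n Nn; rewrite distrC; exact: HN.
have [|a Ha] := real_case (fun n => Re (u n)).
  move=> e /H[N HN]; exists N => n m Nn Nm; apply: le_trans (HN n m Nn Nm).
  by rewrite -ReN -ReD; exact: Re_le_normc.
have [|b Hb] := real_case (fun n => Im (u n)).
  move=> e /H[N HN]; exists N => n m Nn Nm; apply: le_trans (HN n m Nn Nm).
  by rewrite -ImN -ImD; exact: Im_le_normc.
exists (a +i* b) => e e0; have e20 : 0 < e / 2 by rewrite divr_gt0.
have [N HN] := Ha _ e20; have [N' HN'] := Hb _ e20; exists (maxn N N') => n.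
rewrite geq_max => /andP[/HN h1 /HN' h2].
apply: le_trans (normc_le_ReIm _) _; rewrite ReD ImD ReN ImN /=.
by rewrite [e]splitr lerD.
Qed.

End Sequences.

(** * Derivative estimates and limits of holomorphic functions *)

Section HolomorphicEstimates.
Variable R : realType.

Lemma normc_scale_sub (t : R) (x y : R[i]) : 0 <= t ->
  normc (t%:C * x - t%:C * y) = t * normc (x - y).
Proof. by move=> t0; rewrite -mulrBr Normc.normcM normc_real ger0_norm. Qed.

(** Here [u] and [v] are the linear parts of the increments [p - q] and [x - y] of two functions
    whose values are close to common limits [w] and [z]: four errors on values and two
    remainders. *)
Lemma increments_close (u v p q x y w z : R[i]) (a b : R) :
  normc (p - w) <= a -> normc (x - w) <= a -> normc (q - z) <= a ->
  normc (y - z) <= a -> normc (p - q - u) <= b -> normc (x - y - v) <= b ->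
  normc (u - v) <= 4 * a + 2 * b.
Proof.
move=> pw xw qz yz hu hv.
have -> : u - v = (x - y - v) - (p - q - u) + ((p - w) - (x - w)) -
  ((q - z) - (y - z)) by ring.
have t1 := normc_triangle (x - y - v) (- (p - q - u)).
have t2 := normc_triangle (p - w) (- (x - w)).
have t3 := normc_triangle (q - z) (- (y - z)).
have t4 := normc_triangle (x - y - v - (p - q - u)) (p - w - (x - w)).
rewrite !normcN in t1 t2 t3.
by apply: le_trans (normc_triangle _ _) _; rewrite normcN; lra.
Qed.

Local Notation C := (Cplx R).
Variable V : normedModType C.
Implicit Types (x z h v : V) (f : V -> C).

(** The 9 comes from applying the one-variable estimate on a square of half-side r / 3, which fits
    in the disc of radius [r]. *)
Definition holo_cst : R := 9 * taylor_cst R.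

Lemma holo_cst_ge0 : 0 <= holo_cst.
Proof. by rewrite /holo_cst /taylor_cst !mulr_ge0. Qed.

(** One-variable estimate on the complex line through [z] directed by the unit vector h / |h|,
    evaluated at the parameter |h|. The range r / 6 is half of the half-side r / 3. *)
Lemma holo_taylor f z r M : 0 < r ->
  (forall x, vn (x - z) < r -> differentiable f x) ->
  (forall x, vn (x - z) < r -> normc (f x) <= M) ->
  forall h, normc ('d f z h) <= holo_cst * M / r * vn h /\
    (vn h <= r / 6 ->
     normc (f (z + h) - f z - 'd f z h) <= holo_cst * M / r ^+ 2 * vn h ^+ 2).
Proof.
move=> r0 Hd HM h; have [->|h0] := eqVneq h 0.
  rewrite linear0 vn0 Normc.normc0 mulr0 lexx; split=> // _.
  by rewrite addr0 subrr subr0 Normc.normc0 expr0n mulr0.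
have vh : 0 < vn h by rewrite vn_gt0.
have M0 : 0 <= M.
  by apply: le_trans (normc_ge0 (f z)) (HM z _); rewrite subrr vn0.
pose v := ((vn h)^-1%:C : C) *: h.
have vv : vn v = 1.
  by rewrite /v vnZ normc_real ger0_norm ?invr_ge0 ?vn_ge0// mulVf// gt_eqF.
have hv : h = ((vn h)%:C : C) *: v.
  by rewrite /v scalerA -rmorphM/= mulfV ?gt_eqF// scale1r.
have near_z (p : R[i]) : in_rect (- (r / 3)) (r / 3) (- (r / 3)) (r / 3) p ->
    vn (z + (p : C) *: v - z) < r.
  move=> /andP[h1 h2]; rewrite addrAC subrr add0r vnZ vv mulr1.
  apply: le_lt_trans (normc_le_ReIm p) _.
  have a1 : `|Re p| <= r / 3 by rewrite ler_norml.
  have a2 : `|Im p| <= r / 3 by rewrite ler_norml.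
  by clear -r0 a1 a2; lra.
have r30 : 0 < r / 3 by rewrite divr_gt0.
have dl p : in_rect (- (r / 3)) (r / 3) (- (r / 3)) (r / 3) p ->
    exists l, cdiff (fun s : C => f (z + s *: v)) p l.
  by move=> /near_z/Hd; exists ('d f (z + (p : C) *: v) v); exact: diff_line.
have bl p : in_rect (- (r / 3)) (r / 3) (- (r / 3)) (r / 3) p ->
    normc (f (z + (p : C) *: v)) <= M.
  by move=> /near_z/HM.
have dz : cdiff (fun s : C => f (z + s *: v)) 0 ('d f z v).
  have := @diff_line R V f z v 0; rewrite scale0r addr0; apply.
  by apply: Hd; rewrite subrr vn0.
have [T1 T2] := taylor_estimate r30 dl bl dz.
have dh : 'd f z h = (vn h)%:C * 'd f z v by rewrite {1}hv linearZ.
have nh : normc ((vn h)%:C : R[i]) = vn h.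
  by rewrite normc_real ger0_norm// vn_ge0.
split.
  rewrite dh Normc.normcM nh mulrC ler_wpM2r ?vn_ge0//.
  apply: le_trans T1 _; rewrite /holo_cst.
  have -> : taylor_cst R * M / (r / 3) = 3 * (taylor_cst R * M / r).
    by field; rewrite gt_eqF.
  have -> : 9 * taylor_cst R * M / r = 9 * (taylor_cst R * M / r) by ring.
  by rewrite ler_wpM2r ?ler_nat// !mulr_ge0 ?invr_ge0// ltW.
move=> hr; have := T2 (vn h)%:C; rewrite nh.
have -> : r / 3 / 2 = r / 6 by field.
move=> /(_ hr) /=; rewrite -[z + _%:C *: v]/(z + ((vn h)%:C : C) *: v) -hv.
rewrite scale0r addr0 -dh => H; apply: le_trans H _.
rewrite ler_wpM2r ?exprn_ge0 ?vn_ge0// /holo_cst.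
have -> : taylor_cst R * M / (r / 3) ^+ 2 = 9 * taylor_cst R * M / r ^+ 2.
  by field; rewrite gt_eqF.
exact: lexx.
Qed.

(* By [holo_taylor], difference quotients approximate the derivatives uniformly in the sequence, so the derivatives are Cauchy. *)
Lemma holo_limit (g : nat -> V -> C) (G : V -> C) z r M : 0 < r ->
  (forall n x, vn (x - z) < r -> differentiable (g n) x) ->
  (forall n x, vn (x - z) < r -> normc (g n x) <= M) ->
  (forall x, vn (x - z) < r -> ccvg (g ^~ x) (G x)) ->
  differentiable G z /\ forall v, ccvg (fun n => 'd (g n) z v) ('d G z v).
Proof.
move=> r0 Hd HM HG.
have T n h := @holo_taylor (g n) z r M r0 (Hd n) (HM n) h.
have M0 : 0 <= M.
  by apply: le_trans (normc_ge0 (g 0%N z)) (HM 0%N z _); rewrite subrr vn0.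
have exL v : exists l, ccvg (fun n => 'd (g n) z v) l.
  apply: ccauchy => e e0.
  have v0 := vn_ge0 v.
  pose K := holo_cst * M / r ^+ 2 * vn v ^+ 2.
  have K0 : 0 <= K.
    by rewrite /K !mulr_ge0 ?invr_ge0 ?exprn_ge0 ?holo_cst_ge0// ltW.
  have K1 : 0 < K + 1 by rewrite ltr_wpDl.
  have v1 : 0 < vn v + 1 by rewrite ltr_wpDl.
  pose t := Num.min (r / 6 / (vn v + 1)) (e / 4 / (K + 1)).
  have t0 : 0 < t by rewrite lt_min !divr_gt0.
  have tv : vn ((t%:C : C) *: v) <= r / 6.
    rewrite vnZ normc_real ger0_norm ?(ltW t0)//.
    by apply: mulr_le_divD1; rewrite ?ge_min ?lexx// ltW.
  have tK : t * K <= e / 4.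
    by apply: mulr_le_divD1; rewrite ?ge_min ?lexx ?orbT// ltW.
  have inB : vn (z + (t%:C : C) *: v - z) < r.
    rewrite addrAC subrr add0r; apply: le_lt_trans tv _.
    by rewrite ltr_pdivrMr// ltr_pMr// ltr1n.
  have inz : vn (z - z) < r by rewrite subrr vn0.
  (* Four values within t e / 8 of their limits and two remainders of size t e / 4 add up to t e;
     division by [t] then gives the Cauchy bound [e]. *)
  have et0 : 0 < t * e / 8 by rewrite divr_gt0// mulr_gt0.
  have [N1 HN1] := HG _ inB _ et0; have [N2 HN2] := HG _ inz _ et0.
  exists (maxn N1 N2) => n m; rewrite !geq_max => /andP[/HN1 a1 /HN2 a2].
  move=> /andP[/HN1 b1 /HN2 b2].
  have [_ /(_ tv) c1] := T n ((t%:C : C) *: v).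
  have [_ /(_ tv) c2] := T m ((t%:C : C) *: v).
  have KE : holo_cst * M / r ^+ 2 * vn ((t%:C : C) *: v) ^+ 2 = t * (t * K).
    by rewrite vnZ normc_real ger0_norm ?(ltW t0)// /K; ring.
  rewrite KE in c1 c2.
  have tt : t * (t * K) <= t * (e / 4) by rewrite ler_wpM2l// ltW.
  have {}c1 := le_trans c1 tt; have {}c2 := le_trans c2 tt.
  rewrite -(ler_pM2l t0).
  have -> : t * normc ('d (g n) z v - 'd (g m) z v) =
     normc ('d (g n) z ((t%:C : C) *: v) - 'd (g m) z ((t%:C : C) *: v)).
    have lz k : 'd (g k) z ((t%:C : C) *: v) = t%:C * 'd (g k) z v.
      by rewrite linearZ.
    apply/esym; apply: etrans (normc_scale_sub _ _ (ltW t0)).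
    by congr (normc (_ - _)); exact: lz.
  apply: le_trans (increments_close a1 b1 a2 b2 c1 c2) _.
  by clear; lra.
have [L HL] := choice exL.
have linL : linear (L : V -> C).
  move=> a v w; apply: (ccvg_unique (HL _)).
  rewrite [X in ccvg X](_ : _ = fun n => a * 'd (g n) z v + 'd (g n) z w).
    by apply: ccvgD => //; exact: ccvgZ.
  by apply/funext => n; rewrite linearP.
pose L' : {linear V -> C} := HB.pack_for {linear V -> C} (L : V -> C)
  (GRing.isLinear.Build _ _ _ _ (L : V -> C) linL).
have [dG dGE] : differentiable G z /\ 'd G z = L' :> (V -> C).
  apply: (@fdiff_diff R V G z L' (holo_cst * M / r)).
    by move=> h; apply: (ccvg_le (HL h)) => n; have [] := T n h.
  (* The constant in the remainder estimate does not depend on [n], so the estimate survives the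
     limit and makes [L] the differential of [G]. *)
  have rem h : vn h <= r / 6 ->
      normc (G (z + h) - G z - L h) <= holo_cst * M / r ^+ 2 * vn h ^+ 2.
    move=> hr; apply: (ccvg_le (u := fun n => g n (z + h) - g n z - 'd (g n) z h)).
      apply: ccvgB => //; apply: ccvgB; apply: HG.
        rewrite addrAC subrr add0r; apply: le_lt_trans hr _.
        by rewrite ltr_pdivrMr// ltr_pMr// ltr1n.
      by rewrite subrr vn0.
    by move=> n; have [_ /(_ hr)] := T n h.
  move=> e e0; pose K := holo_cst * M / r ^+ 2.
  have K0 : 0 <= K.
    by rewrite /K !mulr_ge0 ?invr_ge0 ?exprn_ge0 ?holo_cst_ge0// ltW.
  have K1 : 0 < K + 1 by rewrite ltr_wpDl.
  exists (Num.min (r / 6) (e / (K + 1))); first by rewrite lt_min !divr_gt0.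
  move=> h; rewrite lt_min => /andP[h1 h2]; apply: le_trans (rem h (ltW h1)) _.
  rewrite -/K expr2 mulrA ler_wpM2r ?vn_ge0//.
  by rewrite mulrC; exact: mulr_le_divD1 (vn_ge0 h) K0 (ltW h2).
split; first exact: dG.
move=> v; have E : 'd G z v = L v := congr1 (fun F : V -> C => F v) dGE.
exact: (eq_ind_r (fun l => ccvg _ l) (HL v) E).
Qed.

End HolomorphicEstimates.

(** * Mean value inequality in several variables *)

Section MeanValue.
Variable R : realType.
Local Notation RT := (measurableTypeR R : measurableType _).
Local Notation mu := (@lebesgue_measure R).

Definition ctuple n := n.-tuple (RT * RT).

Definition cbox n (c : ctuple n) (r : R) : set (ctuple n) :=
  [set t | forall j, csquare (tnth c j).1 (tnth c j).2 r (tnth t j)].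

Definition tset n (t : ctuple n) (j : 'I_n) (s : RT * RT) : ctuple n :=
  [tuple if k == j then s else tnth t k | k < n].

Definition csplit (s : R[i]) : RT * RT := (Re s, Im s).

(** Holomorphy in one coordinate at a time is the form that an induction on the number of
    coordinates preserves. *)
Definition tuple_separately_holomorphic n (D : set (ctuple n))
    (F : ctuple n -> R[i]) :=
  forall t, D t -> forall j, exists l,
    cdiff (fun s => F (tset t j (csplit s))) ((tnth t j).1 +i* (tnth t j).2) l.

Definition tuple_continuous n (D : set (ctuple n)) (F : ctuple n -> R[i]) :=
  forall t, D t -> forall e, 0 < e -> exists2 d : R, 0 < d &
    forall s, tuple_close d s t -> D s -> normc (F s - F t) < e.

Lemma measurable_cbox n (c : ctuple n) r : measurable (cbox c r).
Proof.
rewrite (_ : cbox c r = \bigcap_(j in [set: 'I_n])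
    (fun t : ctuple n => tnth t j) @^-1` csquare (tnth c j).1 (tnth c j).2 r).
  apply: fin_bigcap_measurable; first exact: finite_finset.
  move=> j _; rewrite -[X in measurable X]setTI; apply: measurable_tnth => //.
  exact: measurable_csquare.
by apply/seteqP; split=> [t tc j _|t tc j]; exact: tc.
Qed.

Lemma measurable_nonexpansive_tuple n (D : set (ctuple n)) (F : ctuple n -> R[i])
    (g : R[i] -> R) : (forall x y, `|g x - g y| <= normc (x - y)) -> measurable D ->
  tuple_continuous D F -> measurable_fun D (fun t => g (F t)).
Proof.
move=> Hg mD cF; apply: measurable_fun_tuple => // t Dt e e0.
have [d d0 Hd] := cF t Dt e e0; exists d => // s st Ds.
exact: le_lt_trans (Hg _ _) (Hd s st Ds).
Qed.

Lemma tnth_cons0 n (q : RT * RT) (t : ctuple n) : tnth (tuple_cons (q, t)) ord0 = q.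
Proof. exact: tnth0. Qed.

Lemma tnth_consS n (q : RT * RT) (t : ctuple n) j :
  tnth (tuple_cons (q, t)) (lift ord0 j) = tnth t j.
Proof. exact: tnthS. Qed.

Lemma tset_cons0 n (q s : RT * RT) (t : ctuple n) :
  tset (tuple_cons (q, t)) ord0 s = tuple_cons (s, t).
Proof.
apply: eq_from_tnth => k; rewrite tnth_mktuple.
have [->|] := eqVneq k ord0; first by rewrite tnth_cons0.
by case: (unliftP ord0 k) => [j ->|->] // _; rewrite !tnth_consS.
Qed.

Lemma tset_consS n (q s : RT * RT) (t : ctuple n) j :
  tset (tuple_cons (q, t)) (lift ord0 j) s = tuple_cons (q, tset t j s).
Proof.
apply: eq_from_tnth => k; rewrite tnth_mktuple.
case: (unliftP ord0 k) => [i ->|->]; last by rewrite !tnth_cons0.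
by rewrite !tnth_consS tnth_mktuple (inj_eq lift_inj).
Qed.

Lemma cbox_cons n (q : RT * RT) (t : ctuple n) (c0 : RT * RT) (c : ctuple n) r :
  cbox (tuple_cons (c0, c)) r (tuple_cons (q, t)) <->
  csquare c0.1 c0.2 r q /\ cbox c r t.
Proof.
split=> [H|[H0 H] j].
  split; first by have := H ord0; rewrite !tnth_cons0.
  by move=> j; have := H (lift ord0 j); rewrite !tnth_consS.
case: (unliftP ord0 j) => [i ->|->]; last by rewrite !tnth_cons0.
by rewrite !tnth_consS; exact: H.
Qed.

Lemma tuple_consE n (t : ctuple n.+1) :
  exists q t', t = tuple_cons (q, t').
Proof.
exists (thead t), [tuple of behead t].
by apply: val_inj; rewrite {1}(tuple_eta t).
Qed.

Lemma integral_lebesgueCS n (G : ctuple n.+1 -> \bar R) :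
  measurable_fun setT G -> (forall t, 0 <= G t)%E ->
  (\int[lebesgueC R n.+1]_t G t =
   \int[prod_measure (prod_measure mu mu) (lebesgueC R n)]_z G (tuple_cons z))%E.
Proof.
move=> mG G0.
transitivity (\int[pushforward (prod_measure (prod_measure mu mu) (lebesgueC R n))
    (@tuple_cons _ _ n)]_t G t)%E; first by [].
rewrite ge0_integral_pushforward ?preimage_setT//.
exact: measurable_tuple_cons.
Qed.

(** The constant of [area_estimate]; each complex coordinate contributes one factor. *)
Definition mean_cst (r : R) : R := r ^+ 2 / (16 * 128).

(** Induction on [n]: [area_estimate] in the first coordinate with the others frozen at the centre,
    then the induction hypothesis in the remaining coordinates for each value of the first one, and
    Tonelli to join the two. *)
Lemma tuple_mean_value n (c : ctuple n) (r : R) (F : ctuple n -> R[i]) : 0 < r ->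
  tuple_separately_holomorphic (cbox c r) F -> tuple_continuous (cbox c r) F ->
  ((normc (F c) * mean_cst r ^+ n)%:E <=
    \int[lebesgueC R n]_(t in cbox c r) (normc (F t))%:E)%E.
Proof.
move=> r0; have m0 : 0 <= mean_cst r by rewrite /mean_cst divr_ge0 ?sqr_ge0.
elim: n c F => [|n IH] c F hF cF.
  rewrite expr0 mulr1 integral_dirac//; last 2 first.
  - exact: measurable_cbox.
  - by apply/measurable_EFinP; apply: (measurable_nonexpansive_tuple (@normc_dist R)) => //;
    exact: measurable_cbox.
  rewrite diracE mem_set ?mul1e; last by case.
  by rewrite (tuple0 c).
have [c0 [c' cE]] := tuple_consE c.
have cc0 : csquare c0.1 c0.2 r c0.
  by split; rewrite /= in_itv/= lerBlDr lerDl ltW.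
have cc' : cbox c' r c'.
  by move=> j; split; rewrite /= in_itv/= lerBlDr lerDl ltW.
have inB q t : csquare c0.1 c0.2 r q -> cbox c' r t -> cbox c r (tuple_cons (q, t)).
  by rewrite cE => h1 h2; apply/cbox_cons.
have mF : measurable_fun (cbox c r) (fun t => (normc (F t))%:E).
  apply/measurable_EFinP; apply: (measurable_nonexpansive_tuple (@normc_dist R)) => //.
  exact: measurable_cbox.
pose G := (fun t => (normc (F t))%:E) \_ (cbox c r).
have mG : measurable_fun setT G.
  exact/(measurable_restrictT _ (measurable_cbox c r)).
have G0 t : (0 <= G t)%E.
  by rewrite /G /patch; case: ifP => // _; rewrite lee_fin normc_ge0.
rewrite integral_mkcond -/G.
rewrite integral_lebesgueCS//.
have mGc : measurable_fun setT (G \o @tuple_cons _ _ n).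
  by apply: measurableT_comp mG _; exact: measurable_tuple_cons.
rewrite -[prod_measure (prod_measure mu mu) (lebesgueC R n)]
  /(prod_measure mu mu \x lebesgueC R n)%E fubini_tonelli1//.
pose f s := F (tuple_cons (csplit s, c')).
have hf p : in_rect (c0.1 - r) (c0.1 + r) (c0.2 - r) (c0.2 + r) p ->
    exists l, cdiff f p l.
  move=> /andP[p1 p2].
  have pB : csquare c0.1 c0.2 r (csplit p) by split; rewrite /= in_itv.
  have [l Hl] := hF _ (inB _ _ pB cc') ord0; exists l.
  rewrite tnth_cons0 in Hl.
  have -> : p = (csplit p).1 +i* (csplit p).2 by case: (p).
  by move: Hl; congr cdiff; apply/funext => s; rewrite tset_cons0.
have mf : measurable_fun (csquare c0.1 c0.2 r)
    (fun q : RT * RT => normc (f (q.1 +i* q.2))).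
  by apply: measurable_normc_csquare => p /hf[l]; exact: cdiff_ccont.
have fA : ((normc (f (c0.1 +i* c0.2)) * mean_cst r)%:E <=
   \int[prod_measure mu mu]_(q in csquare c0.1 c0.2 r)
      (normc (f (q.1 +i* q.2)))%:E)%E.
  exact: area_estimate.
have -> : F c = f (c0.1 +i* c0.2) by rewrite cE /f /csplit /=; case: (c0).
rewrite exprS mulrA EFinM.
apply: (@le_trans _ _ (\int[prod_measure mu mu]_(q in csquare c0.1 c0.2 r)
      ((mean_cst r ^+ n)%:E * (normc (f (q.1 +i* q.2)))%:E))%E).
  rewrite ge0_integralZl//.
  - by rewrite muleC lee_wpmul2l// lee_fin exprn_ge0.
  - exact: measurable_csquare.
  - exact/measurable_EFinP.
  - by move=> q _; rewrite lee_fin normc_ge0.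
  - by rewrite lee_fin exprn_ge0.
rewrite [leLHS]integral_mkcond; apply: ge0_le_integral => //.
- move=> q _; rewrite /patch; case: ifP => // _.
  by rewrite mule_ge0// lee_fin ?exprn_ge0 ?normc_ge0.
- apply/(measurable_restrictT _ (measurable_csquare c0.1 c0.2 r)).
  by apply: measurable_funeM; apply/measurable_EFinP.
- by apply: measurable_fun_fubini_tonelli_F => // z; exact: G0.
- move=> q _; rewrite /patch; case: ifPn => [/set_mem qB|_]; last first.
    by apply: integral_ge0 => t _; exact: G0.
  have -> : f (q.1 +i* q.2) = F (tuple_cons (q, c')).
    by rewrite /f /csplit /=; case: (q).
  rewrite -EFinM mulrC.
  apply: le_trans (IH c' (fun t => F (tuple_cons (q, t))) _ _) _.
  + move=> t tB j; have [l Hl] := hF _ (inB _ _ qB tB) (lift ord0 j); exists l.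
    rewrite tnth_consS in Hl; move: Hl; congr cdiff; apply/funext => s.
    by rewrite tset_consS.
  + move=> t tB e e0; have [d d0 Hd] := cF _ (inB _ _ qB tB) e e0.
    exists d => // s st sB; apply: Hd; last exact: inB.
    move=> j; case: (unliftP ord0 j) => [i ->|->].
      by rewrite !tnth_consS; exact: st.
    by rewrite !tnth_cons0 !subrr normr0.
  + rewrite integral_mkcond /fubini_F le_eqVlt; apply/orP; left; apply/eqP.
    apply: eq_integral => t _; rewrite /G /= /patch.
    case: ifPn => [/set_mem tB|tB].
      by rewrite mem_set//; exact: inB.
    rewrite memNset// => /=; rewrite cE => /cbox_cons[_ tB'].
    by move/negP : tB; apply; exact/mem_set.
Qed.

End MeanValue.

Lemma big_nat_cond_recr (V : nmodType) (J : pred nat) (F : nat -> V) N :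
  \sum_(0 <= j < N.+1 | J j) F j =
  \sum_(0 <= j < N | J j) F j + (if J N then F N else 0).
Proof. by rewrite big_mkcond big_nat_recr//= -big_mkcond. Qed.

(** * The space A^2 *)

Section SquareIntegrable.
Context d (T : measurableType d) (R : realType).
Variables (mu : {measure set T -> \bar R}) (D : set T).
Hypothesis mD : measurable D.
Implicit Types (u v w : T -> R[i]) (c : R[i]).

Definition nsq u : \bar R := (\int[mu]_(t in D) (normc (u t) ^+ 2)%:E)%E.

Definition sqi u := [/\ measurable_fun D (fun t => Re (u t)),
  measurable_fun D (fun t => Im (u t)) & (nsq u < +oo)%E].

Definition rnsq u := fine (nsq u).

Definition cip u w : R[i] :=
  (\int[mu]_(t in D) Re (u t * (w t)^*%C)) +i*
  (\int[mu]_(t in D) Im (u t * (w t)^*%C)).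

Lemma measurable_normc_sq u : measurable_fun D (fun t => Re (u t)) ->
  measurable_fun D (fun t => Im (u t)) ->
  measurable_fun D (fun t => normc (u t) ^+ 2).
Proof.
move=> mr mi.
have -> : (fun t => normc (u t) ^+ 2) = (fun t => Re (u t) ^+ 2 + Im (u t) ^+ 2).
  by apply/funext => t; rewrite normc_sqr.
by apply: measurable_funD; exact: measurable_funX.
Qed.

Lemma nsq_ge0 u : (0 <= nsq u)%E.
Proof. by apply: integral_ge0 => t _; rewrite lee_fin sqr_ge0. Qed.

Lemma rnsq_ge0 u : 0 <= rnsq u.
Proof. by rewrite /rnsq fine_ge0// nsq_ge0. Qed.

Lemma rnsqE u : sqi u -> nsq u = (rnsq u)%:E.
Proof. by move=> [_ _ h]; rewrite /rnsq fineK// ge0_fin_numE// nsq_ge0. Qed.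

Lemma integrable_nsq u : sqi u ->
  mu.-integrable D (EFin \o (fun t => normc (u t) ^+ 2)).
Proof.
move=> [mr mi fin]; apply/integrableP; split.
  exact/measurable_EFinP/measurable_normc_sq.
apply: le_lt_trans fin; rewrite /nsq le_eqVlt; apply/orP; left; apply/eqP.
by apply: eq_integral => t _; rewrite /= ger0_norm ?sqr_ge0.
Qed.

Lemma rnsqR u : rnsq u = \int[mu]_(t in D) (normc (u t) ^+ 2).
Proof. by []. Qed.

Lemma normc_prod_le (x y : R[i]) : normc x * normc y <= normc x ^+ 2 + normc y ^+ 2.
Proof. by have := sqr_ge0 (normc x - normc y); have := normc_ge0 x;
  have := normc_ge0 y; nra. Qed.

Lemma integrable_dominated (g : T -> R) u w : measurable_fun D g ->
  sqi u -> sqi w -> (forall t, `|g t| <= normc (u t) * normc (w t)) ->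
  mu.-integrable D (EFin \o g).
Proof.
move=> mg su sw H.
have := integrableD mD (integrable_nsq su) (integrable_nsq sw).
apply: le_integrable => //; first exact/measurable_EFinP.
move=> t _ /=; rewrite lee_fin; apply: le_trans (H t) _.
by apply: le_trans (normc_prod_le _ _) _; exact: ler_norm.
Qed.

Lemma integrableM_cst (k : R) (g : T -> R) : mu.-integrable D (EFin \o g) ->
  mu.-integrable D (EFin \o (fun t => k * g t)).
Proof. by move=> ig; exact: (integrableZl mD k ig). Qed.

Lemma integrable_Re_cip u w : sqi u -> sqi w ->
  mu.-integrable D (EFin \o (fun t => Re (u t * (w t)^*%C))).
Proof.
move=> su sw; apply: (integrable_dominated _ su sw).
  case: su sw => [mr mi _] [mr' mi' _].
  have -> : (fun t => Re (u t * (w t)^*%C)) =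
      (fun t => Re (u t) * Re (w t) + Im (u t) * Im (w t)).
    by apply/funext => t; rewrite ReM ReJ ImJ mulrN opprK.
  by apply: measurable_funD; exact: measurable_funM.
by move=> t; apply: le_trans (Re_le_normc _) _; rewrite Normc.normcM normcJ.
Qed.

Lemma integrable_Im_cip u w : sqi u -> sqi w ->
  mu.-integrable D (EFin \o (fun t => Im (u t * (w t)^*%C))).
Proof.
move=> su sw; apply: (integrable_dominated _ su sw).
  case: su sw => [mr mi _] [mr' mi' _].
  have -> : (fun t => Im (u t * (w t)^*%C)) =
      (fun t => Im (u t) * Re (w t) - Re (u t) * Im (w t)).
    by apply/funext => t; rewrite ImM ReJ ImJ mulrN addrC.
  by apply: measurable_funB; exact: measurable_funM.
by move=> t; apply: le_trans (Im_le_normc _) _; rewrite Normc.normcM normcJ.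
Qed.

Lemma normc_add_sqr (x y c : R[i]) : normc (x + c * y) ^+ 2 =
  normc x ^+ 2 + (2 * Re (c^*%C * (x * y^*%C)) + normc c ^+ 2 * normc y ^+ 2).
Proof. by rewrite !normc_sqr; case: x; case: y; case: c => a b e f g h /=; ring. Qed.

Lemma measurable_comb (x y : R) (f g : T -> R) :
  measurable_fun D f -> measurable_fun D g ->
  measurable_fun D (fun t => x * f t + y * g t).
Proof.
by move=> mf mg; apply: measurable_funD; apply: measurable_funM.
Qed.

Lemma sqi_comb u w c : sqi u -> sqi w -> sqi (fun t => u t + c * w t).
Proof.
move=> su sw; have := su; have := sw => -[mr' mi' fin'] [mr mi fin].
have m1 : measurable_fun D (fun t => Re (u t + c * w t)).
  have -> : (fun t => Re (u t + c * w t)) =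
      (fun t => Re (u t) + (Re c * Re (w t) + - Im c * Im (w t))).
    by apply/funext => t; rewrite ReD ReM mulNr.
  by apply: measurable_funD => //; exact: measurable_comb.
have m2 : measurable_fun D (fun t => Im (u t + c * w t)).
  have -> : (fun t => Im (u t + c * w t)) =
      (fun t => Im (u t) + (Re c * Im (w t) + Im c * Re (w t))).
    by apply/funext => t; rewrite ImD ImM.
  by apply: measurable_funD => //; exact: measurable_comb.
split=> //.
have i1 := integrable_nsq su; have i2 := integrable_nsq sw.
have := integrableD mD (integrableZl mD 2 i1)
  (integrableZl mD (2 * normc c ^+ 2) i2).
move=> /integrableP[_]; apply: le_lt_trans; apply: ge0_le_integral => //.
- by move=> t _; rewrite lee_fin sqr_ge0.
- exact/measurable_EFinP/measurable_normc_sq.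
- apply: measurableT_comp => //; apply: emeasurable_funD;
    apply: measurable_funeM; exact/measurable_EFinP/measurable_normc_sq.
- move=> t _ /=; rewrite lee_fin.
  apply: le_trans (ler_norm _).
  have h1 : normc (u t + c * w t) <= normc (u t) + normc c * normc (w t).
    by rewrite -Normc.normcM; exact: normc_triangle.
  have h0 := normc_ge0 (u t + c * w t).
  apply: (@le_trans _ _ ((normc (u t) + normc c * normc (w t)) ^+ 2)).
    by rewrite ler_pXn2r// nnegrE// (le_trans h0).
  have := sqr_ge0 (normc (u t) - normc c * normc (w t)).
  by clear; nra.
Qed.

Lemma cip_combl u w v c : sqi u -> sqi w -> sqi v ->
  cip (fun t => u t + c * w t) v = cip u v + c * cip w v.
Proof.
move=> su sw sv.
have r1 := integrable_Re_cip su sv; have i1 := integrable_Im_cip su sv.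
have r2 := integrable_Re_cip sw sv; have i2 := integrable_Im_cip sw sv.
apply: complex_eqP; rewrite ?(ReD, ImD, ReM, ImM) /=.
- rewrite -!RintegralZl// -RintegralB//; [|exact: integrableM_cst..].
  rewrite -RintegralD//; last exact: (integrableB mD (integrableM_cst _ r2) (integrableM_cst _ i2)).
  by apply: eq_Rintegral => t _; rewrite mulrDl ReD -mulrA [Re (c * _)]ReM.
- rewrite -!RintegralZl// -RintegralD//; [|exact: integrableM_cst..].
  rewrite -RintegralD//; last exact: (integrableD mD (integrableM_cst _ i2) (integrableM_cst _ r2)).
  by apply: eq_Rintegral => t _; rewrite mulrDl ImD -mulrA [Im (c * _)]ImM.
Qed.

Lemma rnsq_comb u w c : sqi u -> sqi w ->
  rnsq (fun t => u t + c * w t) =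
  rnsq u + (2 * Re (c^*%C * cip u w) + normc c ^+ 2 * rnsq w).
Proof.
move=> su sw.
have r1 := integrable_Re_cip su sw; have i1 := integrable_Im_cip su sw.
have n1 := integrable_nsq su; have n2 := integrable_nsq sw.
have iD (f g : T -> R) : mu.-integrable D (EFin \o f) ->
    mu.-integrable D (EFin \o g) ->
    mu.-integrable D (EFin \o (fun t => f t + g t)).
  by move=> jf jg; exact: (integrableD mD jf jg).
have -> : Re (c^*%C * cip u w) = \int[mu]_(t in D) (Re (c^*%C * (u t * (w t)^*%C))).
  rewrite ReM ReJ ImJ mulNr opprK /= -!RintegralZl// -RintegralD//; [|exact: integrableM_cst..].
  by apply: eq_Rintegral => t _; rewrite [Re (c^*%C * _)]ReM ReJ ImJ mulNr opprK.
have r3 : mu.-integrable D (EFin \o (fun t => Re (c^*%C * (u t * (w t)^*%C)))).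
  have := iD _ _ (integrableM_cst (Re c) r1) (integrableM_cst (Im c) i1).
  by congr (mu.-integrable D _); apply/funext => t /=;
    rewrite [Re (c^*%C * _)]ReM ReJ ImJ mulNr opprK.
rewrite !rnsqR -!RintegralZl// -RintegralD//; [|exact: integrableM_cst..].
rewrite -RintegralD//; last by apply: iD; exact: integrableM_cst.
by apply: eq_Rintegral => t _; rewrite normc_add_sqr.
Qed.

(** * Finite orthonormal sums and Bessel's inequality *)

Section Orthonormal.
Variables (J : pred nat) (e : nat -> T -> R[i]).
Hypothesis se : forall j, J j -> sqi (e j).
Hypothesis oe : forall j k, J j -> J k -> cip (e j) (e k) = (j == k)%:R.
Hypothesis ne : forall j, J j -> rnsq (e j) = 1.

Definition psum (a : nat -> R[i]) N t := \sum_(0 <= j < N | J j) a j * e j t.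

Lemma psum0 a t : psum a 0 t = 0.
Proof. by rewrite /psum big_geq. Qed.

Lemma psumS a N : psum a N.+1 =
  if J N then fun t => psum a N t + a N * e N t else psum a N.
Proof.
apply/funext => t; rewrite /psum big_nat_cond_recr.
by case: ifP => // _; rewrite addr0.
Qed.

Lemma sqi_psum a N : sqi (psum a N).
Proof.
elim: N => [|N IH]; last by rewrite psumS; case: ifP => // JN; apply: sqi_comb => //; exact: se.
have -> : psum a 0 = (fun=> 0) by apply/funext => t; rewrite psum0.
split; [exact: measurable_cst|exact: measurable_cst|].
rewrite /nsq (eq_integral (cst 0%E)) ?integral0// => t _.
by rewrite Normc.normc0 expr0n.
Qed.

Lemma cip_psum0 a N k : J k -> (N <= k)%N -> cip (psum a N) (e k) = 0.
Proof.
move=> Jk; elim: N => [|N IH] Nk.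
  apply: complex_eqP => /=; rewrite -[RHS](Rintegral_set0 mu (cst 0)) Rintegral_mkcond;
   rewrite [RHS]Rintegral_mkcond; apply: eq_Rintegral => t _;
   by rewrite /patch in_set0; case: ifP => // _; rewrite psum0 mul0r.
rewrite psumS; case: ifP => JN; last exact: IH (ltnW Nk).
rewrite cip_combl//; [|exact: sqi_psum|exact: se|exact: se].
by rewrite IH ?(ltnW Nk)// oe// ltn_eqF// mulr0 addr0.
Qed.

Lemma rnsq_psum a N : rnsq (psum a N) = \sum_(0 <= j < N | J j) normc (a j) ^+ 2.
Proof.
elim: N => [|N IH].
  rewrite big_geq// rnsqR -[RHS](Rintegral_set0 mu (cst 0)) Rintegral_mkcond.
  rewrite [RHS]Rintegral_mkcond; apply: eq_Rintegral => t _.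
  rewrite /patch in_set0; case: ifP => // _.
  by rewrite psum0 Normc.normc0 expr0n.
rewrite psumS big_nat_cond_recr -IH.
case: ifP => JN; last by rewrite addr0.
rewrite rnsq_comb; [|exact: sqi_psum|exact: se].
by rewrite cip_psum0// mulr0 mulr0 add0r ne// mulr1.
Qed.

(** Pythagoras, one term at a time: the partial sum is orthogonal to the next basis element, so the
    remainder still has the coefficient of [f] there, and removing it lowers the squared norm by the
    square of its modulus. *)
Lemma rnsq_sub_psum f N : sqi f ->
  rnsq (fun t => f t - psum (fun j => cip f (e j)) N t) =
  rnsq f - \sum_(0 <= j < N | J j) normc (cip f (e j)) ^+ 2.
Proof.
move=> sf; set a := fun j => cip f (e j).
have sub_ M : sqi (fun t => f t - psum a M t).
  have := sqi_comb (-1) sf (sqi_psum a M).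
  by congr sqi; apply/funext => t; rewrite mulN1r.
elim: N => [|N IH].
  rewrite big_geq// subr0; congr rnsq; apply/funext => t.
  by rewrite psum0 subr0.
rewrite psumS big_nat_cond_recr; case: ifP => JN; last by rewrite addr0.
have -> : (fun t => f t - (psum a N t + a N * e N t)) =
    (fun t => (f t - psum a N t) + (- a N) * e N t).
  by apply/funext => t; ring.
rewrite rnsq_comb; [|exact: sub_|exact: se].
have -> : cip (fun t => f t - psum a N t) (e N) = a N.
  have -> : (fun t => f t - psum a N t) = (fun t => f t + (-1) * psum a N t).
    by apply/funext => t; rewrite mulN1r.
  rewrite cip_combl//; [|exact: sqi_psum|exact: se].
  by rewrite cip_psum0// mulr0 addr0.
have -> : Re ((- a N)^*%C * a N) = - normc (a N) ^+ 2.
  by rewrite rmorphN mulNr [_ * a N]mulrC mulcJ ReN.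
rewrite IH ne// mulr1 normcN /a; ring.
Qed.

Lemma bessel f N : sqi f ->
  \sum_(0 <= j < N | J j) normc (cip f (e j)) ^+ 2 <= rnsq f.
Proof.
by move=> /(@rnsq_sub_psum _ N) H; rewrite -subr_ge0 -H; exact: rnsq_ge0.
Qed.

End Orthonormal.

End SquareIntegrable.

(** * Square integrable holomorphic functions and point evaluation *)

Section BergmanSpace.
Variables (R : realType) (n : nat).
Local Notation C := (Cplx R).
Implicit Types (x y z : 'rV[C]_n) (Omega : set 'rV[C]_n) (f g : 'rV[C]_n -> C).

Lemma vn_entry x j : normc (x 0 j) <= vn x.
Proof.
have : `|x 0 j| <= mx_norm x :> C.
  rewrite mx_normE -[leLHS]nngE num_le.
  exact: (le_bigmax _ (fun i => `|x i.1 i.2|%:nng) (ord0, j)).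
by rewrite -[mx_norm x]/(`|x|) [`|x|]vnE normcE lecR.
Qed.

Lemma vn_row_le x (r : R) : 0 <= r -> (forall j, normc (x 0 j) <= r) -> vn x <= r.
Proof.
move=> r0 H; have [->|x0] := eqVneq x 0; first by rewrite vn0.
have : mx_norm x != 0 by rewrite -[mx_norm x]/(`|x|) normr_eq0.
move=> /mx_norm_neq0[[i j] /= E]; move: (E); rewrite -[mx_norm x]/(`|x|) vnE.
by rewrite ord1 normcE => /complexI ->.
Qed.

Definition coords x : ctuple R n :=
  [tuple (Re (x 0 j), Im (x 0 j)) | j < n].

Lemma of_coordsK x : of_coords (coords x) = x.
Proof.
by apply/rowP => j; rewrite mxE tnth_mktuple /=; case: (x 0 j).
Qed.

Lemma of_coords_entry (t : ctuple R n) j :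
  of_coords t 0 j = (tnth t j).1 +i* (tnth t j).2.
Proof. by rewrite mxE. Qed.

Lemma of_coords_close (r : R) (s t : ctuple R n) : 0 < r ->
  tuple_close (r / 2) s t -> vn (of_coords s - of_coords t : 'rV[C]_n) <= r.
Proof.
move=> r0 H; apply: vn_row_le => [|j]; first exact: ltW.
have [h1 h2] := H j; rewrite !mxE.
apply: le_trans (normc_le_ReIm _) _ => /=.
by rewrite [r]splitr lerD// ltW.
Qed.

Definition cdom Omega : set (ctuple R n) := @of_coords R n @^-1` Omega.

Lemma measurable_cdom Omega : open Omega -> measurable (cdom Omega).
Proof.
move=> oO; apply: measurable_tuple_open => t Ot.
have [r r0 Hr] := open_vn oO Ot.
have r40 : 0 < r / 2 / 2 by rewrite !divr_gt0.
exists (r / 2 / 2) => // s st; apply: Hr.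
apply: le_lt_trans (of_coords_close _ st) _; first by rewrite divr_gt0.
by rewrite ltr_pdivrMr// ltr_pMr// ltr1n.
Qed.

Lemma diff_continuous_vn f x : differentiable f x -> forall e : R, 0 < e ->
  exists2 r : R, 0 < r & forall y, vn (y - x) < r -> normc (f y - f x) < e.
Proof.
move=> /differentiable_continuous/cvgrPdist_lt H e e0.
have e0C : (0 : C) < e%:C by rewrite ltcR.
have [r r0 Hr] := nbhs_vnP (H _ e0C); exists r => // y /Hr.
by rewrite /= distrC normcE ltcR.
Qed.

Lemma tuple_continuous_hol Omega f : holomorphic_on Omega f ->
  tuple_continuous (cdom Omega) (fun t => f (of_coords t)).
Proof.
move=> hf t Ot e e0; have [r r0 Hr] := diff_continuous_vn (hf _ Ot) e0.
have r20 : 0 < r / 2 by rewrite divr_gt0.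
exists (r / 2 / 2); first by rewrite divr_gt0.
move=> s st _; apply: Hr; apply: le_lt_trans (of_coords_close r20 st) _.
by rewrite ltr_pdivrMr// ltr_pMr// ltr1n.
Qed.

Lemma of_coords_tset (t : ctuple R n) j (s : R[i]) :
  of_coords (tset t j (csplit s)) = of_coords t +
   ((s - ((tnth t j).1 +i* (tnth t j).2)) : C) *: delta_mx 0 j :> 'rV[C]_n.
Proof.
apply/rowP => k; rewrite !mxE tnth_mktuple /=.
case: eqVneq => [->|kj]; last by rewrite mulr0 addr0.
rewrite mulr1 [RHS]addrC subrK; by case: (s).
Qed.

Lemma tuple_separately_hol Omega f : holomorphic_on Omega f ->
  tuple_separately_holomorphic (cdom Omega) (fun t => f (of_coords t)).
Proof.
move=> hf t Ot j; set p := (tnth t j).1 +i* (tnth t j).2.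
have hd : differentiable f (of_coords t + (0 : C) *: delta_mx 0 j).
  by rewrite scale0r addr0; exact: hf.
exists ('d f (of_coords t + (0 : C) *: delta_mx 0 j) (delta_mx 0 j)) => e e0.
have [r r0 Hr] := diff_line hd e0; exists r => // h /Hr.
rewrite !of_coords_tset subrr.
have -> : p + h - p = 0 + h by ring.
by [].
Qed.

Definition csqi Omega f :=
  sqi (lebesgueC R n) (cdom Omega) (fun t => f (of_coords t)).

Definition L2n Omega f : R :=
  rnsq (lebesgueC R n) (cdom Omega) (fun t => f (of_coords t)).

Lemma L2n_ge0 Omega f : 0 <= L2n Omega f.
Proof. exact: rnsq_ge0. Qed.

Lemma bergman_sqi Omega f : open Omega -> bergman_space Omega f -> csqi Omega f.
Proof.
move=> oO [hf fin]; have mD := measurable_cdom oO.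
have cf := tuple_continuous_hol hf.
by split=> //; [exact: (measurable_nonexpansive_tuple (@Re_dist R))|exact: (measurable_nonexpansive_tuple (@Im_dist R))].
Qed.

Lemma L2norm_sqE Omega f : open Omega -> bergman_space Omega f ->
  L2norm_sq Omega f = (L2n Omega f)%:E.
Proof. by move=> oO Bf; exact: (rnsqE (bergman_sqi oO Bf)). Qed.

Lemma hol_comb Omega f g (c : C) : holomorphic_on Omega f ->
  holomorphic_on Omega g -> holomorphic_on Omega (fun z => f z + c * g z).
Proof.
move=> hf hg z Oz; apply: (@differentiableD _ _ _ f (fun z => c * g z)).
  exact: hf.
exact: (@differentiableZ _ _ _ g c z (hg z Oz)).
Qed.

Lemma bergman_comb Omega f g (c : C) : open Omega -> bergman_space Omega f ->
  bergman_space Omega g -> bergman_space Omega (fun z => f z + c * g z).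
Proof.
move=> oO Bf Bg; split; first by apply: hol_comb; [case: Bf|case: Bg].
by have [_ _] := sqi_comb (measurable_cdom oO) c (bergman_sqi oO Bf) (bergman_sqi oO Bg).
Qed.

(** The mean value inequality controls a modulus by its integral; applied to the holomorphic
    function f^2 it bounds |f|^2 by the squared norm. The box of half-side [r] lies in the ball of
    radius 2 r. *)
Lemma bergman_mean_value Omega f x (r : R) : open Omega -> 0 < r ->
  (forall y, vn (y - x) <= 2 * r -> Omega y) -> bergman_space Omega f ->
  normc (f x) ^+ 2 * mean_cst r ^+ n <= L2n Omega f.
Proof.
move=> oO r0 Hr Bf; have [hf _] := Bf; rewrite -lee_fin -(L2norm_sqE oO Bf).
pose F (t : ctuple R n) : R[i] := f (of_coords t) * f (of_coords t).
have FE t : normc (F t) = normc (f (of_coords t)) ^+ 2.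
  by rewrite /F Normc.normcM.
have sub : cbox (coords x) r `<=` cdom Omega.
  move=> t tB; apply: Hr; apply: vn_row_le; first by rewrite mulr_ge0// ltW.
  move=> j; have := tB j; rewrite tnth_mktuple => -[/=].
  rewrite !in_itv/= => /andP[a1 a2] /andP[b1 b2]; rewrite !mxE.
  apply: le_trans (normc_le_ReIm _) _; rewrite ReD ImD ReN ImN /=.
  have h1 : `|(tnth t j).1 - Re (x 0 j)| <= r by rewrite ler_distl a1 a2.
  have h2 : `|(tnth t j).2 - Im (x 0 j)| <= r by rewrite ler_distl b1 b2.
  by rewrite mulr2n mulrDl mul1r lerD.
have hol2 : holomorphic_on Omega (fun z => f z * f z).
  by move=> z Oz; apply: (@differentiableM _ _ f f); exact: hf.
have := @tuple_mean_value R n (coords x) r F r0.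
rewrite FE of_coordsK => H; apply: le_trans (H _ _) _.
- by move=> t /sub; exact: (tuple_separately_hol hol2).
- move=> t tB e e0; have [d d0 Hd] := tuple_continuous_hol hol2 (sub _ tB) e0.
  by exists d => // s st sB; apply: Hd => //; exact: sub.
- under eq_integral do rewrite FE.
  apply: ge0_subset_integral => //.
  + exact: measurable_cbox.
  + exact: measurable_cdom.
  + have [m1 m2 _] := bergman_sqi oO Bf.
    by apply/measurable_EFinP; exact: measurable_normc_sq.
  + by move=> t _; rewrite lee_fin sqr_ge0.
Qed.

Lemma bergman_eval_bound Omega z : open Omega -> Omega z ->
  exists r K : R, [/\ 0 < r, 0 <= K, (forall x, vn (x - z) < r -> Omega x) &
   forall f, bergman_space Omega f -> forall x, vn (x - z) < r ->
     normc (f x) ^+ 2 <= K * L2n Omega f].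
Proof.
move=> oO Oz; have [r r0 Hr] := open_vn oO Oz.
(* A quarter of the radius: for [x] within r / 2 of [z], the ball of radius 2 (r / 4) around [x]
   stays inside the one of radius [r] around [z]. *)
have r40 : 0 < r / 4 by rewrite divr_gt0.
have m0 : 0 < mean_cst (r / 4) ^+ n.
  by rewrite exprn_gt0// /mean_cst divr_gt0// exprn_gt0.
exists (r / 2), (mean_cst (r / 4) ^+ n)^-1; split=> //.
- by rewrite divr_gt0.
- by rewrite invr_ge0 ltW.
- move=> x xz; apply: Hr; apply: lt_le_trans xz _.
  by rewrite ler_pdivrMr// ler_pMr// ler1n.
move=> f Bf x xz; rewrite mulrC ler_pdivlMr//.
apply: bergman_mean_value => // y yx; apply: Hr.
have -> : y - z = (y - x) + (x - z) by rewrite addrA subrK.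
apply: le_lt_trans (vnD _ _) _.
by clear -yx xz r0; lra.
Qed.

End BergmanSpace.

Lemma le_of_eq (R : realType) (a b : R) : a = b -> a <= b.
Proof. by move=> ->. Qed.

Lemma eq_ccvg (R : realType) (u w : nat -> R[i]) (l : R[i]) :
  (forall k, u k = w k) -> ccvg u l -> ccvg w l.
Proof. by move=> /funext ->. Qed.

(** * Holomorphy of directional derivatives *)

Section DirectionalDerivative.
Variable R : realType.
Local Notation C := (Cplx R).
Variable V : normedModType C.
Implicit Types (x z v : V) (f : V -> C).

Lemma differentiable_shift f (c x : V) : differentiable f (x + c) ->
  differentiable (fun y => f (y + c)) x.
Proof.
move=> df; apply: (@differentiable_comp _ _ _ _ (fun y => y + c) f x) => //.
Qed.

Lemma diff_comb f (g : V -> C) (c : C) x v : differentiable f x ->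
  differentiable g x ->
  'd (fun y => f y + c * g y) x v = 'd f x v + c * 'd g x v.
Proof.
move=> df dg; have dz := @differentiableZ _ _ _ g c x dg.
apply: (etrans (congr1 (fun F : V -> C => F v) (@diffD _ _ _ f _ x df dz))).
congr (_ + _).
exact: (congr1 (fun F : V -> C => F v) (@diffZ _ _ _ g c x dg)).
Qed.

(** Difference quotients of [f] along [v] are holomorphic, and by [holo_taylor] they converge to the
    derivative at a rate uniform near [z]; [holo_limit] then applies. This provides the second
    derivatives that enter the metric. *)
Lemma dir_deriv_hol (Omega : set V) f v : open Omega -> holomorphic_on Omega f ->
  holomorphic_on Omega (fun x => 'd f x v : C).
Proof.
move=> oO hf z Oz.
have [r1 r10 H1] := open_vn oO Oz.
have zz : vn (z - z) < r1 by rewrite subrr vn0.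
have /differentiable_continuous/cvgrPdist_lt cf := hf _ Oz.
have e0C : (0 : C) < 1%:C by rewrite ltcR.
have [r2 r20 H2] := nbhs_vnP (cf _ e0C).
pose r := Num.min r1 r2; have r0 : 0 < r by rewrite lt_min r10.
pose M := normc (f z) + 1.
have Hd x : vn (x - z) < r -> differentiable f x.
  by rewrite lt_min => /andP[/H1 Ox _]; exact: hf.
have HM x : vn (x - z) < r -> normc (f x) <= M.
  rewrite lt_min => /andP[_ /H2]; rewrite /= normcE ltcR => h.
  have := normc_triangle (f x - f z : R[i]) (f z); rewrite subrK normcBC => h'.
  by apply: le_trans h' _; rewrite addrC lerD2l ltW.
have M0 : 0 <= M by rewrite addr_ge0// normc_ge0.
have h0 := @holo_cst_ge0 R.
pose q := r / 2; have q0 : 0 < q by rewrite divr_gt0.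
have half x y : vn (x - z) < q -> vn (y - x) < q -> vn (y - z) < r.
  move=> xz yx; have -> : y - z = (y - x) + (x - z) by rewrite addrA subrK.
  by apply: le_lt_trans (vnD _ _) _; rewrite [r]splitr ltrD.
have T x (xz : vn (x - z) < q) h := @holo_taylor R V f x q M q0
  (fun y yx => Hd y (half x y xz yx)) (fun y yx => HM y (half x y xz yx)) h.
have v1 : 0 < vn v + 1 by rewrite ltr_wpDl ?vn_ge0.
(* Steps tending to 0, scaled so that every displacement stays within the range q / 6 where the
   Taylor estimate holds. *)
pose t (m : nat) : R := q / 6 / (vn v + 1) / m.+1%:R.
have t0 m : 0 < t m by rewrite /t !divr_gt0.
have t1 m : t m <= q / 6 / (vn v + 1).
  by rewrite /t ler_pdivrMr// ler_peMr ?ler1n// ltW// !divr_gt0.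
have tv m : vn (((t m)%:C : C) *: v) <= q / 6.
  rewrite vnZ normc_real ger0_norm ?(ltW (t0 m))//.
  exact: mulr_le_divD1 (ltW (t0 m)) (vn_ge0 v) (t1 m).
pose g m x : C := ((t m)^-1%:C : C) * (f (x + ((t m)%:C : C) *: v) - f x).
pose K := holo_cst R * M / q ^+ 2 * vn v ^+ 2.
have K0 : 0 <= K by rewrite /K !mulr_ge0 ?invr_ge0 ?exprn_ge0 ?vn_ge0// ltW.
have rem m x : vn (x - z) < q -> normc (g m x - 'd f x v) <= K * t m.
  move=> xz; have [_ /(_ (tv m))] := T x xz (((t m)%:C : C) *: v).
  rewrite vnZ normc_real ger0_norm ?(ltW (t0 m))// => H.
  have dl : 'd f x (((t m)%:C : C) *: v) = (t m)%:C * 'd f x v by rewrite linearZ.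
  rewrite dl in H.
  have E : g m x - 'd f x v = (t m)^-1%:C *
      (f (x + ((t m)%:C : C) *: v) - f x - (t m)%:C * 'd f x v).
    have := @divf_sub_lin R[i] (t m)%:C
      (f (x + ((t m)%:C : C) *: v) - f x) ('d f x v).
    rewrite -fmorphV [_ * (t m)%:C]mulrC; apply.
    by rewrite -normc_gt0 normc_real gtr0_norm.
  rewrite E Normc.normcM normc_real ger0_norm ?invr_ge0 ?(ltW (t0 m))//.
  rewrite mulrC ler_pdivrMr//; apply: le_trans H _.
  by rewrite /K; apply: le_of_eq; ring.
apply: (@holo_limit R V g (fun x => 'd f x v) z q
   (holo_cst R * M / q * vn v + K * (q / 6 / (vn v + 1))) q0 _ _ _).1.
- move=> m x xz; apply: (@differentiableZ _ _ _
    (fun x => f (x + ((t m)%:C : C) *: v) - f x) ((t m)^-1%:C) x).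
  apply: (@differentiableB _ _ _ (fun x => f (x + ((t m)%:C : C) *: v)) f).
    apply: differentiable_shift; apply: Hd; apply: (half x) => //.
    rewrite addrAC subrr add0r; apply: le_lt_trans (tv m) _.
    by rewrite ltr_pdivrMr// ltr_pMr// ltr1n.
  by apply: Hd; apply: (half x) => //; rewrite subrr vn0.
- move=> m x xz.
  have -> : g m x = 'd f x v + (g m x - 'd f x v) by rewrite addrC subrK.
  apply: le_trans (normc_triangle _ _) _; apply: lerD.
    by have [] := T x xz v.
  by apply: le_trans (rem m x xz) _; rewrite ler_wpM2l.
- move=> x xz e e0.
  have [N HN] : exists N : nat, K * (q / 6 / (vn v + 1)) / N.+1%:R < e.
    have := archi_boundP (normr_ge0 (K * (q / 6 / (vn v + 1)) / e)).
    set N := Num.bound _ => HN; exists N.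
    rewrite ltr_pdivrMr// -ltr_pdivrMl// [e^-1 * _]mulrC.
    apply: le_lt_trans (ler_norm _) _; apply: lt_le_trans HN _.
    by rewrite ler_nat.
  exists N => m Nm; apply: le_trans (rem m x xz) _; apply: le_trans (ltW HN).
  rewrite /t mulrA ler_wpM2l ?lef_pV2 ?posrE ?ler_nat ?ltnS//.
  by rewrite mulr_ge0// ltW// !divr_gt0.
Qed.

End DirectionalDerivative.

(** * Wirtinger derivatives *)

Section RealDerivative.
Variable R : realType.
Implicit Types (u w : R -> R[i]) (l : R[i]) (s : R -> R).

(** Real and imaginary parts are differentiated separately, as in [real_deriv]; the derivative is
    taken at 0 only, along the parameter of a line. *)
Definition rdiff u l := is_derive (0 : R) (1 : R) (fun t => Re (u t)) (Re l) /\
  is_derive (0 : R) (1 : R) (fun t => Im (u t)) (Im l).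

Lemma is_derive_linear_approx s (l : R) :
  (forall e, 0 < e -> exists2 r : R, 0 < r & forall t, `|t| < r ->
     `|s t - s 0 - t * l| <= e * `|t|) -> is_derive (0 : R) (1 : R) s l.
Proof.
move=> H; suff cv : (fun h : R => h^-1 *: ((s \o shift 0) (h *: (1 : R)) - s 0)) @ 0^' --> l.
  by split; [apply/cvg_ex; exists l|exact: cvg_lim].
apply/cvgrPdist_le => e /H[r r0 Hr]; exists r => //= h.
rewrite /ball_ [X in X -> _]/= sub0r normrN => hr h0.
rewrite /GRing.scale /= mulr1 addr0 distrC divf_sub_lin//.
have nh0 : 0 < `|h| by rewrite normr_gt0.
rewrite normrM normfV mulrC ler_pdivrMr// [l * h]mulrC.
exact: Hr.
Qed.

Lemma rdiff_linear_approx u l :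
  (forall e, 0 < e -> exists2 r : R, 0 < r & forall t : R, `|t| < r ->
     normc (u t - u 0 - t%:C * l) <= e * `|t|) -> rdiff u l.
Proof.
move=> H; split; apply: is_derive_linear_approx => e /H[r r0 Hr];
  exists r => // t /Hr; apply: le_trans.
  have -> : Re (u t) - Re (u 0) - t * Re l = Re (u t - u 0 - t%:C * l).
    by rewrite !ReD !ReN ReM /= mul0r subr0.
  exact: Re_le_normc.
have -> : Im (u t) - Im (u 0) - t * Im l = Im (u t - u 0 - t%:C * l).
  by rewrite !ImD !ImN ImM /= mul0r addr0.
exact: Im_le_normc.
Qed.

Lemma is_derive_local s s' (m r : R) : 0 < r ->
  (forall t, `|t| < r -> s t = s' t) -> is_derive (0 : R) (1 : R) s m ->
  is_derive (0 : R) (1 : R) s' m.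
Proof.
move=> r0 H; apply: near_eq_is_derive; exists r => //= t.
by rewrite /ball_ /= sub0r normrN; exact: H.
Qed.

Lemma rdiff_local u w l (r : R) : 0 < r ->
  (forall t, `|t| < r -> u t = w t) -> rdiff u l -> rdiff w l.
Proof.
move=> r0 H [h1 h2].
by split; [apply: is_derive_local h1|apply: is_derive_local h2]; try exact: r0;
  move=> t /H ->.
Qed.

Lemma is_derive_mul s s' (m m' : R) : is_derive (0 : R) (1 : R) s m ->
  is_derive (0 : R) (1 : R) s' m' ->
  is_derive (0 : R) (1 : R) (fun t => s t * s' t) (s 0 * m' + s' 0 * m).
Proof. by move=> h h'; apply: is_deriveM. Qed.

Lemma is_derive_inv s (m : R) : s 0 != 0 -> is_derive (0 : R) (1 : R) s m ->
  is_derive (0 : R) (1 : R) (fun t => (s t)^-1) (- (s 0) ^- 2 * m).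
Proof.
move=> s0 [hd <-]; split; first exact: derivableV.
by rewrite deriveV.
Qed.

Lemma is_derive_lnc s (m : R) : 0 < s 0 -> is_derive (0 : R) (1 : R) s m ->
  is_derive (0 : R) (1 : R) (fun t => ln (s t)) (m / s 0).
Proof.
move=> s0 [hd <-].
have [hl le] := is_derive1_ln s0.
have dl := (derivable1_diffP (@ln R) (s 0)).1 hl.
have ds := (derivable1_diffP s 0).1 hd.
have dc : differentiable (@ln R \o s) (0 : R) by exact: differentiable_comp ds dl.
split; first exact: (derivable1_diffP (@ln R \o s) 0).2 dc.
have := derive1_comp hd hl; rewrite !derive1E le mulrC => <-.
by [].
Qed.

Lemma rdiff_quotient u s l (m : R) : s 0 != 0 -> rdiff u l ->
  is_derive (0 : R) (1 : R) s m ->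
  rdiff (fun t => u t / (s t)%:C) ((l * (s 0)%:C - u 0 * m%:C) / ((s 0) ^+ 2)%:C).
Proof.
move=> s0 [h1 h2] hs; have hi := is_derive_inv s0 hs.
have i1 := is_derive_mul h1 hi; have i2 := is_derive_mul h2 hi.
have E t : u t / (s t)%:C = (Re (u t) * (s t)^-1) +i* (Im (u t) * (s t)^-1).
  by rewrite -fmorphV; apply: complex_eqP; rewrite ?ReM ?ImM /=; ring.
rewrite /rdiff -fmorphV.
have -> : (fun t => Re (u t / (s t)%:C)) = (fun t => Re (u t) * (s t)^-1).
  by apply/funext => t; rewrite E.
have -> : (fun t => Im (u t / (s t)%:C)) = (fun t => Im (u t) * (s t)^-1).
  by apply/funext => t; rewrite E.
split; [move: i1|move: i2]; congr is_derive; rewrite !(ReM, ImM, ReD, ImD, ReN, ImN) /=;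
  by field.
Qed.

Variables (n : nat).
Implicit Types (z v : 'rV[Cplx R]_n) (f : 'rV[Cplx R]_n -> Cplx R).

Lemma real_derivE f v z l : rdiff (fun t => f (z + (t%:C : Cplx R) *: v)) l ->
  real_deriv f v z = l.
Proof.
move=> [[_ h1] [_ h2]]; rewrite /real_deriv !derive1E.
by apply: complex_eqP.
Qed.

End RealDerivative.

Lemma conj_increment (R : realType) (a b c : R[i]) (t : R) :
  a^*%C - b^*%C - t%:C * c^*%C = (a - b - t%:C * c)^*%C.
Proof. by rewrite !rmorphB rmorphM/= oppr0. Qed.

Lemma diagonal_split (R : realType) (a b c p q w : R[i]) (t e : R) :
  normc (a - b - t%:C * p) <= e / 3 * `|t| ->
  normc (b - c - t%:C * w) <= e / 3 * `|t| -> normc (p - q) < e / 3 ->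
  normc (a - c - t%:C * (q + w)) <= e * `|t|.
Proof.
move=> h1 h2 h3.
have -> : a - c - t%:C * (q + w) = (a - b - t%:C * p) +
   (b - c - t%:C * w) + t%:C * (p - q) by ring.
apply: le_trans (normc_triangle _ _) _; rewrite Normc.normcM normc_real.
have := normc_triangle (a - b - t%:C * p) (b - c - t%:C * w).
have : `|t| * normc (p - q) <= `|t| * (e / 3) by rewrite ler_wpM2l// ltW.
by lra.
Qed.

(** * Differentiation along the diagonal *)

Section Diagonal.
Variable R : realType.
Local Notation C := (Cplx R).
Variable V : normedModType C.
Implicit Types (x y z v : V).

Lemma diff_scale (f : V -> C) z (c : C) v : 'd f z (c *: v) = c * 'd f z v.
Proof. by rewrite linearZ. Qed.

Lemma line_increment (f : V -> C) z v : differentiable f z -> forall e : R, 0 < e ->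
  exists2 r : R, 0 < r & forall t : R, `|t| < r ->
    normc (f (z + (t%:C : C) *: v) - f z - t%:C * 'd f z v) <= e * `|t|.
Proof.
move=> df e e0; have E0 : z + (0 : C) *: v = z by rewrite scale0r addr0.
have H : fdiff f (z + (0 : C) *: v) ('d f z).
  by rewrite E0; exact: diff_fdiff.
have [r r0 Hr] := fdiff_line H e0; exists r => // t tr.
have := Hr t%:C; rewrite normc_real => /(_ tr); apply: le_trans; apply: le_of_eq.
by rewrite E0 add0r [t%:C * _]mulrC.
Qed.

(* Split H(z + tv, z + tv) - H(z, z) through H(z, z + tv); the first increment is controlled by [holo_taylor] uniformly in the second argument. *)
Lemma rdiff_diagonal (H : V -> V -> C) z v r M (g : V -> C) : 0 < r ->
  (forall x y, vn (x - z) < r -> vn (y - z) < r -> differentiable (H ^~ y) x) ->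
  (forall x y, vn (x - z) < r -> vn (y - z) < r -> normc (H x y) <= M) ->
  (forall y, vn (y - z) < r -> H z y = (g y)^*%C) -> differentiable g z ->
  (forall e : R, 0 < e -> exists2 d : R, 0 < d & forall y, vn (y - z) < d ->
     normc ('d (H ^~ y) z v - 'd (H ^~ z) z v) < e) ->
  rdiff (fun t => H (z + (t%:C : C) *: v) (z + (t%:C : C) *: v))
    ('d (H ^~ z) z v + ('d g z v)^*%C).
Proof.
move=> r0 Hd HM Hg dg Hc; apply: rdiff_linear_approx => e e0.
have zz : vn (z - z) < r by rewrite subrr vn0.
have M0 : 0 <= M by apply: le_trans (normc_ge0 (H z z)) (HM _ _ zz zz).
have e30 : 0 < e / 3 by rewrite divr_gt0.
have v1 : 0 < vn v + 1 by rewrite ltr_wpDl ?vn_ge0.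
have [d1 d10 H1] := line_increment v dg e30.
have [d2 d20 H2] := Hc _ e30.
pose K := holo_cst R * M / r ^+ 2 * vn v ^+ 2.
have K0 : 0 <= K.
  by rewrite /K !mulr_ge0 ?invr_ge0 ?exprn_ge0 ?holo_cst_ge0 ?vn_ge0// ltW.
have K1 : 0 < K + 1 by rewrite ltr_wpDl.
pose q := Num.min (r / 6) d2.
have q0 : 0 < q by rewrite lt_min divr_gt0.
exists (Num.min (Num.min d1 (q / (vn v + 1))) (e / 3 / (K + 1))).
  by rewrite !lt_min d10 !divr_gt0.
move=> t; rewrite !lt_min => /andP[/andP[t0 t1] t2].
set h := (t%:C : C) *: v.
have vh : vn h = `|t| * vn v by rewrite /h vnZ normc_real.
have hq : vn h < q.
  rewrite vh; move: t1; rewrite ltr_pdivlMr//; apply: le_lt_trans.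
  by rewrite ler_wpM2l// lerDl.
have [h6 h2] : vn h <= r / 6 /\ vn h < d2.
  by move: hq; rewrite lt_min => /andP[/ltW].
have hr : vn h < r.
  by apply: le_lt_trans h6 _; rewrite ltr_pdivrMr// ltr_pMr// ltr1n.
have zh : vn (z + h - z) < r by rewrite addrAC subrr add0r.
have zh2 : vn (z + h - z) < d2 by rewrite addrAC subrr add0r.
have [_ /(_ h6) T0] := @holo_taylor R V (H ^~ (z + h)) z r M r0
  (fun x xz => Hd x _ xz zh) (fun x xz => HM x _ xz zh) h.
have dl : 'd (H ^~ (z + h)) z h = t%:C * 'd (H ^~ (z + h)) z v := diff_scale _ _ _ _.
have KE : holo_cst R * M / r ^+ 2 * vn h ^+ 2 = K * `|t| * `|t|.
  by rewrite vh /K; ring.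
have T1 : normc (H (z + h) (z + h) - H z (z + h) -
    t%:C * 'd (H ^~ (z + h)) z v) <= K * `|t| * `|t|.
  apply: le_trans (le_of_eq (congr1 (fun p : R[i] =>
    normc (H (z + h) (z + h) - H z (z + h) - p)) (esym dl))) _.
  exact: le_trans T0 (le_of_eq KE).
have T2' : normc (H z (z + h) - H z z - t%:C * ('d g z v)^*%C) <= e / 3 * `|t|.
  have E : H z (z + h) - H z z - t%:C * ('d g z v)^*%C =
      (g (z + h) - g z - t%:C * 'd g z v)^*%C.
    by rewrite (Hg _ zh) (Hg _ zz); exact: conj_increment.
  apply: le_trans (le_of_eq (congr1 (@Normc.normc R) E)) _.
  by rewrite normcJ; exact: H1.
have T3 := H2 _ zh2.
have KT : K * `|t| * `|t| <= e / 3 * `|t|.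
  by apply: ler_wpM2r => //; rewrite mulrC; exact: mulr_le_divD1 (ltW t2).
have {}T1 := le_trans T1 KT.
have E0 : z + ((0 : R)%:C : C) *: v = z by rewrite scale0r addr0.
rewrite E0.
exact: (diagonal_split T1 T2' T3).
Qed.

End Diagonal.

Lemma normc_sum_mul_le (R : realType) (a b : nat -> R[i]) (J : pred nat) N :
  normc (\sum_(0 <= j < N | J j) a j * b j) <=
  \sum_(0 <= j < N | J j) normc (a j) ^+ 2 +
  \sum_(0 <= j < N | J j) normc (b j) ^+ 2.
Proof.
elim: N => [|N IH]; first by rewrite !big_geq// Normc.normc0 addr0.
rewrite !big_nat_cond_recr; apply: le_trans (normc_triangle _ _) _.
rewrite addrACA; apply: lerD => //; case: ifP => _; last by rewrite Normc.normc0 addr0.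
by rewrite Normc.normcM; exact: normc_prod_le.
Qed.

Lemma is_derive_normc_sq (R : realType) (u : R -> R[i]) (l : R[i]) : rdiff u l ->
  is_derive (0 : R) (1 : R) (fun t => normc (u t) ^+ 2) (2 * Re (u 0 * l^*%C)).
Proof.
move=> [h1 h2]; have i1 := is_derive_mul h1 h1; have i2 := is_derive_mul h2 h2.
have E : (fun t => normc (u t) ^+ 2) =
   (fun t => Re (u t) * Re (u t)) + (fun t => Im (u t) * Im (u t)).
  by apply/funext => t; rewrite normc_sqr !expr2.
rewrite E; have := is_deriveD i1 i2; congr is_derive.
by rewrite ReM ReJ ImJ; ring.
Qed.

Section Wirtinger.
Variables (R : realType) (n : nat).
Local Notation C := (Cplx R).
Implicit Types (u : 'rV[C]_n -> C) (z v w : 'rV[C]_n).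

Lemma rdiff_line u z v : differentiable u z ->
  rdiff (fun t => u (z + (t%:C : C) *: v)) ('d u z v).
Proof.
move=> du; apply: rdiff_linear_approx => e /(line_increment v du)[r r0 Hr].
exists r => // t /Hr; have E0 : z + ((0 : R)%:C : C) *: v = z by rewrite scale0r addr0.
by rewrite E0.
Qed.

Lemma d_z_combine (a b : R[i]) :
  (a + b - 'i * ('i * a + - 'i * b)) / 2 = a.
Proof.
have -> : a + b - 'i * ('i * a + - 'i * b) = a + b - 'i ^+ 2 * (a - b) by ring.
by rewrite sqr_i; field.
Qed.

Lemma d_zbar_combine (a b : R[i]) :
  (a + b + 'i * ('i * a + - 'i * b)) / 2 = b.
Proof.
have -> : a + b + 'i * ('i * a + - 'i * b) = a + b + 'i ^+ 2 * (a - b) by ring.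
by rewrite sqr_i; field.
Qed.

(** The real differential is the sum of a complex linear part [a] and an antilinear part [b]; [d_z]
    retains the first and [d_zbar] the second. Only their behaviour under multiplication by i is
    required. *)
Lemma wirtinger u z (a b : 'rV[C]_n -> R[i]) :
  (forall w, rdiff (fun t => u (z + (t%:C : C) *: w)) (a w + b w)) ->
  (forall w, a (('i%C : C) *: w) = 'i * a w) ->
  (forall w, b (('i%C : C) *: w) = - 'i * b w) ->
  forall j, d_z j u z = a (delta_mx 0 j) /\ d_zbar j u z = b (delta_mx 0 j).
Proof.
move=> H Ha Hb j; rewrite /d_z /d_zbar !(real_derivE (H _)) Ha Hb.
by split; [exact: d_z_combine|exact: d_zbar_combine].
Qed.

Lemma row_delta_sum (v : 'rV[C]_n) : v = \sum_j v 0 j *: delta_mx 0 j.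
Proof.
by rewrite {1}(matrix_sum_delta v) big_ord1; apply: eq_bigr.
Qed.

Lemma diff_row_sum (u : 'rV[C]_n -> C) z v :
  'd u z v = \sum_j v 0 j * 'd u z (delta_mx 0 j).
Proof.
rewrite {1}(row_delta_sum v) linear_sum; apply: eq_bigr => j _.
exact: diff_scale.
Qed.

End Wirtinger.

Lemma addcJ (R : realType) (a : R[i]) : a + a^*%C = (2 * Re a)%:C.
Proof. by apply: complex_eqP; case: a => x y /=; ring. Qed.

Lemma normcBJ (R : realType) (a b c d : R[i]) : a = c^*%C -> b = d^*%C ->
  normc (a - b) = normc (c - d).
Proof. by move=> -> ->; rewrite -rmorphB normcJ. Qed.

(** Turns the coordinate Hessian of a logarithm, summed against two vectors, into a quotient of
    directional derivatives. *)
Lemma hessian_sum (F : fieldType) n (g : 'I_n -> 'I_n -> F) (e d x y : 'I_n -> F) s q :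
  \sum_j \sum_k (g j k * s - e k * d j) / q * x j * y k =
  ((\sum_j x j * \sum_k y k * g j k) * s - (\sum_k y k * e k) * \sum_j x j * d j) / q.
Proof.
rewrite mulrBl [_ * \sum_j x j * d j]mulr_sumr !mulr_suml -sumrB; apply: eq_bigr => j _.
rewrite mulr_sumr !mulr_suml -sumrB; apply: eq_bigr => k _; ring.
Qed.

Lemma sum_mul_sub_div (F : fieldType) n (x p q : 'I_n -> F) b s :
  (\sum_j x j * p j) / b - (\sum_j x j * q j) / s =
  \sum_j x j * (p j / b - q j / s).
Proof.
rewrite !mulr_suml -sumrB; apply: eq_bigr => j _.
by rewrite mulrBr !mulrA.
Qed.

(** With [b] = B(w, zeta), [l] and [d] the derivatives of B(., zeta) and B(., w) at w, and [s] =
    B(w, w), the left side is P'/P for P = |b|^2 / s. The right side exhibits it as a complex linear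
    expression plus its conjugate, as [wirtinger] expects. *)
Lemma logP_derivative (R : realType) (b l d : R[i]) (s : R) : b != 0 -> s != 0 ->
  (((2 * Re (b * l^*%C)) * s^-1 - normc b ^+ 2 * (s ^- 2 * (2 * Re d))) /
     (normc b ^+ 2 / s))%:C =
  l / b - d / s%:C + (l / b - d / s%:C)^*%C.
Proof.
move=> b0 s0; rewrite addcJ; congr (_%:C).
have nb0 : normc b ^+ 2 != 0 by rewrite expf_neq0// normc_eq0.
have E : l / b = (normc b ^+ 2)^-1%:C * (l * b^*%C).
  have bc0 : b^*%C != 0 by rewrite conjc_eq0.
  have n0 : (normc b ^+ 2)%:C != 0 by rewrite fmorph_eq0.
  apply: (mulIf b0); rewrite divfK// -mulrA -[_ * b]mulrA [b^*%C * b]mulrC mulcJ.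
  by rewrite mulrCA fmorphV /= mulVf// mulr1.
have E2 : Re (d / s%:C) = Re d / s by rewrite -fmorphV ReM /=; ring.
have E3 : Re (l / b) = (normc b ^+ 2)^-1 * Re (b * l^*%C).
  by rewrite E ReM !ReM /= !ReJ !ImJ; ring.
rewrite ReD ReN E3 E2; move: nb0; move: (normc b ^+ 2) (Re (b * _)) (Re d) => p q r p0.
by field; rewrite s0.
Qed.

Lemma sum_sqr_ge0 (R : realType) (J : pred nat) (a : nat -> R[i]) N :
  0 <= \sum_(0 <= j < N | J j) normc (a j) ^+ 2.
Proof. by apply: sumr_ge0 => j _; exact: sqr_ge0. Qed.

(** Tested on the conjugates of [l] itself, the hypothesis reads s^2 <= K s, where s is the sum to
    be bounded. *)
Lemma duality_bound (R : realType) (J : pred nat) (l : nat -> R[i]) (K : R) N : 0 <= K ->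
  (forall a : nat -> R[i], normc (\sum_(0 <= j < N | J j) a j * l j) ^+ 2 <=
     K * \sum_(0 <= j < N | J j) normc (a j) ^+ 2) ->
  \sum_(0 <= j < N | J j) normc (l j) ^+ 2 <= K.
Proof.
move=> K0 /(_ (fun j => (l j)^*%C)).
have -> : \sum_(0 <= j < N | J j) (l j)^*%C * l j =
    (\sum_(0 <= j < N | J j) normc (l j) ^+ 2)%:C.
  by rewrite rmorph_sum; apply: eq_bigr => j _; rewrite mulrC mulcJ.
under [in X in _ <= X]eq_bigr do rewrite normcJ.
set s := \sum_(0 <= j < N | J j) _.
have s0 : 0 <= s by exact: sum_sqr_ge0.
rewrite normc_real ger0_norm//; have [->|s1] := eqVneq s 0; first by [].
by rewrite expr2 ler_pM2r// lt_neqAle eq_sym s1.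
Qed.

(** * Cauchy-Schwarz for finite sums *)

Section CauchySchwarz.
Variable R : realType.

(** The cross term 2 x a b is at most 2 sqrt(A B) a b, hence at most A b^2 + B a^2 by the
    arithmetic-geometric inequality. *)
Lemma cauchy_schwarz_step (x A B a b : R) : 0 <= x -> 0 <= A -> 0 <= B -> 0 <= a ->
  0 <= b -> x ^+ 2 <= A * B -> (x + a * b) ^+ 2 <= (A + a ^+ 2) * (B + b ^+ 2).
Proof.
move=> x0 A0 B0 a0 b0 H.
have a20 := sqr_ge0 a; have b20 := sqr_ge0 b.
suff K : 2 * x * (a * b) <= A * b ^+ 2 + B * a ^+ 2.
  have -> : (x + a * b) ^+ 2 = x ^+ 2 + 2 * x * (a * b) + a ^+ 2 * b ^+ 2 by ring.
  have -> : (A + a ^+ 2) * (B + b ^+ 2) =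
    A * B + (A * b ^+ 2 + B * a ^+ 2) + a ^+ 2 * b ^+ 2 by ring.
  by rewrite lerD2r lerD.
rewrite -(@ler_pXn2r _ 2) ?nnegrE//; last 2 first.
- by rewrite !mulr_ge0.
- by rewrite addr_ge0// mulr_ge0.
apply: (@le_trans _ _ (4 * (A * B) * (a * b) ^+ 2)).
  have -> : (2 * x * (a * b)) ^+ 2 = 4 * x ^+ 2 * (a * b) ^+ 2 by ring.
  by rewrite ler_wpM2r ?sqr_ge0// ler_wpM2l.
rewrite -subr_ge0.
have -> : (A * b ^+ 2 + B * a ^+ 2) ^+ 2 - 4 * (A * B) * (a * b) ^+ 2 =
  (A * b ^+ 2 - B * a ^+ 2) ^+ 2 by ring.
exact: sqr_ge0.
Qed.

Lemma cauchy_schwarz (a b : nat -> R[i]) (J : pred nat) N :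
  normc (\sum_(0 <= j < N | J j) a j * b j) ^+ 2 <=
  (\sum_(0 <= j < N | J j) normc (a j) ^+ 2) *
  \sum_(0 <= j < N | J j) normc (b j) ^+ 2.
Proof.
elim: N => [|N IH]; first by rewrite !big_geq// Normc.normc0 expr0n mulr0.
rewrite !big_nat_cond_recr; case: ifP => _; last by rewrite !addr0.
set s := \sum_(0 <= j < N | J j) a j * b j.
apply: (@le_trans _ _ ((normc s + normc (a N) * normc (b N)) ^+ 2)).
  rewrite ler_pXn2r ?nnegrE ?normc_ge0 ?addr_ge0 ?mulr_ge0 ?normc_ge0//.
  by rewrite -Normc.normcM; exact: normc_triangle.
by apply: cauchy_schwarz_step; rewrite ?normc_ge0 ?sum_sqr_ge0.
Qed.

Lemma ccvg_normc_sq (u : nat -> R[i]) l (v : nat -> R) (m : R) :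
  ccvg u l -> ccvg (fun N => (v N)%:C) m%:C ->
  (forall N, normc (u N) ^+ 2 <= v N) -> normc l ^+ 2 <= m.
Proof.
move=> Hu Hv H; apply/ler_addgt0Pl => e e0.
have [N0 H0] := Hv e e0.
have bnd N : normc (u (N + N0)%N) ^+ 2 <= e + m.
  apply: le_trans (H _) _; have := H0 _ (leq_addl N N0).
  by rewrite -rmorphB normc_real ler_norml lerBlDr => /andP[].
have em : 0 <= e + m := le_trans (sqr_ge0 _) (bnd 0%N).
rewrite -(sqr_sqrtr em) ler_pXn2r ?nnegrE ?normc_ge0 ?sqrtr_ge0//.
apply: (@ccvg_le _ (fun N => u (N + N0)%N)).
  move=> d /Hu[N1 H1]; exists N1 => N N1N; apply: H1.
  by apply: leq_trans N1N _; exact: leq_addr.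
move=> N; rewrite -(@ler_pXn2r _ 2) ?nnegrE ?normc_ge0 ?sqrtr_ge0//.
by rewrite sqr_sqrtr.
Qed.

End CauchySchwarz.

(** * Constants on a bounded domain *)

Section BoundedDomain.
Variables (R : realType).
Local Notation C := (Cplx R).

Lemma lebesgueC_cbox n (c : ctuple R n) r : (lebesgueC R n (cbox c r) < +oo)%E.
Proof.
elim: n c => [|n IH] c.
  rewrite /lebesgueC /= diracE; case: (_ \in _); exact: ltry.
have [c0 [c' cE]] := tuple_consE c.
have E : @tuple_cons _ (measurableTypeR R * measurableTypeR R)%type n @^-1` cbox c r =
    csquare c0.1 c0.2 r `*` cbox c' r.
  by rewrite cE; apply/seteqP; split=> -[q t] /cbox_cons.
rewrite [X in (X < _)%E](_ : _ = (prod_measure (@lebesgue_measure R)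
   (@lebesgue_measure R) (csquare c0.1 c0.2 r) * lebesgueC R n (cbox c' r))%E); last first.
  rewrite -product_measure1E; [|exact: measurable_csquare|exact: measurable_cbox].
  by rewrite -E.
apply: lte_mul_pinfty; [exact: measure_ge0| |exact: IH].
rewrite ge0_fin_numE ?measure_ge0//.
rewrite [X in (X < _)%E](_ : _ = (lebesgue_measure `[(c0.1 - r)%R, (c0.1 + r)%R] *
   lebesgue_measure `[(c0.2 - r)%R, (c0.2 + r)%R])%E); last first.
  by rewrite -product_measure1E; [|exact: measurable_itv|exact: measurable_itv].
by rewrite !lebesgue_measure_itv; do 2!case: ifP => _; rewrite -?EFinB -?EFinM ?mule0 ?mul0e ltry.
Qed.

Lemma bounded_vn n (Omega : set 'rV[C]_n) : bounded_set Omega ->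
  exists2 M : R, 0 < M & forall x, Omega x -> vn x <= M.
Proof.
move=> /ex_strict_bound_gt0[M /posC_real[m m0 ->] HM]; exists m => // x /HM /=.
by rewrite vnE ltcR => /ltW.
Qed.

(** A bounded set lies in a box of finite volume. The function 1 is what makes B(z, z) positive,
    with a uniform bound on its inverse. *)
Lemma bergman_one n (Omega : set 'rV[C]_n) : open Omega -> bounded_set Omega ->
  bergman_space Omega (fun=> 1 : C).
Proof.
move=> oO /bounded_vn[M M0 HM]; split; first by move=> z _; exact: differentiable_cst.
have mD := measurable_cdom oO.
have sub : cdom Omega `<=` cbox (coords (0 : 'rV[C]_n)) M.
  move=> t Ot j; have := le_trans (vn_entry (of_coords t) j) (HM _ Ot).
  rewrite of_coords_entry tnth_mktuple mxE /= => h.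
  rewrite /csquare /= !in_itv /= !sub0r !add0r -!ler_norml.
  by split; apply: le_trans h; [apply: (Re_le_normc (_ +i* _))|apply: (Im_le_normc (_ +i* _))].
apply: le_lt_trans (lebesgueC_cbox (coords (0 : 'rV[C]_n)) M).
rewrite /L2norm_sq (eq_integral (cst 1%E)); last first.
  by move=> t _; rewrite Normc.normc1 expr1n.
rewrite integral_cst// mul1e.
by apply: le_measure => //; rewrite inE//; exact: measurable_cbox.
Qed.

End BoundedDomain.

Lemma eq_lim_ccvg (R : realType) (u : nat -> R[i]) (l l' : R[i]) :
  l = l' -> ccvg u l -> ccvg u l'.
Proof. by move=> ->. Qed.

Lemma ccvg_real_ge0 (R : realType) (v : nat -> R) (l : R[i]) :
  ccvg (fun N => (v N)%:C) l -> (forall N, 0 <= v N) -> l = (Re l)%:C /\ 0 <= Re l.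
Proof.
move=> H v0.
have hI (e : R) : 0 < e -> `|Im l| <= e /\ - Re l <= e.
  move=> /H[N HN]; have h := HN N (leqnn _).
  have h1 := le_trans (Im_le_normc _) h; have h2 := le_trans (Re_le_normc _) h.
  move: h1 h2; rewrite ImD ReD ImN ReN /= add0r normrN => -> h2; split=> //.
  by have := v0 N; move: h2; rewrite ler_norml; lra.
have I0 : Im l = 0.
  apply/eqP; rewrite -normr_eq0 eq_le normr_ge0 andbT leNgt; apply/negP => h0.
  by have [] := hI (`|Im l| / 2) (ltac:(by rewrite divr_gt0)); lra.
split; first by apply: complex_eqP.
rewrite leNgt; apply/negP => h0.
by have [_] := hI (- Re l / 2) (ltac:(by rewrite divr_gt0// oppr_gt0)); lra.
Qed.

(** The quadratic g - 2 Re(l conj(d)) + |l|^2 s for real g, evaluated at its minimiser l = d / s;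
    the identity itself is purely algebraic. *)
Lemma schur_complement (R : realType) (g d : R[i]) (s : R) : s != 0 ->
  g - d / s%:C * d^*%C - (d / s%:C)^*%C * d + d / s%:C * (d / s%:C)^*%C * s%:C =
  (g * s%:C - d^*%C * d) / s%:C ^+ 2 * s%:C.
Proof.
move=> s0; have -> : (d / s%:C)^*%C = d^*%C / s%:C.
  by rewrite rmorphM fmorphV; congr (_ / _); apply: complex_eqP; rewrite /= ?oppr0.
have sc : s%:C != 0 by rewrite fmorph_eq0.
by move: (d^*%C) sc; move: (s%:C) => t e t0; field.
Qed.

(** The lower half of the bound makes the derivative of h(t) exp(K t) nonnegative, so by the mean
    value theorem its value at 1 is at least h(0). *)
Lemma gronwall_gt0 (R : realType) (h dh : R -> R) (K : R) :
  (forall t : R, 0 <= t <= 1 -> is_derive t (1 : R) h (dh t)) ->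
  (forall t : R, 0 <= t <= 1 -> `|dh t| <= K * h t) -> 0 < h 0 -> 0 < h 1.
Proof.
move=> Hd Hb h0.
pose f t := h t * expR (K * t); pose df t := h t * (expR (K * t) * K) + expR (K * t) * dh t.
have fd (t : R) : 0 <= t <= 1 -> is_derive t (1 : R) f (df t).
  move=> /Hd ht.
  have hl : is_derive t (1 : R) (fun s => K * s) K.
    by have := is_deriveZ K (is_derive_id t (1 : R)); congr is_derive; exact: mulr1.
  exact: (is_deriveM ht (is_derive1_comp (is_derive_expR _) hl)).
have [||c c01] := @MVT R f df 0 1 ltr01.
- by move=> t; rewrite in_itv /= => /andP[t0 t1]; apply: fd; rewrite !ltW.
- apply: continuous_in_subspaceT => t; rewrite inE /= in_itv /= => /fd[dt _].
  exact: differentiable_continuous ((derivable1_diffP f t).1 dt).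
rewrite subr0 mulr1 /f mulr0 expR0 mulr1 mulr1 => E.
have df0 : 0 <= df c.
  move: c01; rewrite in_itv /= => /andP[c0 c1].
  have cc : 0 <= c <= 1 by rewrite !ltW.
  have := Hb c cc; rewrite ler_norml => /andP[h1 _].
  have -> : df c = expR (K * c) * (K * h c + dh c) by rewrite /df; ring.
  by rewrite mulr_ge0 ?expR_ge0// -lerBlDl sub0r.
by rewrite -(pmulr_lgt0 _ (expR_gt0 K)) -(subrK (h 0) (h 1 * _)) E ltr_wpDl.
Qed.

Lemma is_derive_shift0 (R : realType) (h : R -> R) (t m : R) :
  is_derive (0 : R) (1 : R) (fun s => h (t + s)) m -> is_derive t (1 : R) h m.
Proof.
move=> H; have hl : is_derive t (1 : R) (fun s => s - t) 1.
  by have := is_deriveB (is_derive_id t (1 : R)) (is_derive_cst t t (1 : R));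
    congr is_derive; exact: subr0.
have H' : is_derive ((fun s : R => s - t) t) (1 : R) (fun s => h (t + s)) m.
  by rewrite subrr.
have := @is_derive1_comp R (fun s => h (t + s)) (fun s => s - t) t m 1 H' hl; rewrite mulr1; congr is_derive.
by apply/funext => s /=; rewrite addrC subrK.
Qed.

(** * The Bergman kernel and metric *)

Section BergmanKernel.
Variables (R : realType) (n : nat).
Local Notation C := (Cplx R).
Variables (Omega : set 'rV[C]_n) (J : pred nat) (phi : nat -> 'rV[C]_n -> C).
Hypothesis oO : open Omega.
Hypothesis hB : orthonormal_basis Omega J phi.
Implicit Types (x y z u v w zeta X Y : 'rV[C]_n).

Lemma phi_bergman j : J j -> bergman_space Omega (phi j).
Proof. by case: hB => H _ _; exact: H. Qed.

Definition comb a N x : C := \sum_(0 <= j < N | J j) a j * phi j x.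

Lemma combS a N : comb a N.+1 =
  if J N then fun x => comb a N x + a N * phi N x else comb a N.
Proof.
apply/funext => x; rewrite /comb big_nat_cond_recr.
by case: ifP => // _; rewrite addr0.
Qed.

Lemma comb0 a : comb a 0 = fun=> 0.
Proof. by apply/funext => x; rewrite /comb big_geq. Qed.

Lemma bergman0 : bergman_space Omega (fun=> 0 : C).
Proof.
split; first by move=> z _; exact: differentiable_cst.
rewrite /L2norm_sq (eq_integral (cst 0%E)) ?integral0// => t _.
by rewrite Normc.normc0 expr0n.
Qed.

Lemma comb_bergman a N : bergman_space Omega (comb a N).
Proof.
elim: N => [|N IH]; first by rewrite comb0; exact: bergman0.
rewrite combS; case: ifP => JN; last exact: IH.
by apply: bergman_comb; [exact: oO|exact: IH|exact: phi_bergman].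
Qed.

Lemma comb_diff a N x v : Omega x ->
  'd (comb a N) x v = \sum_(0 <= j < N | J j) a j * 'd (phi j) x v.
Proof.
move=> Ox; elim: N => [|N IH].
  by rewrite comb0 big_geq// (diff_cst (0 : C)).
rewrite big_nat_cond_recr -IH.
have dc : differentiable (comb a N) x by have [h _] := comb_bergman a N; exact: h.
have := combS a N; case: ifP => JN E; last by rewrite addr0 E.
have dp : differentiable (phi N) x by have [h _] := phi_bergman JN; exact: h.
apply: (etrans (congr1 (fun F : 'rV[C]_n -> C => 'd F x v) E)).
exact: diff_comb.
Qed.

Lemma phi_sqi j : J j ->
  sqi (lebesgueC R n) (cdom Omega) (fun t => phi j (of_coords t)).
Proof. by move=> Jj; exact: (bergman_sqi oO (phi_bergman Jj)). Qed.

Lemma phi_norm j : J j ->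
  rnsq (lebesgueC R n) (cdom Omega) (fun t => phi j (of_coords t)) = 1.
Proof.
case: hB => _ h2 _ Jj; have := h2 j j Jj Jj; rewrite eqxx => /(congr1 (@complex.Re R)).
rewrite /L2inner /= => H; rewrite rnsqR -[RHS]H.
by apply: eq_Rintegral => t _; rewrite mulcJ.
Qed.

Lemma comb_L2n a N :
  L2n Omega (comb a N) = \sum_(0 <= j < N | J j) normc (a j) ^+ 2.
Proof.
have [_ h2 _] := hB.
exact: (rnsq_psum (measurable_cdom oO) phi_sqi h2 phi_norm a N).
Qed.

(** Evaluation and differentiation at a point are bounded functionals on A^2, and the norm of a
    finite combination is the Euclidean norm of its coefficients. Duality turns this into bounds on
    the sums of |phi_j|^2 and |dphi_j|^2 that are uniform in [N] and locally uniform in [x]. *)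
Lemma comb_eval_bound z : Omega z -> exists r K : R,
  [/\ 0 < r, 0 <= K, (forall x, vn (x - z) < r -> Omega x) &
   forall x, vn (x - z) < r ->
    [/\ forall f, bergman_space Omega f -> normc (f x) ^+ 2 <= K * L2n Omega f,
        forall N, \sum_(0 <= j < N | J j) normc (phi j x) ^+ 2 <= K &
        forall N v, \sum_(0 <= j < N | J j) normc ('d (phi j) x v) ^+ 2 <=
          K * vn v ^+ 2]].
Proof.
move=> Oz; have [r [K [r0 K0 HO HK]]] := bergman_eval_bound oO Oz.
have r20 : 0 < r / 2 by rewrite divr_gt0.
(* Values on the ball of radius r / 2 around [x] are at most sqrt(K) times the norm; [holo_taylor]
   converts this into a derivative bound, and [K'] is its square. *)
pose K' := (holo_cst R / (r / 2)) ^+ 2 * K.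
have K'0 : 0 <= K' by rewrite mulr_ge0// sqr_ge0.
have rr x : vn (x - z) < r / 2 -> vn (x - z) < r.
  by move=> h; apply: lt_trans h _; rewrite ltr_pdivrMr// ltr_pMr// ltr1n.
exists (r / 2), (K + K'); split=> //; first exact: addr_ge0.
  by move=> x /rr/HO.
move=> x xz; have xz' := rr _ xz; have Ox := HO _ xz'.
have S N : \sum_(0 <= j < N | J j) normc (phi j x) ^+ 2 <= K.
  apply: duality_bound => // a; rewrite -comb_L2n.
  exact: (HK _ (comb_bergman a N) _ xz').
split.
- move=> f Bf; apply: le_trans (HK f Bf x xz') _.
  by rewrite ler_wpM2r ?L2n_ge0// lerDl.
- by move=> N; apply: le_trans (S N) _; rewrite lerDl.
- move=> N v; apply: (@le_trans _ _ (K' * vn v ^+ 2)); last first.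
    by rewrite ler_wpM2r ?sqr_ge0// lerDr.
  apply: duality_bound => [|a]; first by rewrite mulr_ge0// sqr_ge0.
  rewrite -comb_diff// -comb_L2n; set s := L2n _ _.
  have s0 : 0 <= s by exact: L2n_ge0.
  have := @holo_taylor R _ (comb a N) x (r / 2) (Num.sqrt (K * s)) r20 _ _ v.
  have inb y : vn (y - x) < r / 2 -> vn (y - z) < r.
    move=> yx; have -> : y - z = (y - x) + (x - z) by rewrite addrA subrK.
    by apply: le_lt_trans (vnD _ _) _; rewrite [r]splitr ltrD.
  case.
  + by move=> y /inb/HO Oy; have [h _] := comb_bergman a N; exact: h.
  + move=> y /inb yz; rewrite -(@ler_pXn2r _ 2) ?nnegrE ?normc_ge0 ?sqrtr_ge0//.
    rewrite sqr_sqrtr ?mulr_ge0//.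
    exact: (HK _ (comb_bergman a N) _ yz).
  + set c := holo_cst R * _ / _ * _ => h _.
    have c0 : 0 <= c.
      by rewrite !mulr_ge0 ?holo_cst_ge0 ?sqrtr_ge0 ?vn_ge0// invr_ge0 ltW.
    have {}h : normc ('d (comb a N) x v) ^+ 2 <= c ^+ 2.
      by rewrite ler_pXn2r ?nnegrE// normc_ge0.
    apply: le_trans h _; apply: le_of_eq; rewrite /c.
    have -> : K' * vn v ^+ 2 * s =
      (holo_cst R / (r / 2)) ^+ 2 * vn v ^+ 2 * (K * s) by rewrite /K'; ring.
    by rewrite -[in RHS](sqr_sqrtr (mulr_ge0 K0 s0)); ring.
Qed.

(** Square summable coefficients bound the partial sums in A^2, hence locally uniformly, and
    [holo_limit] yields termwise differentiation. *)
Lemma series_hol a (G : 'rV[C]_n -> C) (A : R) :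
  (forall N, \sum_(0 <= j < N | J j) normc (a j) ^+ 2 <= A) ->
  (forall x, Omega x -> ccvg (fun N => comb a N x) (G x)) ->
  holomorphic_on Omega G /\ forall x v, Omega x ->
    ccvg (fun N => \sum_(0 <= j < N | J j) a j * 'd (phi j) x v) ('d G x v).
Proof.
move=> HA HG.
have A0 : 0 <= A by apply: le_trans (HA 0%N); exact: sum_sqr_ge0.
have main x : Omega x -> differentiable G x /\
    forall v, ccvg (fun N => 'd (comb a N) x v) ('d G x v).
  move=> Ox; have [r [K [r0 K0 HO HK]]] := comb_eval_bound Ox.
  apply: (@holo_limit R _ (comb a) G x r (Num.sqrt (K * A))) => //.
  - by move=> N y /HO Oy; have [h _] := comb_bergman a N; exact: h.
  - move=> N y yx; rewrite -(@ler_pXn2r _ 2) ?nnegrE ?normc_ge0 ?sqrtr_ge0//.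
    rewrite sqr_sqrtr ?mulr_ge0//; have [h _ _] := HK y yx.
    apply: le_trans (h _ (comb_bergman a N)) _.
    by rewrite ler_wpM2l// comb_L2n.
  - by move=> y /HO; exact: HG.
split; first by move=> x /main[].
move=> x v Ox; have [_ Hv] := main x Ox.
by apply: eq_ccvg (Hv v) => N; exact: comb_diff.
Qed.

Variable B : 'rV[C]_n -> 'rV[C]_n -> C.
Hypothesis hK : forall z xi, Omega z -> Omega xi ->
  (fun N => \sum_(0 <= j < N | J j) phi j z * (phi j xi)^*%C) @ \oo --> B z xi.

Lemma kernel_cvg x y : Omega x -> Omega y ->
  ccvg (fun N => comb (fun j => (phi j y)^*%C) N x) (B x y).
Proof.
move=> Ox Oy; have /ccvgP := hK Ox Oy; apply: eq_ccvg => N.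
by apply: eq_bigr => j _; rewrite mulrC.
Qed.

Lemma kernel_herm x y : Omega x -> Omega y -> B y x = (B x y)^*%C.
Proof.
move=> Ox Oy; apply: (ccvg_unique (kernel_cvg Oy Ox)).
apply: eq_ccvg (ccvgJ (kernel_cvg Ox Oy)) => N.
by rewrite rmorph_sum; apply: eq_bigr => j _; rewrite rmorphM/= conjcK mulrC.
Qed.

Lemma kernel_hol y : Omega y -> holomorphic_on Omega (B ^~ y) /\
  forall x v, Omega x -> ccvg (fun N => \sum_(0 <= j < N | J j)
    (phi j y)^*%C * 'd (phi j) x v) ('d (B ^~ y) x v).
Proof.
move=> Oy; have [r [K [r0 K0 HO HK]]] := comb_eval_bound Oy.
have [|_ S _] := HK y; first by rewrite subrr vn0.
apply: (@series_hol _ (B ^~ y) K).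
  by move=> N; under eq_bigr do rewrite normcJ; exact: S.
by move=> x Ox; exact: kernel_cvg.
Qed.

(* The derivative of B(x, y) in the conjugate of y along v, as a function of x. *)
Definition dkernel v y x : C := ('d (B ^~ x) y v)^*%C.

Lemma dkernel_cvg v y x : Omega x -> Omega y ->
  ccvg (fun N => comb (fun j => ('d (phi j) y v)^*%C) N x) (dkernel v y x).
Proof.
move=> Ox Oy; have [_ H] := kernel_hol Ox.
apply: eq_ccvg (ccvgJ (H y v Oy)) => N; rewrite rmorph_sum; apply: eq_bigr => j _.
by rewrite rmorphM/= conjcK mulrC.
Qed.

(** The coefficients are now the conjugated derivatives of the basis at [y], square summable by the
    derivative part of [comb_eval_bound]. *)
Lemma dkernel_hol v y : Omega y -> holomorphic_on Omega (dkernel v y) /\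
  forall x u, Omega x -> ccvg (fun N => \sum_(0 <= j < N | J j)
    ('d (phi j) y v)^*%C * 'd (phi j) x u) ('d (dkernel v y) x u).
Proof.
move=> Oy; have [r [K [r0 K0 HO HK]]] := comb_eval_bound Oy.
have [|_ _ S] := HK y; first by rewrite subrr vn0.
apply: (@series_hol _ (dkernel v y) (K * vn v ^+ 2)).
  by move=> N; under eq_bigr do rewrite normcJ; exact: S.
by move=> x Ox; exact: dkernel_cvg.
Qed.

(** Turns the dependence of a mixed derivative on its antiholomorphic variable into that of a
    holomorphic function, whose continuity is known. *)
Lemma dkernel_herm u v x y : Omega x -> Omega y ->
  'd (dkernel u y) x v = ('d (dkernel v x) y u)^*%C.
Proof.
move=> Ox Oy; have [_ H1] := dkernel_hol u Oy; have [_ H2] := dkernel_hol v Ox.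
apply: (ccvg_unique (H1 x v Ox)).
apply: eq_ccvg (ccvgJ (H2 y u Oy)) => N; rewrite rmorph_sum; apply: eq_bigr => j _.
by rewrite rmorphM/= conjcK mulrC.
Qed.

Local Notation dk := dkernel.
Local Notation S x := (Re (B x x)).

Lemma kernel_diag x : Omega x -> B x x = (S x)%:C.
Proof.
move=> Ox; have := kernel_herm Ox Ox => H.
apply: complex_eqP => //=; have := congr1 (@complex.Im R) H.
by rewrite ImJ; lra.
Qed.

(** The series are bounded through |a b| <= |a|^2 + |b|^2, which explains the quadratic growth in
    [v]; only local boundedness matters. *)
Lemma kernel_local_bound z : Omega z -> exists r M : R,
  [/\ 0 < r, (forall x, vn (x - z) < r -> Omega x) &
   forall x y, vn (x - z) < r -> vn (y - z) < r ->
     normc (B x y) <= M /\ forall v, normc (dk v y x) <= M * (1 + vn v ^+ 2)].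
Proof.
move=> Oz; have [r [K [r0 K0 HO HK]]] := comb_eval_bound Oz.
exists r, (K + K); split=> // x y xz yz.
have Ox := HO _ xz; have Oy := HO _ yz.
have [_ Sx _] := HK _ xz; have [_ Sy Dy] := HK _ yz.
split.
  apply: (ccvg_le (kernel_cvg Ox Oy)) => N.
  apply: le_trans (normc_sum_mul_le _ _ _ _) _.
  by apply: lerD; [under eq_bigr do rewrite normcJ; exact: Sy|exact: Sx].
move=> v; apply: (ccvg_le (dkernel_cvg v Ox Oy)) => N.
apply: le_trans (normc_sum_mul_le _ _ _ _) _.
apply: (@le_trans _ _ (K * vn v ^+ 2 + K)).
  by apply: lerD; [under eq_bigr do rewrite normcJ; exact: Dy|exact: Sx].
by rewrite mulrDr mulr1 addrC mulrDl lerD// ?lerDl// mulr_ge0// sqr_ge0.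
Qed.

Lemma diag_rdiff z v : Omega z ->
  rdiff (fun t => B (z + (t%:C : C) *: v) (z + (t%:C : C) *: v))
    ('d (B ^~ z) z v + ('d (B ^~ z) z v)^*%C).
Proof.
move=> Oz; have [r [M [r0 HO HM]]] := kernel_local_bound Oz.
apply: (@rdiff_diagonal R _ B z v r M (B ^~ z) r0).
- by move=> x y xz yz; apply: (kernel_hol (HO _ yz)).1; exact: HO.
- by move=> x y xz yz; have [] := HM x y xz yz.
- by move=> y yz; apply: (kernel_herm (HO _ yz) Oz).
- by apply: (kernel_hol Oz).1.
- move=> e e0.
  have dd : differentiable (dk v z) z by apply: (dkernel_hol v Oz).1.
  have [d d0 Hd] := diff_continuous_vn dd e0; exists d => // y /Hd.
  apply: le_lt_trans; apply: le_of_eq; rewrite -normcJ; congr (normc _).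
  exact: rmorphB.
Qed.

Lemma diag_is_derive z v : Omega z ->
  is_derive (0 : R) (1 : R) (fun t => S (z + (t%:C : C) *: v))
    (2 * Re ('d (B ^~ z) z v)).
Proof.
move=> Oz; have [h _] := diag_rdiff v Oz; move: h; congr is_derive.
by rewrite addcJ.
Qed.

Lemma dkernel_rdiff z v w : Omega z ->
  rdiff (fun t => dk v (z + (t%:C : C) *: w) (z + (t%:C : C) *: w))
    ('d (dk v z) z w + ('d (fun y => 'd (B ^~ z) y v : C) z w)^*%C).
Proof.
move=> Oz; have [r [M [r0 HO HM]]] := kernel_local_bound Oz.
apply: (@rdiff_diagonal R _ (fun x y => dk v y x) z w r (M * (1 + vn v ^+ 2))
  (fun y => 'd (B ^~ z) y v) r0).
- by move=> x y xz yz; apply: (dkernel_hol v (HO _ yz)).1; exact: HO.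
- by move=> x y xz yz; have [_] := HM x y xz yz.
- by [].
- by apply: (dir_deriv_hol _ oO (kernel_hol Oz).1).
- move=> e e0.
  have hh := dir_deriv_hol v oO (dkernel_hol w Oz).1.
  have [d d0 Hd] := diff_continuous_vn (hh z Oz) e0.
  exists (Num.min r d); first by rewrite lt_min r0.
  move=> y; rewrite lt_min => /andP[yr /Hd]; apply: le_lt_trans; apply: le_of_eq.
  exact: normcBJ (dkernel_herm v w Oz (HO _ yr))
    (dkernel_herm v w Oz Oz).
Qed.

(** * Logarithmic derivatives of the kernel on the diagonal *)

Hypothesis hS : forall x, Omega x -> 0 < S x.
Local Notation lnS := (fun x => (ln (S x))%:C : C).

Lemma line0 z v : z + ((0 : R)%:C : C) *: v = z.
Proof. by rewrite scale0r addr0. Qed.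

Lemma rdiff_realC (s : R -> R) (m : R) : is_derive (0 : R) (1 : R) s m ->
  rdiff (fun t => (s t)%:C) m%:C.
Proof. by move=> h; split=> //=; exact: is_derive_cst. Qed.

Lemma lnS_rdiff z v : Omega z -> rdiff (fun t => lnS (z + (t%:C : C) *: v))
  ('d (B ^~ z) z v / (S z)%:C + ('d (B ^~ z) z v)^*%C / (S z)%:C).
Proof.
move=> Oz; have p0 : 0 < S (z + ((0 : R)%:C : C) *: v) by rewrite line0; exact: hS.
have := rdiff_realC (is_derive_lnc p0 (diag_is_derive v Oz)).
rewrite line0; congr rdiff.
by rewrite -mulrDl addcJ -fmorphV -rmorphM.
Qed.

Lemma conj_imul_div (a b : R[i]) s : a = 'i * b -> a^*%C / s = - 'i * (b^*%C / s).
Proof.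
move=> ->; have -> : ('i * b)^*%C = - 'i * b^*%C; last by rewrite mulrA.
by apply: complex_eqP; case: b => x y /=; ring. Qed.

Lemma imul_quotient (p p' d d' : R[i]) s e : p = 'i * p' -> d = 'i * d' ->
  (p * s - e * d) / s ^+ 2 = 'i * ((p' * s - e * d') / s ^+ 2).
Proof. by move=> -> ->; rewrite [RHS]mulrA; congr (_ / _); ring. Qed.

Lemma conj_imul_quotient (p p' d d' : R[i]) s e : p = 'i * p' -> d = 'i * d' ->
  (p^*%C * s - e * d^*%C) / s ^+ 2 = - 'i * ((p'^*%C * s - e * d'^*%C) / s ^+ 2).
Proof.
have cJ (b : R[i]) : ('i * b)^*%C = - 'i * b^*%C.
  by apply: complex_eqP; case: b => x y /=; ring.
by move=> -> ->; rewrite !cJ [RHS]mulrA; congr (_ / _); ring.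
Qed.

Lemma imul_div (a b : R[i]) s : a = 'i * b -> a / s = 'i * (b / s).
Proof. by move=> ->; rewrite mulrA. Qed.

Lemma d_zbar_lnS z k : Omega z ->
  d_zbar k lnS z = dk (delta_mx 0 k) z z / (S z)%:C.
Proof.
move=> Oz; have [_ //] := @wirtinger R n lnS z
  (fun w => 'd (B ^~ z) z w / (S z)%:C) (fun w => ('d (B ^~ z) z w)^*%C / (S z)%:C)
  (fun w => lnS_rdiff w Oz)
  (fun w => imul_div _ (diff_scale _ _ _ _))
  (fun w => conj_imul_div _ (diff_scale _ _ _ _)) k.
Qed.

Lemma quotient_split (p q d e s : R[i]) :
  (p * s - e * d) / s ^+ 2 + (q * s - e * d^*%C) / s ^+ 2 =
  ((p + q) * s - e * (d + d^*%C)) / s ^+ 2.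
Proof. by rewrite -mulrDl; congr (_ / _); ring. Qed.

Lemma d_z_d_zbar_lnS z j k : Omega z ->
  d_z j (d_zbar k lnS) z =
  ('d (dk (delta_mx 0 k) z) z (delta_mx 0 j) * (S z)%:C -
     dk (delta_mx 0 k) z z * 'd (B ^~ z) z (delta_mx 0 j)) / (S z)%:C ^+ 2.
Proof.
move=> Oz; set ek := delta_mx 0 k : 'rV[C]_n.
have H w : rdiff (fun t => d_zbar k lnS (z + (t%:C : C) *: w))
  (('d (dk ek z) z w * (S z)%:C - dk ek z z * 'd (B ^~ z) z w) / (S z)%:C ^+ 2 +
   (('d (fun y => 'd (B ^~ z) y ek : C) z w)^*%C * (S z)%:C -
      dk ek z z * ('d (B ^~ z) z w)^*%C) / (S z)%:C ^+ 2).
  have [r r0 Hr] := open_vn oO Oz.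
  have v1 : 0 < vn w + 1 by rewrite ltr_wpDl ?vn_ge0.
  (* The closed form of the first derivative holds only inside [Omega], so it replaces the
     derivative for [t] small enough to keep the line in a ball around [z]. *)
  apply: (@rdiff_local _ (fun t => dk ek (z + (t%:C : C) *: w) (z + (t%:C : C) *: w) /
     (S (z + (t%:C : C) *: w))%:C) _ _ (r / (vn w + 1))).
  - exact: divr_gt0.
  - move=> t; rewrite ltr_pdivlMr// => tr; apply/esym; apply: d_zbar_lnS.
    apply: Hr; rewrite addrAC subrr add0r vnZ normc_real.
    by apply: le_lt_trans tr; rewrite ler_wpM2l// lerDl.
  have p0 : S (z + ((0 : R)%:C : C) *: w) != 0 by rewrite line0 gt_eqF// hS.
  have := rdiff_quotient p0 (dkernel_rdiff ek w Oz) (diag_is_derive w Oz).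
  rewrite line0; congr rdiff.
  by rewrite rmorphXn /= -addcJ; exact: esym (quotient_split _ _ _ _ _).
have h1 w := imul_quotient (S z)%:C (dk ek z z)
  (diff_scale (dk ek z) z ('i%C : C) w) (diff_scale (B ^~ z) z ('i%C : C) w).
have h2 w := conj_imul_quotient (S z)%:C (dk ek z z)
  (diff_scale (fun y => 'd (B ^~ z) y ek : C) z ('i%C : C) w)
  (diff_scale (B ^~ z) z ('i%C : C) w).
exact: (wirtinger H h1 h2 j).1.
Qed.

Lemma dkernel_row_sum z v : dk v z z = \sum_k (v 0 k)^*%C * dk (delta_mx 0 k) z z.
Proof.
apply: etrans (congr1 (fun a : R[i] => a^*%C) (diff_row_sum (B ^~ z) z v)) _.
rewrite rmorph_sum; apply: eq_bigr => k _; exact: rmorphM.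
Qed.

Lemma diff_dkernel_row_sum z v u : Omega z ->
  'd (dk v z) z u = \sum_k (v 0 k)^*%C * 'd (dk (delta_mx 0 k) z) z u.
Proof.
move=> Oz; apply: etrans (dkernel_herm v u Oz Oz) _.
apply: etrans (congr1 (fun a : R[i] => a^*%C) (diff_row_sum (dk u z) z v)) _.
rewrite rmorph_sum; apply: eq_bigr => k _; rewrite rmorphM /=; congr (_ * _).
exact: esym (dkernel_herm (delta_mx 0 k) u Oz Oz).
Qed.

(** Coordinate-free form of the Hessian of log B(z, z): the mixed derivative of B times B, minus the
    product of the two first derivatives, over B^2. *)
Lemma bergman_metricE z X Y : Omega z -> bergman_metric B z X Y =
  ('d (dk Y z) z X * (S z)%:C - dk Y z z * 'd (B ^~ z) z X) / (S z)%:C ^+ 2.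
Proof.
move=> Oz.
pose g j k : R[i] := 'd (dk (delta_mx 0 k) z) z (delta_mx 0 j).
pose e k : R[i] := dk (delta_mx 0 k) z z.
pose d j : R[i] := 'd (B ^~ z) z (delta_mx 0 j).
pose x j : R[i] := X 0 j; pose y k : R[i] := (Y 0 k)^*%C.
have E1 : bergman_metric B z X Y = \sum_j \sum_k
    (g j k * (S z)%:C - e k * d j) / (S z)%:C ^+ 2 * x j * y k.
  apply: eq_bigr => j _; apply: eq_bigr => k _; congr (_ * _ * _).
  exact: (d_z_d_zbar_lnS).
have E2 : 'd (dk Y z) z X = \sum_j x j * \sum_k y k * g j k.
  apply: etrans (diff_row_sum _ _ _) _; apply: eq_bigr => j _; congr (_ * _).
  exact: diff_dkernel_row_sum.
have E3 : dk Y z z = \sum_k y k * e k := dkernel_row_sum z Y.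
have E4 : 'd (B ^~ z) z X = \sum_j x j * d j := diff_row_sum _ _ _.
apply: etrans E1 _; apply: etrans (hessian_sum g e d x y _ _) _.
exact: esym (congr1 (fun a : R[i] => a / (S z)%:C ^+ 2) (congr2 (fun a b : R[i] => a - b)
  (congr1 (fun a : R[i] => a * (S z)%:C) E2)
  (congr2 (fun a b : R[i] => a * b) E3 E4))).
Qed.

Lemma berezin_is_derive w zeta v : Omega w -> Omega zeta ->
  is_derive (0 : R) (1 : R) (fun t => berezin B (w + (t%:C : C) *: v) zeta)
    (normc (B w zeta) ^+ 2 * (- (S w) ^- 2 * (2 * Re ('d (B ^~ w) w v))) +
     (S w)^-1 * (2 * Re (B w zeta * ('d (B ^~ zeta) w v)^*%C))).
Proof.
move=> Ow Oz; have hb := is_derive_normc_sq (rdiff_line v ((kernel_hol Oz).1 w Ow)).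
have p0 : S (w + ((0 : R)%:C : C) *: v) != 0 by rewrite line0 gt_eqF// hS.
have := is_derive_mul hb (is_derive_inv p0 (diag_is_derive v Ow)).
by rewrite line0.
Qed.

Lemma lnP_rdiff w zeta v : Omega w -> Omega zeta -> B w zeta != 0 ->
  rdiff (fun t => (ln (berezin B (w + (t%:C : C) *: v) zeta))%:C)
    ('d (B ^~ zeta) w v / B w zeta - 'd (B ^~ w) w v / (S w)%:C +
     ('d (B ^~ zeta) w v / B w zeta - 'd (B ^~ w) w v / (S w)%:C)^*%C).
Proof.
move=> Ow Oz b0; have S0 := hS Ow; have Sn0 : S w != 0 by rewrite gt_eqF.
have q0 : 0 < berezin B (w + ((0 : R)%:C : C) *: v) zeta.
  by rewrite line0 divr_gt0// exprn_gt0// normc_gt0.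
have := rdiff_realC (is_derive_lnc q0 (berezin_is_derive v Ow Oz)).
rewrite line0; congr rdiff.
apply: etrans (logP_derivative _ _ b0 Sn0); congr (_%:C).
by congr (_ / _); ring.
Qed.

(** Formally log P = log B + log conj(B) - log S, and the (1, 0)-part ignores the middle term. No
    branch of the complex logarithm is chosen: the real derivative of log P is computed and split by
    [wirtinger]. *)
Lemma dpartial_lnP w zeta Y : Omega w -> Omega zeta -> B w zeta != 0 ->
  dpartial Y (fun x => (ln (berezin B x zeta))%:C) w =
  'd (B ^~ zeta) w Y / B w zeta - 'd (B ^~ w) w Y / (S w)%:C.
Proof.
move=> Ow Oz b0.
pose T v : R[i] := 'd (B ^~ zeta) w v / B w zeta - 'd (B ^~ w) w v / (S w)%:C.
have H1 v : T (('i%C : C) *: v) = 'i * T v.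
  apply: etrans (congr2 (fun a b : R[i] => a / B w zeta - b / (S w)%:C)
    (diff_scale (B ^~ zeta) w 'i%C v) (diff_scale (B ^~ w) w 'i%C v)) _.
  by rewrite /T [RHS]mulrBr !mulrA.
have H2 v : (T (('i%C : C) *: v))^*%C = - 'i * (T v)^*%C.
  rewrite H1 rmorphM; congr (_ * _).
  by apply: complex_eqP; rewrite /= ?oppr0.
have H j := (@wirtinger R n (fun x => (ln (berezin B x zeta))%:C) w T
  (fun v => (T v)^*%C) (fun v => lnP_rdiff v Ow Oz b0) H1 H2 j).1.
rewrite /dpartial; under eq_bigr do rewrite H.
have E1 : 'd (B ^~ zeta) w Y = \sum_j Y 0 j * 'd (B ^~ zeta) w (delta_mx 0 j) := diff_row_sum _ _ _.
have E2 : 'd (B ^~ w) w Y = \sum_j Y 0 j * 'd (B ^~ w) w (delta_mx 0 j) := diff_row_sum _ _ _.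
apply: etrans (esym (congr2 (fun a b : R[i] => a / B w zeta - b / (S w)%:C) E1 E2)).
exact: esym (sum_mul_sub_div (fun j => Y 0 j)
  (fun j => 'd (B ^~ zeta) w (delta_mx 0 j)) (fun j => 'd (B ^~ w) w (delta_mx 0 j)) _ _).
Qed.

(** * Fourier expansions and the extremal property of the metric *)

Local Notation coef f := (fun j => L2inner Omega f (phi j)).

Lemma coef_bessel f N : bergman_space Omega f ->
  \sum_(0 <= j < N | J j) normc (coef f j) ^+ 2 <= L2n Omega f.
Proof.
move=> Bf; have [_ h2 _] := hB.
exact: (bessel (measurable_cdom oO) phi_sqi h2 phi_norm N (bergman_sqi oO Bf)).
Qed.

(** Completeness gives convergence in norm only; the bound on point evaluation makes it
    pointwise. *)
Lemma expansion f z : bergman_space Omega f -> Omega z ->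
  ccvg (fun N => comb (coef f) N z) (f z).
Proof.
move=> Bf Oz; have [r [K [r0 K0 HO HK]]] := comb_eval_bound Oz.
have [|HKz _ _] := HK z; first by rewrite subrr vn0.
have [_ _ /(_ f Bf) H3] := hB.
have B' N : bergman_space Omega (fun z => f z - comb (coef f) N z).
  have := bergman_comb (-1) oO Bf (comb_bergman (coef f) N).
  by congr bergman_space; apply/funext => x; rewrite mulN1r.
have E N : L2norm_sq Omega (fun z => f z - \sum_(0 <= j < N | J j) coef f j * phi j z) =
    (L2n Omega (fun z => f z - comb (coef f) N z))%:E.
  exact: (L2norm_sqE oO (B' N)).
move=> e e0.
have K1 : 0 < K + 1 by rewrite ltr_wpDl.
have d0 : 0 < e ^+ 2 / (K + 1) by rewrite divr_gt0// exprn_gt0.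
have H4 : (fun N => L2n Omega (fun z => f z - comb (coef f) N z)) @ \oo --> (0 : R).
  move: H3; have -> : (fun N => L2norm_sq Omega (fun z => f z -
      \sum_(0 <= j < N | J j) coef f j * phi j z)) =
      (fun N => (L2n Omega (fun z => f z - comb (coef f) N z))%:E).
    by apply/funext => N; exact: E.
  exact: fine_cvg.
move/cvgrPdist_le : H4 => /(_ _ d0) [N _ HN].
exists N => k Nk; rewrite normcBC -(@ler_pXn2r _ 2) ?nnegrE ?normc_ge0 ?(ltW e0)//.
apply: le_trans (HKz _ (B' k)) _.
have := HN k Nk; rewrite /= sub0r normrN => /(le_trans (ler_norm _)).
rewrite ler_pdivlMr// mulrC; apply: le_trans.
by rewrite ler_wpM2r ?L2n_ge0// lerDl.
Qed.

Lemma expansion_diff f z v : bergman_space Omega f -> Omega z ->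
  ccvg (fun N => \sum_(0 <= j < N | J j) coef f j * 'd (phi j) z v) ('d f z v).
Proof.
move=> Bf Oz; have [_ H] := series_hol (fun N => coef_bessel N Bf)
  (fun x Ox => expansion Bf Ox).
exact: H.
Qed.

Lemma kernel_diag_cvg z : Omega z ->
  ccvg (fun N => (\sum_(0 <= j < N | J j) normc (phi j z) ^+ 2)%:C) (S z)%:C.
Proof.
move=> Oz; have := kernel_cvg Oz Oz; rewrite (kernel_diag Oz).
apply: eq_ccvg => N; rewrite rmorph_sum; apply: eq_bigr => j _.
by rewrite mulrC mulcJ.
Qed.

(** Cauchy-Schwarz on the expansion of [f z], with Bessel for the coefficients and the limit B(z, z)
    for the sum of |phi_j(z)|^2. *)
Lemma eval_le_kernel f z : bergman_space Omega f -> Omega z ->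
  normc (f z) ^+ 2 <= L2n Omega f * S z.
Proof.
move=> Bf Oz; apply: (ccvg_normc_sq (expansion Bf Oz)
  (v := fun N => L2n Omega f * \sum_(0 <= j < N | J j) normc (phi j z) ^+ 2)).
  have := ccvgZ (L2n Omega f)%:C (kernel_diag_cvg Oz); rewrite -rmorphM.
  by apply: eq_ccvg => N; rewrite -rmorphM.
move=> N; apply: le_trans (cauchy_schwarz _ _ _ _) _.
by rewrite ler_wpM2r ?sum_sqr_ge0// coef_bessel.
Qed.

(** For f = 1 the evaluation inequality reads 1 <= |1|^2 B(z, z), with |1|^2 the squared norm. *)
Lemma kernel_diag_gt0 z : bounded_set Omega -> Omega z -> 0 < S z.
Proof.
move=> bO Oz; have := eval_le_kernel (bergman_one oO bO) Oz.
rewrite Normc.normc1 expr1n => h; have l0 := L2n_ge0 Omega (fun=> 1 : C).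
by rewrite ltNge; apply/negP => s0; have := mulr_ge0_le0 l0 s0; lra.
Qed.

Lemma normc_sub_mul_sqr (d p l : R[i]) :
  (normc (d - l * p) ^+ 2)%:C = d^*%C * d - l * (d^*%C * p) -
    l^*%C * (p^*%C * d) + l * l^*%C * (p^*%C * p).
Proof. by rewrite -mulcJ rmorphB rmorphM; ring. Qed.

Lemma shifted_sum_cvg z X (l : R[i]) : Omega z ->
  ccvg (fun N => (\sum_(0 <= j < N | J j) normc ('d (phi j) z X - l * phi j z) ^+ 2)%:C)
   ('d (dk X z) z X - l * ('d (B ^~ z) z X)^*%C - l^*%C * 'd (B ^~ z) z X +
     l * l^*%C * B z z).
Proof.
move=> Oz; have [_ HG] := dkernel_hol X Oz.
have [_ HD] := kernel_hol Oz.
have h1 := HG z X Oz; have h2 := dkernel_cvg X Oz Oz.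
have h3 := HD z X Oz; have h4 := kernel_cvg Oz Oz.
apply: eq_ccvg (ccvgD (ccvgB (ccvgB h1 (ccvgZ l h2)) (ccvgZ l^*%C h3))
  (ccvgZ (l * l^*%C) h4)) => N.
rewrite !mulr_sumr -!sumrB -big_split rmorph_sum; apply: eq_bigr => j _ /=.
exact: esym (normc_sub_mul_sqr _ _ _).
Qed.

(** The subtracted multiple is the orthogonal projection of the sequence of derivatives on the
    sequence of values at [z]. The squared length of what remains is a Schur complement, equal to
    the metric times B(z, z). *)
Lemma metric_cvg z X : Omega z ->
  ccvg (fun N => (\sum_(0 <= j < N | J j)
     normc ('d (phi j) z X - 'd (B ^~ z) z X / (S z)%:C * phi j z) ^+ 2)%:C)
   (bergman_metric B z X X * (S z)%:C).
Proof.
move=> Oz; have S0 : S z != 0 by rewrite gt_eqF// hS.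
apply: eq_lim_ccvg (shifted_sum_cvg X ('d (B ^~ z) z X / (S z)%:C) Oz).
 apply: etrans (congr1 (fun b : R[i] => 'd (dk X z) z X -
   'd (B ^~ z) z X / (S z)%:C * ('d (B ^~ z) z X)^*%C -
   ('d (B ^~ z) z X / (S z)%:C)^*%C * 'd (B ^~ z) z X +
   'd (B ^~ z) z X / (S z)%:C * ('d (B ^~ z) z X / (S z)%:C)^*%C * b)
  (kernel_diag Oz)) _.
apply: etrans (schur_complement _ _ S0) _.
exact: esym (congr1 (fun b : R[i] => b * (S z)%:C) (bergman_metricE X X Oz)).
Qed.

(** By [metric_cvg] the metric times the positive number [S z] is a limit of sums of squares. *)
Lemma metric_real z X : Omega z ->
  bergman_metric B z X X = (Re (bergman_metric B z X X))%:C /\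
  0 <= Re (bergman_metric B z X X).
Proof.
move=> Oz; have S0 := hS Oz.
have [] := ccvg_real_ge0 (metric_cvg X Oz) (fun N => sum_sqr_ge0 _ _ N).
move: (bergman_metric B z X X) => g; rewrite ReM /= mulr0 subr0 pmulr_lge0// => h1 h2.
split=> //; apply: complex_eqP => //=.
have /eqP := congr1 (@complex.Im R) h1.
by rewrite ImM /= mulr0 add0r mulf_eq0 (gt_eqF S0) orbF => /eqP.
Qed.

(* As f z = 0, any multiple of the expansion of f z may be subtracted from that of 'd f z X; l is the multiple for which Cauchy-Schwarz is sharpest. *)
Lemma metric_inequality f z X : bergman_space Omega f -> Omega z -> f z = 0 ->
  normc ('d f z X) ^+ 2 <= L2n Omega f * (Re (bergman_metric B z X X) * S z).
Proof.
move=> Bf Oz fz0.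
set l := 'd (B ^~ z) z X / (S z)%:C.
have h1 := expansion_diff X Bf Oz; have h2 := expansion Bf Oz.
have h3 := ccvgB h1 (ccvgZ l h2).
have E : 'd f z X - l * f z = 'd f z X by rewrite fz0 mulr0 subr0.
apply: le_trans (le_of_eq (congr1 (fun a : R[i] => normc a ^+ 2) (esym E))) _.
apply: (ccvg_normc_sq h3 (v := fun N => L2n Omega f *
  \sum_(0 <= j < N | J j) normc ('d (phi j) z X - l * phi j z) ^+ 2)).
  have := ccvgZ (L2n Omega f)%:C (metric_cvg X Oz).
  have -> : (L2n Omega f)%:C * (bergman_metric B z X X * (S z)%:C) =
      (L2n Omega f * (Re (bergman_metric B z X X) * S z))%:C.
    by rewrite [in LHS](metric_real X Oz).1 -!rmorphM.
  by apply: eq_ccvg => N; rewrite -rmorphM.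
move=> N; have := cauchy_schwarz (fun j => L2inner Omega f (phi j))
  (fun j => 'd (phi j) z X - l * phi j z) J N.
have -> : \sum_(0 <= j < N | J j) L2inner Omega f (phi j) * ('d (phi j) z X - l * phi j z)
  = \sum_(0 <= j < N | J j) L2inner Omega f (phi j) * 'd (phi j) z X -
    l * comb (fun j => L2inner Omega f (phi j)) N z.
  rewrite mulr_sumr -sumrB; apply: eq_bigr => j _.
  by rewrite mulrBr mulrCA.
move=> h; apply: le_trans h _.
by rewrite ler_wpM2r ?sum_sqr_ge0// (coef_bessel N Bf).
Qed.

Lemma hol_mul (F K : 'rV[C]_n -> C) : holomorphic_on Omega F -> holomorphic_on Omega K ->
  holomorphic_on Omega (fun x => F x * K x).
Proof.
by move=> hF hK' x Ox; apply: (@differentiableM _ _ F K); [exact: hF|exact: hK'].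
Qed.

Lemma bergman_mul (F K : 'rV[C]_n -> C) (c : R) : holomorphic_on Omega F -> 0 <= c ->
  (forall x, Omega x -> normc (F x) ^+ 2 <= c) -> bergman_space Omega K ->
  bergman_space Omega (fun x => F x * K x) /\
  L2n Omega (fun x => F x * K x) <= c * L2n Omega K.
Proof.
move=> hF c0 Fc BK; have [hK' _] := BK.
have hFK := hol_mul hF hK'.
have mD := measurable_cdom oO.
have mn (f : 'rV[C]_n -> C) : holomorphic_on Omega f ->
    measurable_fun (cdom Omega) (fun t => (normc (f (of_coords t)) ^+ 2)%:E).
  move=> hf; have ct := tuple_continuous_hol hf.
  apply/measurable_EFinP; apply: measurable_normc_sq.
    exact: (measurable_nonexpansive_tuple (@Re_dist R)).
  exact: (measurable_nonexpansive_tuple (@Im_dist R)).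
have le : (L2norm_sq Omega (fun x => (F x * K x)%R) <= (c * L2n Omega K)%:E)%E.
  rewrite EFinM -(L2norm_sqE oO BK) /L2norm_sq -ge0_integralZl//; last 2 first.
  - exact: (mn K hK').
  - by move=> t _; rewrite lee_fin sqr_ge0.
  apply: ge0_le_integral => //.
  - by move=> t _; rewrite lee_fin sqr_ge0.
  - exact: (mn _ hFK).
  - by apply: measurable_funeM; exact: (mn K hK').
  - move=> t Ot; rewrite -EFinM lee_fin Normc.normcM exprMn ler_wpM2r ?sqr_ge0//.
    exact: Fc.
have Bm : bergman_space Omega (fun x => F x * K x).
  by split=> //; apply: le_lt_trans le _; exact: ltry.
by split=> //; rewrite -lee_fin -(L2norm_sqE oO Bm).
Qed.

Lemma diff_mul_zero (F K : 'rV[C]_n -> C) z X : differentiable F z -> differentiable K z -> F z = 0 ->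
  'd (fun x => F x * K x) z X = K z * 'd F z X.
Proof.
move=> dF dK F0.
apply: etrans (congr1 (fun L : 'rV[C]_n -> C => L X) (@diffM _ _ F K z dF dK)) _.
exact: etrans (congr1 (fun a : R[i] => a * 'd K z X + K z * 'd F z X) F0)
  (etrans (congr1 (fun a : R[i] => a + K z * 'd F z X) (mul0r _)) (add0r _)).
Qed.

(** The factor [k] may vanish: early partial sums of the kernel can be 0 at the given point. *)
Lemma cancel_square_le (k m r : R) : 0 <= k -> 0 <= r -> k ^+ 2 * m <= k * r ->
  k * m <= r.
Proof.
move=> k0 r0; have [->|kn] := eqVneq k 0; first by rewrite !mul0r.
by rewrite expr2 -mulrA ler_pM2l// lt_neqAle eq_sym kn.
Qed.

(* Test function: F times a partial sum of B(., z), whose norm and value at z coincide. *)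
Lemma bounded_diff_le_metric (F : 'rV[C]_n -> C) z X (c : R) : holomorphic_on Omega F -> 0 <= c ->
  (forall x, Omega x -> normc (F x) ^+ 2 <= c) -> Omega z -> F z = 0 ->
  normc ('d F z X) ^+ 2 <= c * Re (bergman_metric B z X X).
Proof.
move=> hF c0 Fc Oz F0; set g := Re (bergman_metric B z X X).
have S0 := hS Oz; have [_ g0] := metric_real X Oz.
pose a j : C := (phi j z)^*%C.
pose k N : R := \sum_(0 <= j < N | J j) normc (phi j z) ^+ 2.
have kE N : comb a N z = (k N)%:C.
  by rewrite rmorph_sum; apply: eq_bigr => j _; rewrite mulrC mulcJ.
have k0 N : 0 <= k N by exact: sum_sqr_ge0.
have kn N : L2n Omega (comb a N) = k N.
  by rewrite (comb_L2n); apply: eq_bigr => j _; rewrite normcJ.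
(* The metric inequality carries (k N)^2 on the left and k N on the right; one power cancels, and
   the remaining one tends to [S z]. *)
have main N : k N * normc ('d F z X) ^+ 2 <= c * g * S z.
  apply: cancel_square_le => //; first by rewrite !mulr_ge0// ltW.
  have BN := comb_bergman a N; have [hN _] := BN.
  have [Bm Lm] := bergman_mul hF c0 Fc BN.
  have m0 : F z * comb a N z = 0 by rewrite F0 mul0r.
  have := metric_inequality X Bm Oz m0.
  have E := diff_mul_zero X (hF _ Oz) (hN _ Oz) F0.
  have E2 : normc ('d (fun x => F x * comb a N x) z X) ^+ 2 =
      k N ^+ 2 * normc ('d F z X) ^+ 2.
    apply: etrans (congr1 (fun b : R[i] => normc b ^+ 2) E) _.
    by rewrite Normc.normcM exprMn kE normc_real ger0_norm.
  move=> h; apply: le_trans (le_of_eq (esym E2)) _; apply: le_trans h _.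
  apply: (@le_trans _ _ (c * k N * (g * S z))).
    by rewrite ler_wpM2r ?mulr_ge0 ?(ltW S0)// -kn.
  by apply: le_of_eq; ring.
have h : ccvg (fun N => (normc ('d F z X) ^+ 2 * k N)%:C) (normc ('d F z X) ^+ 2 * S z)%:C.
  have := ccvgZ (normc ('d F z X) ^+ 2)%:C (kernel_diag_cvg Oz).
  by rewrite -rmorphM; apply: eq_ccvg => N; rewrite -rmorphM.
have := ccvg_le h (M := c * g * S z).
rewrite normc_real => /(_ _)/(le_trans (ler_norm _)) H.
rewrite -(ler_pM2r S0); apply: H => N.
rewrite normc_real ger0_norm; first by rewrite mulrC; exact: main.
by rewrite mulr_ge0 ?sqr_ge0.
Qed.

(** * Absence of zeros of the kernel *)

Hypothesis bO : bounded_set Omega.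
Hypothesis cO : connected Omega.

Lemma kernel_diag_lower_bound : exists2 L : R, 0 <= L &
  forall x, Omega x -> (S x)^-1 <= L.
Proof.
exists (L2n Omega (fun=> 1 : C)); first exact: L2n_ge0.
move=> x Ox; have := eval_le_kernel (bergman_one oO bO) Ox.
by rewrite Normc.normc1 expr1n -[_^-1]mul1r ler_pdivrMr// hS.
Qed.

(** In [bergman_metricE] with equal vectors the subtracted product is |d|^2 >= 0, so it may be
    dropped from an upper bound. *)
Lemma metric_le_diff x v (K : R) : Omega x ->
  (forall N, \sum_(0 <= j < N | J j) normc ('d (phi j) x v) ^+ 2 <= K) ->
  Re (bergman_metric B x v v) <= K / S x.
Proof.
move=> Ox HKx; have S0 := hS Ox; have S1 : S x != 0 by rewrite gt_eqF.
have [_ HG] := dkernel_hol v Ox.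
have G : normc ('d (dk v x) x v) <= K.
  apply: (ccvg_le (HG x v Ox)) => N.
  rewrite (_ : \sum_(0 <= j < N | J j) ('d (phi j) x v)^*%C * 'd (phi j) x v =
    (\sum_(0 <= j < N | J j) normc ('d (phi j) x v) ^+ 2)%:C); last first.
    by rewrite rmorph_sum; apply: eq_bigr => j _; rewrite mulrC mulcJ.
  by rewrite normc_real ger0_norm ?sum_sqr_ge0.
have E := bergman_metricE v v Ox.
have aux (g d : R[i]) (s : R) : 0 < s -> normc g <= K ->
    Re ((g * s%:C - d^*%C * d) / s%:C ^+ 2) <= K / s.
  move=> s0 gK; rewrite [d^*%C * d]mulrC mulcJ -rmorphXn -fmorphV ReM /= mulr0 subr0.
  rewrite ReD ReN ReM /= mulr0 subr0 ler_pdivrMr ?exprn_gt0//.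
  have -> : K / s * s ^+ 2 = K * s by rewrite expr2 mulrA divfK ?gt_eqF.
  apply: (@le_trans _ _ (Re g * s)); first by rewrite gerBl sqr_ge0.
  rewrite ler_pM2r//; apply: le_trans gK; apply: le_trans (Re_le_normc _).
  exact: ler_norm.
exact: le_trans (le_of_eq (congr1 (@complex.Re R) E)) (aux _ _ _ S0 G).
Qed.

Variable alpha : R.
Hypothesis alpha0 : 0 < alpha.
Hypothesis logP_bound : forall w zeta Y, Omega w -> Omega zeta -> B w zeta != 0 ->
  alpha * normc (dpartial Y (fun x => (ln (berezin B x zeta))%:C) w) ^+ 2 <=
  Re (bergman_metric B w Y Y).

(** Phrased for P rather than log P so as to include the zeros of B(., zeta), where |B|^2 vanishes
    together with its derivative. Elsewhere P'/P is twice the real part of the logarithmic gradient,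
    which the hypothesis bounds. *)
Lemma berezin_derive_bound w zeta v (c : R) : Omega w -> Omega zeta -> 0 <= c ->
  Re (bergman_metric B w v v) <= alpha * c ^+ 2 ->
  exists m, is_derive (0 : R) (1 : R) (fun t => berezin B (w + (t%:C : C) *: v) zeta) m /\
    `|m| <= 2 * c * berezin B w zeta.
Proof.
move=> Ow Oz c0 gc; have S0 := hS Ow; have Sn0 : S w != 0 by rewrite gt_eqF.
have := berezin_is_derive v Ow Oz.
set m := (X in is_derive _ _ _ X -> _) => H; exists m; split; first exact: H.
have [b0|b0] := eqVneq (B w zeta) 0.
  rewrite /m /berezin b0.
  have -> : Re (0 * ('d (B ^~ zeta) w v)^*%C) = 0 by rewrite mul0r.
  by rewrite Normc.normc0 expr0n /= !(mul0r, mulr0) addr0 normr0.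
have P0 : 0 < berezin B w zeta by rewrite /berezin divr_gt0// exprn_gt0// normc_gt0.
pose T : R[i] := 'd (B ^~ zeta) w v / B w zeta - 'd (B ^~ w) w v / (S w)%:C.
have mT : m / berezin B w zeta = 2 * Re T.
  apply: (@complexI R); rewrite -addcJ.
  apply: etrans (logP_derivative _ _ b0 Sn0); congr (_%:C).
  by congr (_ / _); rewrite /m; ring.
have Tc : normc T <= c.
  rewrite -(@ler_pXn2r _ 2) ?nnegrE ?normc_ge0//.
  rewrite -(ler_pM2l alpha0); apply: le_trans gc; apply: le_trans (logP_bound v Ow Oz b0).
  apply: le_of_eq; congr (_ * normc _ ^+ 2).
  exact: esym (dpartial_lnP v Ow Oz b0).
have -> : m = 2 * Re T * berezin B w zeta by rewrite -mT divfK// gt_eqF.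
rewrite normrM (ger0_norm (ltW P0)) ler_wpM2r ?(ltW P0)// normrM ger0_norm//.
by rewrite ler_wpM2l//; apply: le_trans (Re_le_normc _) Tc.
Qed.

(* The metric is bounded near q, so |h'| <= 2 c h for the Berezin kernel h along segments: by Gronwall a zero would propagate. *)
Lemma kernel_neq0_local q zeta : Omega q -> Omega zeta -> exists2 r : R, 0 < r &
  forall x y, vn (x - q) < r -> vn (y - q) < r ->
    Omega x /\ (B x zeta != 0 -> B y zeta != 0).
Proof.
move=> Oq Oz; have [r [K [r0 K0 HO HK]]] := comb_eval_bound Oq.
have [L L0 HL] := kernel_diag_lower_bound.
exists r => // x y xq yq; split; first exact: HO.
pose v := y - x.
(* Convexity of balls; [t = 1] is separate because the strict inequality is otherwise obtained from
   the weight 1 - t. *)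
have inball (t : R) : 0 <= t <= 1 -> vn (x + (t%:C : C) *: v - q) < r.
  move=> /andP[t0 t1].
  have -> : x + (t%:C : C) *: v - q =
      ((1 - t)%:C : C) *: (x - q) + (t%:C : C) *: (y - q).
    rewrite rmorphB rmorph1 /v scalerBl scale1r !scalerBr.
    by apply/rowP => j; rewrite !mxE; ring.
  apply: le_lt_trans (vnD _ _) _; rewrite !vnZ !normc_real !ger0_norm ?subr_ge0//.
  have [t10|t1'] := eqVneq t 1; first by rewrite t10 subrr mul0r add0r mul1r.
  have h1 : (1 - t) * vn (x - q) < (1 - t) * r.
    by rewrite ltr_pM2l// subr_gt0 lt_neqAle t1'.
  have h2 : t * vn (y - q) <= t * r by rewrite ler_wpM2l// ltW.
  by move: h1 h2; lra.
(* Chosen so that alpha c^2 is exactly the bound K |v|^2 L for the metric along the segment. *)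
pose c := Num.sqrt (K * vn v ^+ 2 * L / alpha).
have c20 : 0 <= K * vn v ^+ 2 * L / alpha.
  exact: divr_ge0 (mulr_ge0 (mulr_ge0 K0 (sqr_ge0 _)) L0) (ltW alpha0).
have c0 : 0 <= c := sqrtr_ge0 _.
have gc (t : R) : 0 <= t <= 1 ->
    Re (bergman_metric B (x + (t%:C : C) *: v) v v) <= alpha * c ^+ 2.
  move=> t01; have tq := inball t t01; have Ot := HO _ tq; have [_ _ D] := HK _ tq.
  apply: le_trans (metric_le_diff Ot (fun N => D N v)) _.
  rewrite sqr_sqrtr// [alpha * _]mulrC divfK ?gt_eqF//.
  exact: ler_wpM2l (mulr_ge0 K0 (sqr_ge0 _)) _ _ (HL _ Ot).
pose h t := berezin B (x + (t%:C : C) *: v) zeta.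
(* Outside [0, 1] the derivative gets the arbitrary value 0; Gronwall only looks inside the
   interval. *)
have /choice[dh Hdh] : forall t : R, exists m, 0 <= t <= 1 ->
    is_derive t (1 : R) h m /\ `|m| <= 2 * c * h t.
  move=> t; have [t01|] := boolP (0 <= t <= 1); last by exists 0.
  have [m [Hm mb]] := berezin_derive_bound (HO _ (inball t t01)) Oz c0 (gc t t01).
  have E : (fun s => h (t + s)) =
      (fun s => berezin B (x + (t%:C : C) *: v + (s%:C : C) *: v) zeta).
    apply/funext => s; apply: (congr1 (fun p => berezin B p zeta)).
    by rewrite rmorphD scalerDl addrA.
  exists m => _; split; last exact: mb.
  exact: is_derive_shift0 (eq_ind_r (fun g => is_derive (0 : R) (1 : R) g m) Hm E).
have S0 := hS (HO _ xq); have Sy0 := hS (HO _ yq).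
move=> Bx; have h0 : 0 < h 0.
  by rewrite /h line0 /berezin divr_gt0// exprn_gt0// normc_gt0.
have := gronwall_gt0 (fun t t01 => (Hdh t t01).1) (fun t t01 => (Hdh t t01).2) h0.
have -> : h 1 = berezin B y zeta.
  by rewrite /h rmorph1 scale1r /v addrC subrK.
by rewrite /berezin; apply: contraTneq => ->; rewrite Normc.normc0 expr0n mul0r ltxx.
Qed.

(** The zero-free part contains [zeta] because B(zeta, zeta) > 0. Since the local statement is
    symmetric in its two points, it propagates zeros as well as nonzeros, so both parts of [Omega]
    are open and connectedness concludes. *)
Lemma kernel_neq0 w zeta : Omega w -> Omega zeta -> B w zeta != 0.
Proof.
move=> Ow Oz.
pose U := Omega `&` [set x | B x zeta != 0].
suff UE : U = Omega by have : U w by [rewrite UE]; case.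
have locP x (Ox : Omega x) := kernel_neq0_local Ox Oz.
have xx x (r : R) : 0 < r -> vn (x - x) < r by rewrite subrr vn0.
have oU : open U.
  rewrite openE => x [Ox Bx]; have [r r0 Hr] := locP x Ox.
  apply: (vn_nbhs r0) => y yx; have [Oy _] := Hr y x yx (xx _ _ r0).
  by split=> //; exact: (Hr x y (xx _ _ r0) yx).2.
have oV : open (Omega `&` [set x | B x zeta == 0]).
  rewrite openE => x [Ox /= /eqP Bx]; have [r r0 Hr] := locP x Ox.
  apply: (vn_nbhs r0) => y yx; have [Oy H] := Hr y x yx (xx _ _ r0).
  split=> //=; apply/negPn/negP => /H; by rewrite Bx eqxx.
apply: cO.
- exists zeta; split=> //=; have := hS Oz; apply: contraTneq => ->.
  by rewrite ltxx.
- by exists U => //; rewrite setIA setIid.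
- exists (~` (Omega `&` [set x | B x zeta == 0])); first exact: open_closedC.
  apply/seteqP; split=> x [Ox].
    by move=> Bx; split=> // -[_ /= /eqP]; apply/eqP.
  by move=> H; split=> //=; apply/negP => /eqP Bx; apply: H; split=> //=; rewrite Bx.
Qed.

(** * The conjugated logarithmic gradient *)

Hypothesis hN : forall x y, Omega x -> Omega y -> B x y != 0.

Definition log_gradient w Y zeta : C :=
  (dpartial Y (fun x => (ln (berezin B x zeta))%:C) w)^*%C.

(** Closed form of [log_gradient]: conjugation replaces B(w, zeta) by B(zeta, w), which is
    holomorphic in [zeta]. *)
Definition log_gradient_kernel w Y zeta : C :=
  dk Y w zeta * (B zeta w)^-1 - dk Y w w / (S w)%:C.

Lemma log_gradientE w Y zeta : Omega w -> Omega zeta ->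
  log_gradient w Y zeta = log_gradient_kernel w Y zeta.
Proof.
move=> Ow Oz; apply: etrans (congr1 (fun a : R[i] => a^*%C)
  (dpartial_lnP Y Ow Oz (hN Ow Oz))) _.
have aux (a b c : R[i]) (s : R) : (a / b - c / s%:C)^*%C =
    a^*%C * (b^*%C)^-1 - c^*%C / s%:C.
  rewrite rmorphB !rmorphM !fmorphV; congr (_ - _ / _).
  by apply: complex_eqP; rewrite /= ?oppr0.
apply: etrans (aux _ _ _ _) _.
rewrite /log_gradient_kernel (kernel_herm Ow Oz).
by [].
Qed.

Lemma log_gradient_diff w Y zeta : Omega w -> Omega zeta ->
  differentiable (log_gradient_kernel w Y) zeta.
Proof.
move=> Ow Oz; have d1 := (dkernel_hol Y Ow).1 zeta Oz.
have d2 := (kernel_hol Ow).1 zeta Oz.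
apply: (@differentiableB _ _ _ (fun x => dk Y w x * (B x w)^-1) (cst (dk Y w w / (S w)%:C))).
  apply: (@differentiableM _ _ (dk Y w) (fun x => (B x w)^-1)) => //.
  by apply: (@differentiableV _ _ (B ^~ w)) => //; exact: hN.
exact: differentiable_cst.
Qed.

Lemma quotient_derivative (a b p q : R[i]) (s : R) : s != 0 -> b = s%:C ->
  a * (- b ^- 2 * q) + b^-1 * p - 0 = (p * s%:C - a * q) / s%:C ^+ 2.
Proof.
move=> s0 ->; have : s%:C != 0 by rewrite fmorph_eq0.
by move: (s%:C) => t t0; field.
Qed.

(** The right side is the expression of [bergman_metricE]: differentiating the gradient in [zeta] at
    the base point recovers the metric of [v] and [Y]. *)
Lemma diff_log_gradient w Y v : Omega w ->
  'd (log_gradient_kernel w Y) w v =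
  ('d (dk Y w) w v * (S w)%:C - dk Y w w * 'd (B ^~ w) w v) / (S w)%:C ^+ 2.
Proof.
move=> Ow; have d1 := (dkernel_hol Y Ow).1 w Ow.
have d2 := (kernel_hol Ow).1 w Ow; have b0 := hN Ow Ow.
have dV := @differentiableV _ _ (B ^~ w) w d2 b0.
have dM := @differentiableM _ _ (dk Y w) (fun x => (B x w)^-1) w d1 dV.
have E0 : 'd (log_gradient_kernel w Y) w v = 'd (fun x => dk Y w x * (B x w)^-1) w v - 0.
  apply: etrans (congr1 (fun L : 'rV[C]_n -> C => L v)
    (@diffB _ _ _ (fun x => dk Y w x * (B x w)^-1) (cst (dk Y w w / (S w)%:C)) w
      dM (differentiable_cst _ _))) _.
  apply: (congr1 (fun a : R[i] => 'd (fun x => dk Y w x * (B x w)^-1) w v - a)).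
  by rewrite diff_cst.
have E1 : 'd (fun x => dk Y w x * (B x w)^-1) w v =
   dk Y w w * 'd (fun x => (B x w)^-1) w v + (B w w)^-1 * 'd (dk Y w) w v :=
  congr1 (fun L : 'rV[C]_n -> C => L v) (@diffM _ _ (dk Y w) (fun x => (B x w)^-1) w d1 dV).
have E2 : 'd (fun x => (B x w)^-1) w v = - (B w w) ^- 2 * 'd (B ^~ w) w v :=
  congr1 (fun L : 'rV[C]_n -> C => L v) (@diffV _ _ (B ^~ w) w d2 b0).
apply: etrans E0 _; apply: etrans (congr1 (fun a : R[i] => a - 0) E1) _.
apply: etrans (congr1 (fun a : R[i] => dk Y w w * a + (B w w)^-1 * 'd (dk Y w) w v - 0) E2) _.
apply: quotient_derivative; last exact: (kernel_diag Ow).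
by rewrite gt_eqF// hS.
Qed.

Lemma log_gradient_diag w Y : Omega w -> log_gradient_kernel w Y w = 0.
Proof.
by move=> Ow; rewrite /log_gradient_kernel {1}(kernel_diag Ow) subrr.
Qed.

End BergmanKernel.

Theorem corollary3p8 (R : realType) (n m : nat)
    (Omega1 : set 'rV[Cplx R]_n) (Omega2 : set 'rV[Cplx R]_m)
    (B1 : 'rV[Cplx R]_n -> 'rV[Cplx R]_n -> Cplx R)
    (B2 : 'rV[Cplx R]_m -> 'rV[Cplx R]_m -> Cplx R) (alpha : R) :
  bounded_domain Omega1 -> bounded_domain Omega2 ->
  is_bergman_kernel Omega1 B1 -> is_bergman_kernel Omega2 B2 ->
  0 < alpha ->
  (forall w zeta Y : 'rV[Cplx R]_m, Omega2 w -> Omega2 zeta ->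
     berezin B2 w zeta != 0 ->
     (alpha%:C : Cplx R) *
       `|dpartial Y (fun x => (ln (berezin B2 x zeta))%:C) w| ^+ 2 <=
     bergman_metric B2 w Y Y *
       ((1 - ((Normc.normc (B2 w zeta)) ^+ 2 /
              (complex.Re (B2 w w) * complex.Re (B2 zeta zeta))) `^ alpha)%:C
        : Cplx R)) ->
  forall f : 'rV[Cplx R]_n -> 'rV[Cplx R]_m,
    holomorphic_on Omega1 f -> (forall z, Omega1 z -> Omega2 (f z)) ->
    forall z X : 'rV[Cplx R]_n, Omega1 z ->
      bergman_metric B2 (f z) ('d f z X) ('d f z X) <=
      ((alpha^-1)%:C : Cplx R) * bergman_metric B1 z X X.
Proof.
move=> [_ oO1 _ bO1] [_ oO2 cO2 bO2] [J1 [phi1 [hB1 hK1]]] [J2 [phi2 [hB2 hK2]]].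
move=> alpha0 H f hf fO z X Oz.
have hS1 x (Ox : Omega1 x) := kernel_diag_gt0 oO1 hB1 hK1 bO1 Ox.
have hS2 x (Ox : Omega2 x) := kernel_diag_gt0 oO2 hB2 hK2 bO2 Ox.
have bound w zeta Y : Omega2 w -> Omega2 zeta -> B2 w zeta != 0 ->
    alpha * normc (dpartial Y (fun x => (ln (berezin B2 x zeta))%:C) w) ^+ 2 <=
    Re (bergman_metric B2 w Y Y).
  move=> Ow Ozeta b0; have [gE g0] := metric_real oO2 hB2 hK2 hS2 Y Ow.
  have p0 : berezin B2 w zeta != 0.
    by rewrite gt_eqF// /berezin divr_gt0 ?hS2// exprn_gt0// normc_gt0.
  have := H w zeta Y Ow Ozeta p0; rewrite [in X in _ <= X -> _]gE normcE.
  rewrite -rmorphXn -!rmorphM lecR => h; apply: le_trans h _.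
  (* The last factor is at most 1 because the real power is nonnegative. *)
  by rewrite ler_piMr// gerBl powR_ge0.
have hN := kernel_neq0 oO2 hB2 hK2 hS2 bO2 cO2 alpha0 bound.
set w := f z; set Y := 'd f z X.
have Ow : Omega2 w := fO z Oz.
have [g2E g20] := metric_real oO2 hB2 hK2 hS2 Y Ow.
have [g1E g10] := metric_real oO1 hB1 hK1 hS1 X Oz.
set g2 := Re (bergman_metric B2 w Y Y) in g2E g20 *.
set g1 := Re (bergman_metric B1 z X X) in g1E g10 *.
pose F := log_gradient_kernel B2 w Y \o f.
have dG zeta (Ozeta : Omega2 zeta) := log_gradient_diff oO2 hB2 hK2 hN Y Ow Ozeta.
have hF : holomorphic_on Omega1 F.
  move=> x Ox; exact: (differentiable_comp (hf x Ox) (dG _ (fO x Ox))).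
have Fb x : Omega1 x -> normc (F x) ^+ 2 <= g2 / alpha.
  move=> Ox; have Ofx := fO x Ox; rewrite ler_pdivlMr// mulrC.
  (* The bound is applied with base point [w] and second argument [f x]; conjugation does not change
     the modulus. *)
  apply: le_trans (bound w (f x) Y Ow Ofx (hN _ _ Ow Ofx)); apply: le_of_eq.
  congr (_ * _ ^+ 2); rewrite -[RHS]normcJ; congr normc.
  exact: esym (log_gradientE oO2 hB2 hK2 hS2 hN Y Ow Ofx).
have c0 : 0 <= g2 / alpha by rewrite divr_ge0// ltW.
have Fz : F z = 0 := log_gradient_diag hK2 Y Ow.
have main := bounded_diff_le_metric oO1 hB1 hK1 hS1 X hF c0 Fb Oz Fz.
(* By the chain rule the gradient is differentiated at [w] along [Y], the image of [X], so both
   arguments of the metric are [Y]. *)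
have dF : 'd F z X = g2%:C.
  apply: etrans (congr1 (fun L : 'rV[Cplx R]_n -> Cplx R => L X)
    (diff_comp (hf z Oz) (dG w Ow))) _.
  apply: etrans (diff_log_gradient oO2 hB2 hK2 hS2 hN Y Y Ow) _.
  exact: etrans (esym (bergman_metricE oO2 hB2 hK2 hS2 Y Y Ow)) g2E.
have E : normc ('d F z X) ^+ 2 = g2 ^+ 2.
  by apply: etrans (congr1 (fun a : R[i] => normc a ^+ 2) dF) _; rewrite normc_real ger0_norm.
have fin : g2 ^+ 2 <= g2 / alpha * g1 := le_trans (le_of_eq (esym E)) main.
rewrite g2E g1E -rmorphM lecR.
(* One factor [g2] is to be cancelled; when it vanishes the claim reduces to nonnegativity of
   [g1]. *)
have [->|g2n] := eqVneq g2 0; first by rewrite mulr_ge0// invr_ge0 ltW.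
have g2p : 0 < g2 by rewrite lt_neqAle eq_sym g2n.
by move: fin; rewrite expr2 -mulrA ler_pM2l.
Qed.
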